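(* Let $\pi,\pi'$ be irreducible smooth $\psi_U$-generic representations of $\mathrm{Sp}_{2n}(F)$ with the same central character, let $v\in V_\pi$, $v'\in V_{\pi'}$ with $W_v(1)=W_{v'}(1)=1$, and let $C$ be a positive integer such that $\pi(k)v=v$ and $\pi'(k)v'=v'$ for all $k\in K_C$. Let $w\in\mathbf{W}$ with $w\le w_0$. Let $a_t$, $0\le t\le l(w)$, be integers with $a_0=0$ and $a_t\ge t+a_{t-1}$ for $1\le t\le l(w)$, and let $m$ be an integer with $m\ge 4^{a_{l(w)}}C$. (1) If $W_{v_k}(tw')=W_{v'_k}(tw')$ for all $w'<w$, all $k\ge 4^{a_{l(w')}}C$ and all $t\in T$, then $W_{v_m}(twu)=W_{v'_m}(twu)$ for all $t\in T$ and all $u\in U_w^-\setminus U^-_{w,m}$. (2) If $W_{v_k}(tw')=W_{v'_k}(tw')$ for all $w'\le w$, all $k\ge 4^{a_{l(w')}}C$ and all $t\in T$, then $W_{v_m}(g)=W_{v'_m}(g)$ for all $g\in BwB$.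
   Context: $F$ is a $p$-adic field, $\mathcal{O}$ its ring of integers, $\mathcal{P}$ its maximal ideal, $\varpi$ a uniformizer; $n>1$. $\mathrm{Sp}_{2n}(F)$ is the symplectic group of $\begin{pmatrix}0&J_n\\-J_n&0\end{pmatrix}$ ($J_n$ the antidiagonal matrix of ones). $U$ = upper triangular unipotent subgroup, $T$ = diagonal torus $t=\mathrm{diag}(a_1,\dots,a_n,a_n^{-1},\dots,a_1^{-1})$, $B=TU$. Simple roots $\alpha_i(t)=a_i/a_{i+1}$ ($1\le i\le n-1$), $\beta(t)=a_n^2$; $\Sigma^+$ the positive roots, $U_\gamma$ the root subgroup of $\gamma$. $\psi$ is an additive character of $F$ with conductor $\mathcal{O}$, $\psi_U((u_{ij}))=\psi(\sum_{i=1}^nu_{i,i+1})$. For an irreducible $\psi_U$-generic $\pi$ fix a nonzero $\lambda_\pi\in\mathrm{Hom}_U(\pi,\psi_U)$ and set $W_v(g)=\lambda_\pi(\pi(g)v)$ (similarly for $\pi'$). For $m\ge1$: $K_m=(I_{2n}+\mathrm{Mat}_{2n}(\mathcal{P}^m))\cap\mathrm{Sp}_{2n}(F)$; $\tau_m((k_{ij}))=\psi(\varpi^{-2m}\sum_{i=1}^nk_{i,i+1})$ on $K_m$; $d_m=\mathrm{diag}(\varpi^{-(2n-1)m},\varpi^{-(2n-3)m},\dots,\varpi^{-m},\varpi^{m},\dots,\varpi^{(2n-1)m})$; $H_m=d_mK_md_m^{-1}$; $\psi_m(h)=\tau_m(d_m^{-1}hd_m)$; $U_m=U\cap H_m$;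 Howe vectors $v_m=\mathrm{vol}(U_m)^{-1}\int_{U_m}\psi_m(u)^{-1}\pi(u)v\,du$, and $v'_m$ likewise. $\mathbf{W}=N(T)/T$ is the Weyl group, generated by the simple reflections $s_{\alpha_i},s_\beta$; expressions $W(tw)$ are evaluated at a fixed representative of $w$ in $N(T)$ (the statements are for all $t\in T$). $l(w)$ is the length; the Bruhat order: $w'\le w$ if $w'$ is a subexpression of a reduced expression of $w$, $w'<w$ if moreover $w'\ne w$. $w_0=s_{\alpha_1}\cdots s_{\alpha_{n-1}}s_\beta s_{\alpha_{n-1}}\cdots s_{\alpha_1}$ (the reflection in $2(\alpha_1+\dots+\alpha_{n-1})+\beta$). $\Sigma_w^-=\{\gamma\in\Sigma^+:w(\gamma)<0\}$, $U_w^-=\prod_{\gamma\in\Sigma_w^-}U_\gamma$, $U_{w,m}^-=U_w^-\cap H_m$. *)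

(* Defs.v *)
From HB Require Import structures.
From mathcomp Require Import all_boot all_order fingroup perm all_algebra.
From mathcomp Require Import all_classical all_reals all_analysis.
From mathcomp Require Import complex.

Set Implicit Arguments.
Unset Strict Implicit.
Unset Printing Implicit Defensive.

Import Order.TTheory GRing.Theory Num.Theory.

Local Open Scope classical_set_scope.
Local Open Scope ring_scope.

(* A p-adic field: a field of characteristic 0, complete for a normalized
   discrete valuation with finite residue field, with the valuation topology.
   The value of [pval] at 0 is irrelevant. *)
HB.mixin Record isPadicField F & GRing.Field F & Uniform F := {
  pval : F -> int;
  pvalM : forall x y : F, x != 0 -> y != 0 -> pval (x * y) = pval x + pval y;
  pvalD : forall x y : F, x != 0 -> y != 0 -> x + y != 0 ->
    Num.min (pval x) (pval y) <= pval (x + y);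
  pval_normalized : exists2 x : F, x != 0 & pval x = 1;
  padic_entourageE : forall A : set (F * F), entourage A <->
    exists k : int, forall x y : F, (x - y = 0 \/ k <= pval (x - y)) -> A (x, y);
  padic_complete : forall G : set_system F, ProperFilter G -> cauchy G ->
    exists l : F, G --> l;
  padic_residue_finite :
    finite_set [set [set y : F | y - x = 0 \/ 1 <= pval (y - x)] |
                 x in [set x : F | x = 0 \/ 0 <= pval x]];
  padic_pchar0 : [pchar F] =i pred0 }.

#[short(type="padicFieldType")]
HB.structure Definition PadicField :=
  {F of GRing.Field F & Uniform F & isPadicField F}.

(* [Pointed] cannot be a superclass of [PadicField]: HB would then require a join
   of [Pointed] and [Algebra.BaseAddMagma] declared before the normed structures
   of the library. *)
#[non_forgetful_inheritance]
HB.instance Definition _ (F : padicFieldType) := isPointed.Build F 0.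

Section PadicFieldDefs.
Variable F : padicFieldType.

(* The fractional ideal P^k; in particular [pideal F 0] is O. *)
Definition pideal (k : int) : set F := [set x | x = 0 \/ k <= pval x].

Definition uniformizer (x : F) : Prop := x != 0 /\ pval x = 1.

(* [psi_trivial_O] makes [psi] locally constant, hence continuous. *)
Record additive_character_of_conductor_O (R : rcfType) (psi : F -> R[i])
    : Prop := {
  psi_neq0 : forall x, psi x != 0;
  psiD : forall x y, psi (x + y) = psi x * psi y;
  psi_trivial_O : forall x, pideal 0 x -> psi x = 1;
  psi_conductor : exists2 x, pideal (-1) x & psi x != 1 }.

End PadicFieldDefs.

Section Symplectic.
Variables (F : padicFieldType) (n : nat).
Local Notation M := 'M[F]_(n + n).

Definition Jn : 'M[F]_n := \matrix_(i, j) (j == rev_ord i)%:R.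

Definition symp_form : M := block_mx 0 Jn (- Jn) 0.

Definition Sp : set M := [set g | g^T *m symp_form *m g = symp_form].

Definition Sp_center : set M :=
  [set z | Sp z /\ forall g, Sp g -> z *m g = g *m z].

Definition Uni : set M := [set u | [/\ Sp u, forall i, u i i = 1 &
  forall i j : 'I_(n + n), (j < i)%N -> u i j = 0]].

Definition Tor : set M := [set t | exists2 a : 'rV[F]_n,
  (forall i, a 0 i != 0) &
  t = diag_mx (row_mx a (\row_i (a 0 (rev_ord i))^-1))].

Definition Bor : set M := [set g | exists t u, [/\ Tor t, Uni u & g = t *m u]].

(* The sum of the entries (i, i+1) for 1 <= i <= n (with 1-based indices). *)
Definition superdiag (g : M) : F :=
  \sum_(i < n) g (lshift n i) (ordS (lshift n i)).

(** Weyl group: its elements are the cosets of T in N(T). *)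

Definition NTor : set M :=
  [set g | Sp g /\ forall t, Tor t <-> Tor (g *m t *m invmx g)].

Definition Tcoset (g : M) : set M := [set g *m t | t in Tor].

Definition weyl : set (set M) := [set Tcoset g | g in NTor].

(* Representatives of the simple reflections: [simple_refl i] represents
   s_{alpha_{i+1}} if i < n - 1 and s_beta if i = n - 1. *)
Definition simple_refl (i : 'I_n) : M :=
  let p := lshift n i in let q := ordS p in
  if (i.+1 < n)%N
  then perm_mx (tperm p q) *m perm_mx (tperm (rev_ord p) (rev_ord q))
  else \matrix_(j, k)
    (if (j == p) && (k == q) then 1
     else if (j == q) && (k == p) then -1
     else ((j == k) && (j != p) && (j != q))%:R).

Definition word_mx (s : seq 'I_n) : M :=
  \big[mulmx/1%:M]_(i <- s) simple_refl i.

Definition weyl_word (s : seq 'I_n) : set M := Tcoset (word_mx s).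

Definition weyl_length (w : set M) : nat :=
  xget 0%N [set k | (exists2 s, size s = k & weyl_word s = w) /\
                    forall s, weyl_word s = w -> (k <= size s)%N].

Definition reduced_word (w : set M) (s : seq 'I_n) : Prop :=
  weyl_word s = w /\ size s = weyl_length w.

Definition bruhat_le (w' w : set M) : Prop :=
  exists s s', [/\ reduced_word w s, subseq s' s & w' = weyl_word s'].

Definition bruhat_lt (w' w : set M) : Prop := bruhat_le w' w /\ w' <> w.

Definition w0 : set M :=
  weyl_word (enum 'I_n ++ behead (rev (enum 'I_n))).

(** Roots: [g : {ffun 'I_n -> int}] stands for the rational character
    t |-> \prod_i a_i ^ (g i) of T. *)

Local Notation chi := {ffun 'I_n -> int}.

Definition char_eval (g : chi) (t : M) : F :=
  \prod_(i < n) t (lshift n i) (lshift n i) ^ g i.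

Definition simple_root (i : 'I_n) : chi :=
  [ffun j : 'I_n => if (i.+1 < n)%N
                    then (j == i)%:Z - (j == i.+1 :> nat)%:Z
                    else 2 * (j == i)%:Z].

Definition sp_lie : set M :=
  [set X | X^T *m symp_form + symp_form *m X = 0].

Definition root_space (g : chi) : set M := [set X | sp_lie X /\
  forall t, Tor t -> t *m X *m invmx t = char_eval g t *: X].

Definition sp_root : set chi :=
  [set g | g != 0 /\ exists2 X, root_space g X & X != 0].

Definition pos_root : set chi :=
  [set g | sp_root g /\
           exists c : 'I_n -> nat, g = \sum_(i < n) simple_root i *+ c i].

(* Every X in a root space of sp_2n satisfies X ^ 2 = 0, so exp X = 1 + X. *)
Definition root_subgroup (g : chi) : set M :=
  [set 1%:M + X | X in root_space g].

(* d = w(g), i.e. d(t) = g(w^-1 t w) for all t. *)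
Definition weyl_act (w : set M) (g d : chi) : Prop :=
  forall x t, w x -> Tor t -> char_eval d t = char_eval g (invmx x *m t *m x).

Definition inv_roots (w : set M) : set chi :=
  [set g | pos_root g /\ exists2 d, pos_root d & weyl_act w g (- d)].

(* The product set of the root subgroups, for some enumeration of [inv_roots w];
   the product set does not depend on the enumeration. *)
Definition Uminus (w : set M) : set M :=
  [set u | exists (s : seq chi) (x : chi -> M),
    [/\ uniq s, [set` s] = inv_roots w,
        forall g, inv_roots w g -> root_subgroup g (x g) &
        u = \big[mulmx/1%:M]_(g <- s) x g]].

Definition bruhat_cell (x : M) : set M :=
  [set g | exists b1 b2, [/\ Bor b1, Bor b2 & g = b1 *m x *m b2]].

Definition Kgrp (m : nat) : set M :=
  [set k | Sp k /\ forall i j, pideal m%:Z ((k - 1%:M) i j)].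

Section Howe.
Variables (R : realType) (varpi : F) (psi : F -> R[i]).

Definition psiU (u : M) : R[i] := psi (superdiag u).

Definition tau (m : nat) (k : M) : R[i] :=
  psi (varpi ^ (- (2 * m)%N%:Z) * superdiag k).

(* With 0-based i the exponent of the i-th entry is (2i + 1 - 2n)m. *)
Definition dmx (m : nat) : M :=
  diag_mx (\row_(i < n + n)
             varpi ^ (((2 * i + 1)%N%:Z - (2 * n)%N%:Z) * m%:Z)).

Definition Hgrp (m : nat) : set M :=
  [set dmx m *m k *m invmx (dmx m) | k in Kgrp m].

Definition psiH (m : nat) (h : M) : R[i] :=
  tau m (invmx (dmx m) *m h *m dmx m).

Definition Um (m : nat) : set M := Uni `&` Hgrp m.

Definition Uminus_m (w : set M) (m : nat) : set M := Uminus w `&` Hgrp m.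

Definition borel_mx := g_sigma_algebraType (@open M).

(* A (left) Haar measure on a closed subgroup G of GL_2n(F), viewed as a Borel
   measure on the space of matrices concentrated on G. *)
Record haar_measure (G : set M) (mu : {measure set borel_mx -> \bar R})
    : Prop := {
  haar_conc : mu (~` G) = 0%E;
  haar_invariant : forall (g : M) (A : set borel_mx), G g -> measurable A ->
    mu [set g *m x | x in A] = mu A;
  haar_compact : forall K : set M, compact K -> K `<=` G -> (mu K < +oo)%E;
  haar_open : forall O : set M, open O -> O `&` G !=set0 ->
    (0 < mu (O `&` G))%E }.

(* The integral over A of a vector-valued function taking finitely many values
   on A: the sum of mu(A /\ f = x) x over these values. A locally constant
   function on a compact set is of this kind. *)
Definition vintegral (mu : {measure set borel_mx -> \bar R})
    (V : lmodType R[i]) (A : set M) (f : M -> V) : V :=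
  \sum_(x \in f @` A) (fine (mu (A `&` f @^-1` [set x])))%:C%C *: x.

Section Representation.
Variables (V : lmodType R[i]) (rho : M -> {linear V -> V}).

Record representation : Prop := {
  rep1 : forall v, rho 1%:M v = v;
  repM : forall g h, Sp g -> Sp h -> forall v, rho (g *m h) v = rho g (rho h v) }.

Definition smooth_rep : Prop := forall v, exists2 O : set M, open O &
  [set g | Sp g /\ rho g v = v] = Sp `&` O.

Record subrepresentation (S : set V) : Prop := {
  subrep0 : S 0;
  subrepD : forall x y, S x -> S y -> S (x + y);
  subrepZ : forall c x, S x -> S (c *: x);
  subrep_stable : forall g x, Sp g -> S x -> S (rho g x) }.

Definition irreducible_rep : Prop := (exists v : V, v != 0) /\
  forall S, subrepresentation S -> S = [set 0] \/ S = setT.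

Definition central_character (omega : M -> R[i]) : Prop :=
  forall z v, Sp_center z -> rho z v = omega z *: v.

Definition whittaker_functional (lambda : {scalar V}) : Prop :=
  (exists v, lambda v != 0) /\
  forall u v, Uni u -> lambda (rho u v) = psiU u * lambda v.

Definition whittaker (lambda : {scalar V}) (v : V) (g : M) : R[i] :=
  lambda (rho g v).

Definition howe_vector (mu : {measure set borel_mx -> \bar R})
    (m : nat) (v : V) : V :=
  ((fine (mu (Um m)))^-1)%:C%C *:
    vintegral mu (Um m) (fun u => (psiH m u)^-1 *: rho u v).

End Representation.
End Howe.
End Symplectic.

(* Main.v *)
(** For u in U, the map W_{v_m}(t w u) is an average over x in U_m of the values
    W_{v_k}(t w u x) with 3k <= m. Fix a reduced word of w and peel off its
    letters from the right: w u factors through elements s_i x_i(r_i). Either all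
    the r_i are so small that u lies in (U cap w^-1 U w) U_m, or some r_i is large
    and the SL_2 identity s x_alpha(r) = b x_{-alpha}(1/r) moves w u into a smaller
    Bruhat cell times a conjugate of a small negative root element x_{-gamma}(1/r)
    by H_m. Such conjugates lie in a lattice of matrices that is multiplicatively
    closed and has diagonal in 1 + P, so Gaussian elimination writes them as an
    upper triangular matrix times a lower unipotent element of H_k, which fixes the
    Howe vector v_k. Hence the value is controlled by smaller cells and one
    concludes by induction on subwords. If mu(U_m) is
    infinite, the normalizing factor vol(U_m)^-1 is 0 by convention and both Howe
    vectors vanish; if it is finite, positivity of mu on open subgroups makes the
    indices of the lattice subgroups finite, so integrals become coset sums. *)
From HB Require Import structures.
From mathcomp Require Import all_boot all_order fingroup perm all_algebra.
From mathcomp Require Import all_classical all_reals all_analysis.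
From mathcomp Require Import complex zify ring.
Require Import Defs.

Set Implicit Arguments.
Unset Strict Implicit.
Unset Printing Implicit Defensive.

Import Order.TTheory GRing.Theory Num.Theory.

Local Open Scope classical_set_scope.
Local Open Scope ring_scope.

(** The level has to drop from m to k because a conjugate of x_{-gamma}(1/r) by elements of H_m need
    not lie in H_m: that r misses its ideal gains one unit in the exponent of 1/r, and the bounds in
    [fK] can be worse than those of H_m by 2m - 1. Below the diagonal the exponents of H_m grow with
    m, so the loss is affordable for H_k once 3k <= m; the condition a_t >= t + a_{t-1} supplies a
    factor 4 from one length to the next. Averaging is what lets v_k enter: not lying in (U cap w^-1
    U w) U_m is a property of the coset u U_m, so every term of the average falls into the
    large-coordinate case. The argument runs on words instead of Weyl group elements. Subwords met
    on the way may fail to be reduced; the deletion property then passes to a shorter subword, so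
    the Bruhat order is used only in its subexpression form. Groups are described by exponents of
    matrix entries, with a function theta of the index recording d_m and the letters already
    read. *)

Section PadicIdeals.
Variable F : padicFieldType.
Implicit Types (x y : F) (k l : int).

(** * Fractional ideals of a p-adic field *)

Lemma pval1 : pval (1 : F) = 0.
Proof.
have := pvalM _ _ (oner_neq0 F) (oner_neq0 F); rewrite mulr1; move: (pval _) => y; lia.
Qed.

Lemma pvalN1 : pval (-1 : F) = 0.
Proof.
have n1 : (-1 : F) != 0 by rewrite oppr_eq0 oner_neq0.
have := pvalM _ _ n1 n1; rewrite mulrNN mulr1 pval1; move: (pval _) => y; lia.
Qed.

Lemma pvalV x : x != 0 -> pval x^-1 = - pval x.
Proof.
move=> x0; have := pvalM _ _ x0 (invr_neq0 x0).
by rewrite mulfV // pval1; move: (pval _) (pval _) => y z; lia.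
Qed.

Lemma pideal0 k : pideal k (0 : F). Proof. by left. Qed.

Lemma pideal1 k : k <= 0 -> pideal k (1 : F).
Proof. by move=> k0; right; rewrite pval1. Qed.

Lemma pideal_le k l x : l <= k -> pideal k x -> pideal l x.
Proof. by move=> lk [->|kx]; [left|right; apply: le_trans kx]. Qed.

Lemma pidealM k l x y : pideal k x -> pideal l y -> pideal (k + l) (x * y).
Proof.
move=> [->|kx]; first by rewrite mul0r; left.
move=> [->|ly]; first by rewrite mulr0; left.
have [->|x0] := eqVneq x 0; first by rewrite mul0r; left.
have [->|y0] := eqVneq y 0; first by rewrite mulr0; left.
by right; rewrite pvalM // lerD.
Qed.

Lemma pidealM_le k l j x y : j <= k + l ->
  pideal k x -> pideal l y -> pideal j (x * y).
Proof. by move=> h kx ly; apply: (pideal_le h); apply: pidealM. Qed.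

Lemma pidealD k x y : pideal k x -> pideal k y -> pideal k (x + y).
Proof.
move=> [->|kx]; first by rewrite add0r.
move=> [->|ky]; first by rewrite addr0; right.
have [->|x0] := eqVneq x 0; first by rewrite add0r; right.
have [->|y0] := eqVneq y 0; first by rewrite addr0; right.
have [->|xy0] := eqVneq (x + y) 0; first by left.
by right; apply: le_trans (pvalD _ _ x0 y0 xy0); rewrite le_min kx ky.
Qed.

Lemma pidealN k x : pideal k x -> pideal k (- x).
Proof.
move=> kx; rewrite -mulN1r -[k]add0r; apply: pidealM kx.
by right; rewrite pvalN1.
Qed.

Lemma pidealB k x y : pideal k x -> pideal k y -> pideal k (x - y).
Proof. by move=> kx ky; apply: pidealD kx (pidealN ky). Qed.

Lemma pideal_sum (I : Type) (r : seq I) (P : pred I) (G : I -> F) k :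
  (forall i, P i -> pideal k (G i)) -> pideal k (\sum_(i <- r | P i) G i).
Proof.
move=> kG; elim/big_rec: _ => [|i x Pi kx]; first exact: pideal0.
exact: pidealD (kG i Pi) kx.
Qed.

(** A valuation below k is at most k - 1; the unit gained here is what puts the diagonal of [fK] in
    P. *)
Lemma pidealV x k : ~ pideal k x -> pideal (1 - k) x^-1.
Proof.
move=> nk; have [x0|x0] := eqVneq x 0; first by case: nk; left.
by right; rewrite pvalV //; case: (leP k (pval x)) => [h|]; [case: nk; right|lia].
Qed.

Lemma pideal1_unit x : pideal 1 x -> 1 + x != 0.
Proof.
move=> [->|h]; first by rewrite addr0 oner_neq0.
apply: contraPneq h => /eqP; rewrite addrC addr_eq0 => /eqP ->.
by rewrite pvalN1.
Qed.

Lemma pideal1_inv x : pideal 1 x -> pideal 0 (1 + x)^-1.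
Proof.
move=> h; have u := pideal1_unit h.
right; rewrite pvalV //; case: (leP (pval (1 + x)) 0) => [|g]; first by lia.
have : pideal 1 ((1 + x) - x) by apply: pidealB h; right; lia.
rewrite addrK => -[/eqP|]; first by rewrite oner_eq0.
by rewrite pval1.
Qed.

Lemma pideal_expz (x : F) (z : int) : uniformizer x -> pideal z (x ^ z).
Proof.
move=> [x0 vx]; right.
suff e : forall j : nat, pval (x ^+ j) = j%:Z.
  case: z => j; first by rewrite -exprnP e.
  by rewrite NegzE -exprnN pvalV ?expf_neq0 // e.
elim=> [|j IH]; first by rewrite expr0 pval1.
by rewrite exprS pvalM ?expf_neq0 // IH vx; lia.
Qed.

End PadicIdeals.

(** * Matrix lattices given by entrywise exponents, and triangular matrices *)

Section Lattice.
Variables (F : padicFieldType) (N : nat).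
Local Notation M := 'M[F]_N.
Implicit Types (A B : M) (f g h : 'I_N -> 'I_N -> int).

(** If f a b <= f a c + f c b, the matrices congruent to 1 modulo [latt f] are closed under
    products. K_C, H_m, the Weyl conjugates of H_m and the lattices [fK] all have this shape. *)
Definition latt f : set M := [set A | forall a b, pideal (f a b) (A a b)].

Lemma latt_mul f g h A B : (forall a c b, h a b <= f a c + g c b) ->
  latt f A -> latt g B -> latt h (A *m B).
Proof.
move=> fgh fA gB a b; rewrite mxE; apply: pideal_sum => c _.
by apply: (@pidealM_le F (f a c) (g c b)).
Qed.

Lemma lattD f A B : latt f A -> latt f B -> latt f (A + B).
Proof. by move=> fA fB a b; rewrite mxE; apply: pidealD. Qed.

Lemma latt_sub1_mul f A B : (forall a c b, f a b <= f a c + f c b) ->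
  latt f (A - 1%:M) -> latt f (B - 1%:M) -> latt f (A *m B - 1%:M).
Proof.
move=> ff fA fB.
have -> : A *m B - 1%:M = (A - 1%:M) *m (B - 1%:M) + ((A - 1%:M) + (B - 1%:M)).
  rewrite mulmxBl mul1mx mulmxBr mulmx1.
  by rewrite [_ + (B - _)]addrC addrA subrK addrA subrK.
by apply: lattD; [apply: latt_mul ff fA fB | apply: lattD].
Qed.

Definition upper_mx A := forall a b : 'I_N, (b < a)%N -> A a b = 0.
Definition lower_mx A := forall a b : 'I_N, (a < b)%N -> A a b = 0.
Definition diag1_mx A := forall a, A a a = 1.

Lemma upper_mul A B : upper_mx A -> upper_mx B -> upper_mx (A *m B).
Proof.
move=> uA uB a b ba; rewrite mxE big1 // => c _.
have [ca|ac] := ltnP c a; first by rewrite uA // mul0r.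
by rewrite uB ?mulr0 //; lia.
Qed.

Lemma upper_mul_diag A B a :
  upper_mx A -> upper_mx B -> (A *m B) a a = A a a * B a a.
Proof.
move=> uA uB; rewrite mxE (bigD1 a) //= big1 ?addr0 // => c; rewrite -val_eqE /= => ca.
have [lt|le] := ltnP c a; first by rewrite uA // mul0r.
by rewrite uB ?mulr0 //; lia.
Qed.

Lemma lower_mul A B : lower_mx A -> lower_mx B -> lower_mx (A *m B).
Proof.
move=> uA uB a b ba; rewrite mxE big1 // => c _.
have [ca|ac] := ltnP a c; first by rewrite uA // mul0r.
by rewrite uB ?mulr0 //; lia.
Qed.

Lemma lower_mul_diag A B a :
  lower_mx A -> lower_mx B -> (A *m B) a a = A a a * B a a.
Proof.
move=> uA uB; rewrite mxE (bigD1 a) //= big1 ?addr0 // => c; rewrite -val_eqE /= => ca.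
have [lt|le] := ltnP a c; first by rewrite uA // mul0r.
by rewrite uB ?mulr0 //; lia.
Qed.

(** Forward substitution: row a of [A *m B] is a nonzero multiple of row a of B plus a combination
    of earlier rows, which already vanish above the diagonal. *)
Lemma lower_cancel A B : lower_mx A -> (forall a, A a a != 0) ->
  lower_mx (A *m B) -> lower_mx B.
Proof.
move=> lA dA lAB a b ab.
have [j ja] := ubnP (a : nat); elim: j a ab ja => // j IH a ab aj.
have := lAB a b ab; rewrite mxE (bigD1 a) //= big1 ?addr0 => [|c]; last rewrite -val_eqE /= => ca.
  by move/eqP; rewrite mulf_eq0 (negPf (dA a)) /= => /eqP.
by have [lt|le] := ltnP a c; [rewrite lA // mul0r|rewrite IH ?mulr0 //; lia].
Qed.

Lemma upper_lower1 A : upper_mx A -> lower_mx A -> diag1_mx A -> A = 1%:M.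
Proof.
move=> uA lA dA; apply/matrixP => a b; rewrite mxE.
have [->|ab] := eqVneq a b; first exact: dA.
case: (ltngtP a b) => [h|h|/val_inj h]; first by rewrite lA.
  by rewrite uA.
by rewrite h eqxx in ab.
Qed.

End Lattice.

(* Gaussian elimination of the last index, with total functions in place of
   matrices so that the size can vary. *)
Lemma udl_nat (F : padicFieldType) (N : nat) (f : nat -> nat -> int)
    (A : nat -> nat -> F) :
  (forall a c b, f a b <= f a c + f c b) -> (forall a, 1 <= f a a) ->
  (forall a b, (a < N)%N -> (b < N)%N -> pideal (f a b) (A a b - (a == b)%:R)) ->
  exists (U L : nat -> nat -> F) (D : nat -> F),
   [/\ forall a b, (a < N)%N -> (b < N)%N ->
         A a b = \sum_(c < N) U a c * D c * L c b,
       forall a b, (a < N)%N -> (b < N)%N -> pideal (f a b) (U a b - (a == b)%:R)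
         /\ pideal (f a b) (L a b - (a == b)%:R),
       forall a, (a < N)%N -> pideal (f a a) (D a - 1),
       forall a, (a < N)%N -> U a a = 1 /\ L a a = 1 &
       forall a b, (a < N)%N -> (b < N)%N -> (a < b)%N -> U b a = 0 /\ L a b = 0].
Proof.
move=> ff f1; elim: N A => [|N IH] A hA.
  by exists (fun _ _ => 0), (fun _ _ => 0), (fun _ => 0); split.
pose d := A N N.
have hd : pideal (f N N) (d - 1) by have := hA N N; rewrite eqxx; apply.
have hd1 : pideal 1 (d - 1) by apply: pideal_le hd.
have d0 : d != 0 by have := pideal1_unit hd1; rewrite subrKC.
have dV : pideal 0 d^-1 by have := pideal1_inv hd1; rewrite subrKC.
have hr b : (b < N)%N -> pideal (f N b) (A N b).
  move=> bN; have := hA N b; rewrite gtn_eqF // subr0; apply; lia.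
have hc a : (a < N)%N -> pideal (f a N) (A a N).
  move=> aN; have := hA a N; rewrite ltn_eqF // subr0; apply; lia.
have hrd b : (b < N)%N -> pideal (f N b) (A N b / d).
  by move=> bN; apply: pidealM_le (hr b bN) dV; rewrite addr0.
have hcd a : (a < N)%N -> pideal (f a N) (A a N / d).
  by move=> aN; apply: pidealM_le (hc a aN) dV; rewrite addr0.
(* Schur complement of the last pivot d. The correction stays in the lattice by f a b <= f a N + f N
   b, since d is a unit. Eliminating the last index first puts the upper factor on the left. *)
have [] := IH (fun a b => A a b - A a N / d * A N b).
  move=> a b aN bN; rewrite addrAC; apply: pidealB.
    by apply: hA; lia.
  by apply: pidealM_le (ff a N b) (hcd a aN) (hr b bN).
move=> U [L [D [e1 e2 e3 e4 e5]]].
exists (fun a c => if (c < N)%N then (if (a < N)%N then U a c else 0)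
                   else if (a < N)%N then A a N / d else 1).
exists (fun a c => if (a < N)%N then (if (c < N)%N then L a c else 0)
                   else if (c < N)%N then A N c / d else 1).
exists (fun a => if (a < N)%N then D a else d); split.
- move=> a b aN bN; rewrite big_ord_recr /= ltnn.
  have [aN'|aN'] := ltnP a N; have [bN'|bN'] := ltnP b N.
  + rewrite [X in X + _](_ : _ = A a b - A a N / d * A N b).
      by rewrite mulfVK // mulrA [_ * A N b]mulrAC subrK.
    by rewrite e1 //; apply: eq_bigr => c _; rewrite ltn_ord.
  + rewrite big1 => [|c _]; last by rewrite ltn_ord mulr0.
    by rewrite add0r mulfVK // mulr1; congr (A _ _); lia.
  + rewrite big1 => [|c _]; last by rewrite ltn_ord !mul0r.
    by rewrite add0r mul1r mulrC mulfVK //; congr (A _ _); lia.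
  + rewrite big1 => [|c _]; last by rewrite ltn_ord !mul0r.
    by rewrite add0r mul1r mulr1; congr (A _ _); lia.
- move=> a b aN bN.
  have [aN'|aN'] := ltnP a N; have [bN'|bN'] := ltnP b N.
  + exact: e2.
  + have -> : b = N by lia.
    by rewrite ltn_eqF // !subr0; split; [apply: hcd|apply: pideal0].
  + have -> : a = N by lia.
    by rewrite gtn_eqF // !subr0; split; [apply: pideal0|apply: hrd].
  + have -> : a = N by lia.
    have -> : b = N by lia.
    by rewrite eqxx subrr; split; apply: pideal0.
- move=> a aN; have [aN'|aN'] := ltnP a N; first exact: e3.
  by have -> : a = N by lia.
- by move=> a aN; have [aN'|aN'] := ltnP a N; [apply: e4|].
- move=> a b aN bN ab; have aN' : (a < N)%N by lia.
  by rewrite aN'; have [bN'|bN'] := ltnP b N; [apply: e5|].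
Qed.

Lemma udl_decomposition (F : padicFieldType) (N : nat)
    (f : 'I_N -> 'I_N -> int) (A : 'M[F]_N) :
  (forall a c b, f a b <= f a c + f c b) -> (forall a, 1 <= f a a) ->
  latt f (A - 1%:M) ->
  exists (U D L : 'M[F]_N), [/\ A = U *m D *m L,
    [/\ upper_mx U, diag1_mx U & latt f (U - 1%:M)],
    [/\ lower_mx L, diag1_mx L & latt f (L - 1%:M)] &
    [/\ upper_mx D, lower_mx D, forall a, D a a != 0 & latt f (D - 1%:M)]].
Proof.
(* The empty size is treated apart because [inord] needs a nonempty ordinal type. *)
case: N f A => [|N] f A ff f1 fA.
  by exists A, A, A; split; [apply/matrixP => -[]|split=> -[]..].
have hE a b : pideal (f a b) (A a b - (a == b)%:R).
  by have := fA a b; rewrite !mxE.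
have [] := @udl_nat F N.+1 (fun a b => f (inord a) (inord b))
  (fun a b => A (inord a) (inord b)).
- by move=> a c b; apply: ff.
- by move=> a; apply: f1.
- move=> a b aN bN; have := hE (inord a) (inord b).
  by rewrite -val_eqE /= !inordK.
move=> U [L [D [e1 e2 e3 e4 e5]]].
have i_ := @inord_val N.
have fD : latt f (\matrix_(a, b < N.+1) (D a *+ (a == b)) - 1%:M).
  move=> a b; rewrite !mxE; have [<-|_] := eqVneq a b.
    by rewrite mulr1n; have := e3 a (ltn_ord a); rewrite i_.
  by rewrite mulr0n subr0; apply: pideal0.
exists (\matrix_(a, b) U a b), (\matrix_(a, b) (D a *+ (a == b))).
exists (\matrix_(a, b) L a b); split.
- apply/matrixP => a b; have := e1 a b (ltn_ord a) (ltn_ord b).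
  rewrite !i_ => ->; rewrite mxE; apply: eq_bigr => c _; rewrite !mxE.
  congr (_ * _); rewrite (bigD1 c) //= big1 => [|j jc]; last first.
    by rewrite !mxE (negPf jc) mulr0n mulr0.
  by rewrite !mxE eqxx mulr1n addr0.
- split=> [a b ba|a|a b]; rewrite !mxE.
  + by have [] := e5 b a (ltn_ord b) (ltn_ord a) ba.
  + by have [] := e4 a (ltn_ord a).
  + by have [+ _] := e2 a b (ltn_ord a) (ltn_ord b); rewrite !i_.
- split=> [a b ba|a|a b]; rewrite !mxE.
  + by have [] := e5 a b (ltn_ord a) (ltn_ord b) ba.
  + by have [] := e4 a (ltn_ord a).
  + by have [_] := e2 a b (ltn_ord a) (ltn_ord b); rewrite !i_.
- split=> [a b ba|a b ba|a|] //; rewrite ?mxE.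
  + by have -> : (a == b) = false by apply/eqP => e; rewrite e ltnn in ba.
  + by have -> : (a == b) = false by apply/eqP => e; rewrite e ltnn in ba.
  + rewrite eqxx mulr1n; have := e3 a (ltn_ord a); rewrite i_ => h.
    by rewrite -[D a](subrKC 1); apply/pideal1_unit/(pideal_le (f1 a)).
Qed.

Lemma invmx_mul (F : fieldType) (N : nat) (x y : 'M[F]_N) :
  x \in unitmx -> y \in unitmx -> invmx (x *m y) = invmx y *m invmx x.
Proof.
move=> ux uy; have e : (x *m y) *m (invmx y *m invmx x) = 1%:M.
  by rewrite mulmxA -[_ *m invmx y]mulmxA mulmxV // mulmx1 mulmxV.
have [uxy _] := mulmx1_unit e.
by rewrite -[LHS]mulmx1 -e mulKmx.
Qed.

(** * The symplectic group and its triangular subgroups *)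

Section SymplecticBasics.
Variables (F : padicFieldType) (n : nat).
Local Notation M := 'M[F]_(n + n).
Local Notation I := 'I_(n + n).
Implicit Types (g h A B : M) (a b c : I).

(** The sign of the only nonzero entry in row a of the symplectic form; that entry sits in column
    [rev_ord a]. *)
Definition eps a : F := if (a < n)%N then 1 else -1.

Lemma eps_rev a : eps (rev_ord a) = - eps a.
Proof.
rewrite /eps /=; have := ltn_ord a.
by case: (ltnP a n) => ? ?; case: ltnP => ?; rewrite ?opprK //; lia.
Qed.

Lemma eps_mul a : eps a * eps a = 1.
Proof. by rewrite /eps; case: ifP => _; rewrite ?mulrNN mulr1. Qed.

Lemma eps_neq0 a : eps a != 0.
Proof. by rewrite /eps; case: ifP => _; rewrite ?oppr_eq0 oner_eq0. Qed.

Lemma rev_ord_neq a : (rev_ord a == a) = false.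
Proof. by apply/eqP => /(congr1 val) /=; have := ltn_ord a; lia. Qed.

Lemma symp_formE a b : symp_form F n a b = eps a * (b == rev_ord a)%:R.
Proof.
rewrite /symp_form /eps -(fintype.splitK a) -(fintype.splitK b).
case: (fintype.split a) => i; case: (fintype.split b) => j /=;
  rewrite ?block_mxEul ?block_mxEur ?block_mxEdl ?block_mxEdr !mxE -!val_eqE /=;
  have := ltn_ord i; have := ltn_ord j => hj hi.
- by rewrite hi mul1r; case: eqP => //; lia.
- rewrite hi mul1r; congr (_%:R); congr nat_of_bool; apply/eqP/eqP; lia.
- rewrite ifF; last by apply/negbTE; lia.
  rewrite mulN1r; congr (- _%:R); congr nat_of_bool; apply/eqP/eqP; lia.
- rewrite ifF; last by apply/negbTE; lia.
  by rewrite mulN1r; case: eqP => [|_]; [lia|rewrite oppr0].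
Qed.

(* J^-1 A^T J; this is A^-1 for A in Sp, and exhibits the inverse of a
   triangular element of Sp as triangular. *)
Definition sp_adj A : M :=
  \matrix_(a, b) (eps a * eps b * A (rev_ord b) (rev_ord a)).

Lemma sp_adjM A B : sp_adj (A *m B) = sp_adj B *m sp_adj A.
Proof.
apply/matrixP => a b; rewrite !mxE mulr_sumr (reindex_inj rev_ord_inj) /=.
apply: eq_bigr => c _; rewrite !mxE.
by rewrite -[LHS]mul1r -(eps_mul c); ring.
Qed.

Lemma sp_adjK A : sp_adj (sp_adj A) = A.
Proof.
apply/matrixP => a b; rewrite !mxE !rev_ordK !eps_rev mulrNN mulrA.
by rewrite -[RHS]mul1r -(eps_mul a) -[RHS]mul1r -(eps_mul b); ring.
Qed.

Lemma sp_adj1 : sp_adj 1%:M = 1%:M.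
Proof.
apply/matrixP => a b; rewrite !mxE (inj_eq rev_ord_inj) eq_sym.
by have [->|_] := eqVneq a b; rewrite ?eps_mul ?mulr1 ?mulr0.
Qed.

Lemma sp_adj_mulE g a b :
  (sp_adj g *m g) a b = - eps a * (g^T *m symp_form F n *m g) (rev_ord a) b.
Proof.
rewrite -mulmxA [RHS]mulrC !mxE mulr_suml (reindex_inj rev_ord_inj) /=.
apply: eq_bigr => c _; rewrite !mxE rev_ordK eps_rev (bigD1 (rev_ord c)) //=.
rewrite symp_formE eqxx big1 ?addr0 => [|d dc]; last first.
  by rewrite symp_formE (negPf dc) mulr0 mul0r.
by rewrite mulr1; ring.
Qed.

Lemma SpP g : Sp g <-> sp_adj g *m g = 1%:M.
Proof.
split=> [e|e].
  apply/matrixP => a b; rewrite sp_adj_mulE e symp_formE rev_ordK eps_rev mxE.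
  by rewrite mulrA mulrNN eps_mul mul1r eq_sym.
apply/matrixP => a b; have := congr1 (fun X : M => X (rev_ord a) b) e.
rewrite sp_adj_mulE rev_ordK eps_rev opprK => h.
rewrite symp_formE -[LHS]mul1r -(eps_mul a) -mulrA h mxE.
by rewrite [rev_ord a == b]eq_sym eps_mul.
Qed.

Lemma Sp_adjl g : Sp g -> sp_adj g *m g = 1%:M. Proof. by move/SpP. Qed.
Lemma Sp_adjr g : Sp g -> g *m sp_adj g = 1%:M.
Proof. by move/SpP/mulmx1C. Qed.

Lemma Sp_unit g : Sp g -> g \in unitmx.
Proof. by move=> /SpP e; have [] := mulmx1_unit e. Qed.

Lemma Sp_invE g : Sp g -> invmx g = sp_adj g.
Proof.
move=> hg; rewrite -[LHS]mul1mx -(Sp_adjl hg) mulmxK //; exact: Sp_unit.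
Qed.

Lemma Sp1 : Sp (1%:M : M).
Proof. by apply/SpP; rewrite sp_adj1 mulmx1. Qed.

Lemma Sp_mul g h : Sp g -> Sp h -> Sp (g *m h).
Proof.
move=> hg hh; apply/SpP; rewrite sp_adjM mulmxA -[_ *m g]mulmxA Sp_adjl //.
by rewrite mulmx1 Sp_adjl.
Qed.

Lemma Sp_adj g : Sp g -> Sp (sp_adj g).
Proof. by move=> hg; apply/SpP; rewrite sp_adjK Sp_adjr. Qed.

Lemma Sp_inv g : Sp g -> Sp (invmx g).
Proof. by move=> hg; rewrite Sp_invE //; apply: Sp_adj. Qed.

Lemma upper_adj A : upper_mx A -> upper_mx (sp_adj A).
Proof.
move=> uA a b ba; rewrite mxE uA ?mulr0 //=.
by have := ltn_ord a; have := ltn_ord b; lia.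
Qed.

Lemma lower_adj A : lower_mx A -> lower_mx (sp_adj A).
Proof.
move=> uA a b ba; rewrite mxE uA ?mulr0 //=.
by have := ltn_ord a; have := ltn_ord b; lia.
Qed.

Lemma diag1_adj A : diag1_mx A -> diag1_mx (sp_adj A).
Proof. by move=> dA a; rewrite mxE dA mulr1 eps_mul. Qed.

Lemma UniP g : Uni g <-> [/\ Sp g, diag1_mx g & upper_mx g].
Proof. by []. Qed.

Lemma Uni1 : Uni (1%:M : M).
Proof.
apply/UniP; split=> [|a|a b ba]; [exact: Sp1|by rewrite mxE eqxx|].
by rewrite mxE; case: eqP => // e; rewrite e ltnn in ba.
Qed.

Lemma Uni_mul g h : Uni g -> Uni h -> Uni (g *m h).
Proof.
move=> /UniP[sg dg ug] /UniP[sh dh uh]; apply/UniP; split; first exact: Sp_mul.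
  by move=> a; rewrite upper_mul_diag // dg dh mulr1.
exact: upper_mul.
Qed.

Lemma Uni_inv g : Uni g -> Uni (invmx g).
Proof.
move=> /UniP[sg dg ug]; rewrite Sp_invE //; apply/UniP; split.
- exact: Sp_adj.
- exact: diag1_adj.
- exact: upper_adj.
Qed.

(** By [sp_adj g *m g = 1] the diagonal entries at a and [rev_ord a] are inverse to each other. In
    this form the closure properties of T reduce to those of triangular matrices. *)
Lemma torP g : Tor g <-> [/\ Sp g, upper_mx g & lower_mx g].
Proof.
split=> [[t t0 ->]|[sg ug lg]].
  set d := row_mx _ _.
  have dE a : d 0 a * d 0 (rev_ord a) = 1.
    wlog an : a / (a < n)%N.
      move=> W; have [|an] := ltnP a n; first exact: W.
      rewrite -[X in d 0 X](rev_ordK a) mulrC W ?rev_ordK //=.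
      by have := ltn_ord a; lia.
    have -> : a = lshift n (Ordinal an) by apply: val_inj.
    have -> : rev_ord (lshift n (Ordinal an)) = rshift n (rev_ord (Ordinal an)).
      by apply: val_inj => /=; lia.
    by rewrite row_mxEl row_mxEr mxE rev_ordK mulfV.
  move: d dE => d dE; split=> [|a b|a b].
  - apply/SpP/matrixP => a b; rewrite mul_mx_diag !mxE (inj_eq rev_ord_inj).
    rewrite eq_sym; have [->|_] := eqVneq a b; last by rewrite mulr0n mulr0 mul0r.
    by rewrite eps_mul !mulr1n mul1r -[X in _ * d 0 X]rev_ordK dE.
  - by move=> ba; rewrite mxE; case: eqP => // e; rewrite e ltnn in ba.
  - by move=> ba; rewrite mxE; case: eqP => // e; rewrite e ltnn in ba.
have dg a : g (rev_ord a) (rev_ord a) * g a a = 1.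
  have := congr1 (fun X : M => X a a) (Sp_adjl sg).
  by rewrite upper_mul_diag //; [rewrite !mxE eqxx eps_mul mul1r|exact: upper_adj].
have g0 a : g a a != 0.
  by apply/eqP => e; have := dg a; rewrite e mulr0 => /eqP; rewrite eq_sym oner_eq0.
exists (\row_i g (lshift n i) (lshift n i)) => [i|]; first by rewrite mxE.
apply/matrixP => a b; rewrite mxE.
have [<-|ab] := eqVneq a b; last first.
  rewrite mulr0n; case: (ltngtP a b) => [h|h|/val_inj h]; first exact: lg.
    exact: ug.
  by rewrite h eqxx in ab.
rewrite mulr1n; case: (fintype.splitP a) => j aj; last first.
  have -> : a = rshift n j by apply: val_inj.
  rewrite row_mxEr !mxE; set c := lshift n _.
  have -> : rshift n j = rev_ord c.
    by apply: val_inj => /=; have := ltn_ord j; lia.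
  by rewrite -[LHS]mulr1 -(mulfV (g0 c)) mulrA dg mul1r.
have -> : a = lshift n j by apply: val_inj.
by rewrite row_mxEl mxE.
Qed.

Lemma Tor_Sp g : Tor g -> Sp g. Proof. by case/torP. Qed.
Lemma Uni_Sp g : Uni g -> Sp g. Proof. by case. Qed.

Lemma Tor1 : Tor (1%:M : M).
Proof.
apply/torP; split; first exact: Sp1.
  by have /UniP[] := Uni1.
by move=> a b ab; rewrite mxE; case: eqP => // e; rewrite e ltnn in ab.
Qed.

Lemma Tor_mul g h : Tor g -> Tor h -> Tor (g *m h).
Proof.
move=> /torP[sg ug lg] /torP[sh uh lh]; apply/torP; split.
- exact: Sp_mul.
- exact: upper_mul.
- exact: lower_mul.
Qed.

Lemma Tor_inv g : Tor g -> Tor (invmx g).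
Proof.
move=> /torP[sg ug lg]; rewrite Sp_invE //; apply/torP; split.
- exact: Sp_adj.
- exact: upper_adj.
- exact: lower_adj.
Qed.

(** Diagonals of upper triangular matrices multiply, so the diagonal part of an upper triangular
    symplectic matrix is again symplectic; it is the torus factor. *)
Lemma borP g : Bor g <-> Sp g /\ upper_mx g.
Proof.
split=> [[t [u [/torP[st ut _] /UniP[su _ uu] ->]]]|[sg ug]].
  by split; [apply: Sp_mul|apply: upper_mul].
have dg a : g (rev_ord a) (rev_ord a) * g a a = 1.
  have := congr1 (fun X : M => X a a) (Sp_adjl sg).
  by rewrite upper_mul_diag //; [rewrite !mxE eqxx eps_mul mul1r|exact: upper_adj].
pose t : M := \matrix_(a, b) (g a a *+ (a == b)).
have ut : upper_mx t.
  by move=> a b ba; rewrite mxE; case: eqP => // e; rewrite e ltnn in ba.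
have lt : lower_mx t.
  by move=> a b ba; rewrite mxE; case: eqP => // e; rewrite e ltnn in ba.
have st : Sp t.
  apply/SpP/upper_lower1.
  - by apply: upper_mul => //; apply: upper_adj.
  - by apply: lower_mul => //; apply: lower_adj.
  - move=> a; rewrite upper_mul_diag //; last exact: upper_adj.
  rewrite !mxE !eqxx eps_mul mul1r.
    by rewrite !mulr1n.
exists t, (invmx t *m g); split; first by apply/torP.
  rewrite Sp_invE //; apply/UniP; split.
  - by apply: Sp_mul => //; apply: Sp_adj.
  - move=> a; rewrite upper_mul_diag //; last exact: upper_adj.
  rewrite !mxE eqxx eps_mul mul1r.
    by rewrite mulr1n.
  - by apply: upper_mul => //; apply: upper_adj.
by rewrite mulKVmx // Sp_unit.
Qed.

Lemma Tor_Bor g : Tor g -> Bor g.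
Proof. by move=> /torP[sg ug _]; apply/borP. Qed.

Lemma Uni_Bor g : Uni g -> Bor g.
Proof. by move=> /UniP[sg _ ug]; apply/borP. Qed.

Lemma Bor_Sp g : Bor g -> Sp g. Proof. by case/borP. Qed.

Lemma Bor_mul g h : Bor g -> Bor h -> Bor (g *m h).
Proof.
move=> /borP[sg ug] /borP[sh uh]; apply/borP.
by split; [apply: Sp_mul|apply: upper_mul].
Qed.

Lemma Bor_inv g : Bor g -> Bor (invmx g).
Proof.
move=> /borP[sg ug]; rewrite Sp_invE //; apply/borP.
by split; [apply: Sp_adj|apply: upper_adj].
Qed.

Lemma Uni_conj_Tor (t u : M) : Tor t -> Uni u -> Uni (t *m u *m invmx t).
Proof.
move=> /torP[st ut lt] /UniP[su du uu]; rewrite Sp_invE //; apply/UniP; split.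
- by apply: Sp_mul; [apply: Sp_mul|apply: Sp_adj].
- move=> a; rewrite !upper_mul_diag //; [|exact: upper_mul|exact: upper_adj].
  rewrite du mulr1.
  have := congr1 (fun X : M => X a a) (Sp_adjr st).
  by rewrite upper_mul_diag //; [move=> ->; rewrite mxE eqxx|exact: upper_adj].
- by apply: upper_mul; [apply: upper_mul|apply: upper_adj].
Qed.

(** B meets the lower unipotent matrices only in 1. *)
Lemma lower_unip_unique (b b' l l' : M) :
  Bor b -> Bor b' -> Sp l -> Sp l' -> lower_mx l -> lower_mx l' ->
  diag1_mx l -> diag1_mx l' -> b *m l = b' *m l' -> l = l'.
Proof.
move=> hb hb' sl sl' ll ll' dl dl' e.
have e1 : l *m sp_adj l' = invmx b *m b'.
  rewrite -[l in LHS](mulKmx (Sp_unit (Bor_Sp hb))) e -mulmxA.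
  by rewrite -[b' *m l' *m _]mulmxA Sp_adjr // mulmx1.
have /borP[_ ub] := Bor_mul (Bor_inv hb) hb'.
have : l *m sp_adj l' = 1%:M.
  apply: upper_lower1; first by rewrite e1.
    by apply: lower_mul => //; apply: lower_adj.
  by move=> a; rewrite lower_mul_diag //; [rewrite dl (diag1_adj dl') mulr1|exact: lower_adj].
move=> /(congr1 (mulmx^~ l')) /=.
by rewrite -mulmxA Sp_adjl // mulmx1 mul1mx.
Qed.

(** The factors produced by elimination are symplectic by uniqueness: up to cyclic rearrangement,
    [sp_adj g *m g = 1] says that an upper triangular matrix times a lower unipotent one is 1. *)
Lemma sp_udl (f : I -> I -> int) g :
  (forall a c b, f a b <= f a c + f c b) -> (forall a, 1 <= f a a) ->
  Sp g -> latt f (g - 1%:M) ->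
  exists (u t l : M), [/\ g = u *m t *m l, Uni u /\ latt f (u - 1%:M),
    Tor t /\ latt f (t - 1%:M) &
    [/\ Sp l, lower_mx l, diag1_mx l & latt f (l - 1%:M)]].
Proof.
move=> ff f1 sg fg.
have [u [t [l [e [uu du fu] [ll dl fl] [ut lt t0 ft]]]]] :=
  udl_decomposition ff f1 fg.
have e1 : sp_adj t *m (sp_adj u *m u) *m t *m (l *m sp_adj l) = 1%:M.
  apply: mulmx1C; rewrite -[l *m _ *m _]mulmxA; apply: mulmx1C.
  by rewrite -(Sp_adjl sg) e !sp_adjM !mulmxA.
set P := sp_adj u *m u in e1; set Q := l *m sp_adj l in e1.
have uP : upper_mx P by apply: upper_mul => //; apply: upper_adj.
have dP : diag1_mx P.
  by move=> a; rewrite upper_mul_diag //; [rewrite (diag1_adj du) du mulr1|exact: upper_adj].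
have lQ : lower_mx Q by apply: lower_mul => //; apply: lower_adj.
have dQ : diag1_mx Q.
  by move=> a; rewrite lower_mul_diag //; [rewrite (diag1_adj dl) dl mulr1|exact: lower_adj].
(* [Q *m T = 1] with Q lower unipotent makes the upper triangular T lower triangular as well, so T
   and Q are both 1. *)
set T := sp_adj t *m P *m t in e1.
have uT : upper_mx T.
  by apply: upper_mul => //; apply: upper_mul => //; apply: upper_adj.
have e2 : Q *m T = 1%:M by apply: mulmx1C.
have l1 : lower_mx (1%:M : M) by have /torP[] := Tor1.
have lT : lower_mx T.
  by apply: lower_cancel lQ _ _; [move=> a; rewrite dQ oner_eq0|rewrite e2].
have T1 : T = 1%:M.
  apply: upper_lower1 => // a; have := congr1 (fun X : M => X a a) e2.
  by rewrite lower_mul_diag // dQ mul1r !mxE eqxx.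
have Q1 : Q = 1%:M by move: e2; rewrite T1 mulmx1.
have t0' a : sp_adj t a a != 0.
  by rewrite mxE !mulf_neq0 ?eps_neq0.
have P1 : P = 1%:M.
  apply: upper_lower1 => //.
  apply: (@lower_cancel _ _ (sp_adj t)) => //; first exact: lower_adj.
  move=> a b ab; have := congr1 (fun X : M => X a b) T1.
  rewrite mxE (bigD1 b) //= big1 => [|c].
    rewrite addr0 (l1 _ _ ab) => /eqP; rewrite mulf_eq0 (negPf (t0 b)) orbF.
    by move/eqP.
  rewrite -val_eqE neq_ltn => /orP[cb|cb]; first by rewrite lt // mulr0.
  by rewrite ut // mulr0.
exists u, t, l; split=> //.
- by split=> //; apply/UniP; split=> //; apply/SpP.
- split=> //; apply/torP; split=> //; apply/SpP.
  by move: T1; rewrite /T P1 mulmx1.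
- by split=> //; apply/SpP/mulmx1C.
Qed.

End SymplecticBasics.

(** * Signed permutation matrices and the Weyl group *)

Section Monomial.
Variables (F : padicFieldType) (n : nat).
Local Notation M := 'M[F]_(n + n).
Local Notation I := 'I_(n + n).
Implicit Types (g h x y A B : M) (a b c : I).

Definition is_sign (z : F) := z = 1 \/ z = -1.

Lemma is_sign_mul (y z : F) : is_sign y -> is_sign z -> is_sign (y * z).
Proof.
by rewrite /is_sign => -[]-> -[]->; rewrite ?mulrNN ?mul1r ?mulr1; auto.
Qed.

Lemma is_signK (z : F) : is_sign z -> z * z = 1.
Proof. by move=> []->; rewrite ?mulrNN mulr1. Qed.

Lemma is_sign_pideal (z y : F) k : is_sign z -> pideal k y -> pideal k (z * y).
Proof. by move=> []-> ?; rewrite ?mul1r // mulN1r; apply: pidealN. Qed.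

Lemma is_sign_eps a : is_sign (eps F a).
Proof. by rewrite /eps; case: ifP; [left|right]. Qed.

(** Signs, rather than arbitrary torus entries, make conjugation permute the matrix entries up to
    sign, so valuation bounds are merely permuted. *)
Definition mono (s : {perm I}) x := exists2 e : I -> F,
  (forall a, is_sign (e a)) & x = \matrix_(a, b) (e a *+ (b == s a)).

Lemma mono_mulmxE (s : {perm I}) (e : I -> F) A a b :
  (\matrix_(a, b) (e a *+ (b == s a)) *m A) a b = e a * A (s a) b.
Proof.
rewrite mxE (bigD1 (s a)) //= mxE eqxx mulr1n big1 ?addr0 // => c ca.
by rewrite mxE (negPf ca) mul0r.
Qed.

Lemma mono1 : mono 1%g 1%:M.
Proof.
exists (fun=> 1) => [a|]; first by left.
by apply/matrixP => a b; rewrite !mxE perm1 eq_sym.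
Qed.

Lemma mono_mul s t x y : mono s x -> mono t y -> mono (s * t)%g (x *m y).
Proof.
move=> [e he ->] [d hd ->]; exists (fun a => e a * d (s a)) => [a|].
  exact: is_sign_mul.
by apply/matrixP => a b; rewrite mono_mulmxE !mxE permM mulrnAr.
Qed.

Lemma mono_inv s x : mono s x -> mono s^-1%g (invmx x).
Proof.
move=> [e he ->]; exists (fun a => e ((s^-1)%g a)) => // [].
set x' := \matrix_(a, b) (e a *+ _); set y := \matrix_(a, b) _.
have e1 : x' *m y = 1%:M.
  apply/matrixP => a b; rewrite mono_mulmxE !mxE permK eq_sym.
  by have [->|_] := eqVneq a b; rewrite ?mulr0 // mulr1n is_signK.
have [ux _] := mulmx1_unit e1.
by rewrite -[LHS]mulmx1 -e1 mulKmx.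
Qed.

Lemma mono_conj s x : mono s x -> exists2 e : I -> F,
  (forall a, is_sign (e a)) &
  forall A a b, (x *m A *m invmx x) a b = e a * e b * A (s a) (s b).
Proof.
move=> mx; have [e he ex] := mx; have [d hd ey] := mono_inv mx.
exists e => // A a b.
have ux : x \in unitmx.
  suff xE : x *m \matrix_(a, b) (e ((s^-1)%g a) *+ (b == (s^-1)%g a)) = 1%:M.
    by have [] := mulmx1_unit xE.
  apply/matrixP => i j; rewrite ex mono_mulmxE !mxE permK eq_sym.
  by have [->|_] := eqVneq i j; rewrite ?mulr0 // mulr1n is_signK.
have de b' : d (s b') = e b'.
  have := congr1 (fun X : M => X b' b') (mulmxV ux).
  rewrite {1}ex mono_mulmxE ey !mxE permK !eqxx mulr1n => h.
  by rewrite -[LHS]mul1r -(is_signK (he b')) -mulrA h mulr1.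
rewrite -mulmxA {1}ex mono_mulmxE -mulrA; congr (_ * _).
rewrite mxE (bigD1 (s b)) //= big1 => [|c cb].
  by rewrite ey mxE permK eqxx mulr1n de addr0 mulrC.
by rewrite ey mxE -(inj_eq (@perm_inj _ s)) permKV eq_sym (negPf cb) mulr0.
Qed.

Lemma mono_diff s x y : mono s x -> mono s y -> Sp x -> Sp y ->
  Tor (invmx x *m y).
Proof.
move=> mx my sx sy; have [e _ eE] := mono_mul (mono_inv mx) my.
apply/torP; split; first by apply: Sp_mul => //; apply: Sp_inv.
  move=> a b ba; rewrite eE mxE mulVg perm1.
  by case: eqP => // h; rewrite h ltnn in ba.
move=> a b ba; rewrite eE mxE mulVg perm1.
by case: eqP => // h; rewrite h ltnn in ba.
Qed.

(** The permutations commuting with [rev_ord] form the Weyl group of type C inside the symmetric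
    group on 2n letters. *)
Definition comm_rev (s : {perm I}) := forall a, s (rev_ord a) = rev_ord (s a).

Lemma comm_revM s t : comm_rev s -> comm_rev t -> comm_rev (s * t)%g.
Proof. by move=> hs ht a; rewrite !permM hs ht. Qed.

Lemma comm_revV s : comm_rev s -> comm_rev s^-1%g.
Proof. by move=> hs a; apply: (@perm_inj _ s); rewrite hs !permKV. Qed.

Lemma Sp_mono s x (e : I -> F) : comm_rev s ->
  x = \matrix_(a, b) (e a *+ (b == s a)) ->
  (forall a, eps F a * eps F (s a) * (e a * e (rev_ord a)) = 1) -> Sp x.
Proof.
move=> cs xE he; apply/SpP/matrixP => a b; rewrite [RHS]mxE.
rewrite mxE (bigD1 ((s^-1)%g a)) //= big1 ?addr0 => [|c ca]; last first.
  rewrite mxE xE !mxE cs (inj_eq rev_ord_inj).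
  have -> : (a == s c) = false.
    by apply: contraNF ca => /eqP ->; rewrite permK.
  by rewrite mulr0n mulr0 mul0r.
rewrite xE !mxE cs permKV eqxx mulr1n eq_sym.
have := he ((s^-1)%g a); rewrite permKV => h.
have [_|_] := eqVneq a b; last by rewrite mulr0n mulr0.
by rewrite mulr1n; apply: etrans h; ring.
Qed.

Definition pos (i : 'I_n) : I := lshift n i.
Definition nxt (i : 'I_n) : I := ordS (pos i).

Lemma nxt_mod (i : 'I_n) : (i.+1 %% (n + n))%N = i.+1.
Proof. by rewrite modn_small //; have := ltn_ord i; lia. Qed.

Lemma nxt_val i : nxt i = i.+1 :> nat.
Proof. exact: nxt_mod. Qed.

(* Simplification unfolds [nat_of_ord (nxt i)] to a remainder. *)
Definition nxtE := (nxt_mod, nxt_val).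

(** For i = n - 1 one has [rev_ord (pos i) = nxt i], so the two transpositions coincide and one
    formula covers the short and the long simple roots. *)
Definition swf (i : 'I_n) (a : I) : I :=
  if a == pos i then nxt i else if a == nxt i then pos i
  else if a == rev_ord (pos i) then rev_ord (nxt i)
  else if a == rev_ord (nxt i) then rev_ord (pos i) else a.

Lemma swfE i a : swf i a = (if (a : nat) == i then i.+1
  else if (a : nat) == i.+1 then i : nat
  else if (a : nat) == (n + n - i.+1)%N then (n + n - i.+2)%N
  else if (a : nat) == (n + n - i.+2)%N then (n + n - i.+1)%N else a) :> nat.
Proof.
by rewrite /swf -!val_eqE /= !nxtE; do 4?[case: ifP => _] => //=; rewrite ?nxtE.
Qed.

Lemma swfK i : involutive (swf i).
Proof.
move=> a; apply: val_inj => /=; rewrite [LHS]swfE.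
have := swfE i a; move: (swf i a) => b; have := ltn_ord i; have := ltn_ord a.
by do 8?[case: eqP => ?]; lia.
Qed.

Definition sw i : {perm I} := perm (can_inj (swfK i)).

Lemma swE i a : sw i a = swf i a. Proof. exact: permE. Qed.

Lemma sw_rev i : comm_rev (sw i).
Proof.
move=> a; apply: val_inj => /=; rewrite !swE !swfE /=.
have := ltn_ord i; have := ltn_ord a.
by do 8?[case: eqP => ?]; lia.
Qed.

Lemma swV i : (sw i)^-1%g = sw i.
Proof.
apply/permP => a; apply: (@perm_inj _ (sw i)); rewrite permKV !swE.
by rewrite swfK.
Qed.

(** Matrix form of the fact that a simple reflection permutes the positive roots other than its own:
    the simple root occupies two mirror positions, which coincide for the long root. *)
Lemma sw_lt i a b : (a < b)%N -> (sw i b < sw i a)%N ->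
  (a = pos i /\ b = nxt i) \/ (a = rev_ord (nxt i) /\ b = rev_ord (pos i)).
Proof.
rewrite !swE !swfE => ab h.
suff : ((a : nat) = i /\ (b : nat) = i.+1) \/
       ((a : nat) = (n + n - i.+2)%N /\ (b : nat) = (n + n - i.+1)%N).
  by case=> -[ea eb]; [left|right]; split; apply: val_inj => /=; rewrite ?nxtE.
move: h; have := ltn_ord i; have := ltn_ord a; have := ltn_ord b.
by do 8?[case: eqP => ?]; lia.
Qed.

Definition srefl_sign (i : 'I_n) (a : I) : F :=
  if (i.+1 < n)%N then 1 else if a == nxt i then -1 else 1.

Lemma simple_reflE i :
  simple_refl F i = \matrix_(a, b) (srefl_sign i a *+ (b == sw i a)).
Proof.
apply/matrixP => a b; rewrite /simple_refl /srefl_sign -/(pos i) -/(nxt i).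
case: ifP => hi; last rewrite !mxE.
  rewrite -perm_mxM !mxE swE.
  have -> : (tperm (pos i) (nxt i) * tperm (rev_ord (pos i)) (rev_ord (nxt i)))%g a
     = swf i a.
    have tE (x y z : I) : tperm x y z = (if (z : nat) == x then y
        else if (z : nat) == y then x else z) :> nat.
      by rewrite !val_eqE; case: tpermP => [->|->|/eqP/negPf-> /eqP/negPf->];
        rewrite ?eqxx //; case: eqP => // ->.
    rewrite permM; apply: val_inj => /=; rewrite swfE [LHS]tE.
    have := tE (pos i) (nxt i) a; move: (tperm _ _ a) => c; rewrite /= !nxtE.
    have := ltn_ord i; have := ltn_ord a.
    by do 8?[case: eqP => ?]; rewrite /= ?nxtE; lia.
  by rewrite eq_sym.
have hn : i.+1 = n by have := ltn_ord i; lia.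
rewrite swE.
have -> : (b == swf i a) = if a == pos i then b == nxt i else
    if a == nxt i then b == pos i else b == a.
  rewrite -!val_eqE /= swfE ?nxtE.
  by have := ltn_ord a; do 4?[case: ifP => /eqP ?]; lia.
have hpq : (nxt i == pos i) = false.
  by apply/negbTE; rewrite -val_eqE /= ?nxtE; lia.
have [->|ap] := eqVneq a (pos i).
  rewrite eq_sym in hpq; rewrite hpq /=; case: eqP => // _.
  by rewrite andbF.
have [->|aq] := eqVneq a (nxt i).
  by rewrite /= andbF; case: eqP.
by rewrite /= !andbT eq_sym.
Qed.

Lemma mono_simple i : mono (sw i) (simple_refl F i).
Proof.
exists (srefl_sign i); last exact: simple_reflE.
by move=> a; rewrite /srefl_sign; do 2?case: ifP => _; by [left|right].
Qed.

Lemma Sp_simple (i : 'I_n) : Sp (simple_refl F i).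
Proof.
apply: Sp_mono (@sw_rev i) (simple_reflE i) _ => a.
rewrite swE /srefl_sign /eps -!val_eqE /= swfE ?nxtE.
have := ltn_ord i; have := ltn_ord a => ha hi; have [hin|hin] := ltnP i.+1 n;
  by do 6?[case: eqP => ?]; do 2?case: ifP => ?;
     rewrite ?(mulr1, mul1r, mulrNN) //; lia.
Qed.

Definition wperm (s : seq 'I_n) : {perm I} := (\prod_(i <- s) sw i)%g.

Lemma wperm_cat (s t : seq 'I_n) : wperm (s ++ t) = (wperm s * wperm t)%g.
Proof. exact: big_cat. Qed.

Lemma wperm_rev (s : seq 'I_n) : comm_rev (wperm s).
Proof.
rewrite /wperm; elim: s => [|i s IH]; first by move=> a; rewrite big_nil !perm1.
by rewrite big_cons; apply: comm_revM IH; apply: sw_rev.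
Qed.

Lemma word_mx_cat (s t : seq 'I_n) : word_mx F (s ++ t) = word_mx F s *m word_mx F t.
Proof.
rewrite /word_mx; elim: s => [|i s IH] /=; first by rewrite big_nil mul1mx.
by rewrite !big_cons IH mulmxA.
Qed.

Lemma word_mx_rcons (s : seq 'I_n) i : word_mx F (rcons s i) = word_mx F s *m simple_refl F i.
Proof. by rewrite -cats1 word_mx_cat {2}/word_mx big_cons big_nil mulmx1. Qed.

Lemma mono_word (s : seq 'I_n) : mono (wperm s) (word_mx F s).
Proof.
rewrite /wperm /word_mx; elim: s => [|i s IH]; rewrite ?big_nil ?big_cons.
  exact: mono1.
by apply: mono_mul IH; apply: mono_simple.
Qed.

Lemma Sp_word (s : seq 'I_n) : Sp (word_mx F s).
Proof.
rewrite /word_mx; elim: s => [|i s IH]; rewrite ?big_nil ?big_cons.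
  exact: Sp1.
by apply: Sp_mul IH; apply: Sp_simple.
Qed.

Lemma Tor_conj_mono s x (t : M) : mono s x -> Sp x -> Tor t -> Tor (x *m t *m invmx x).
Proof.
move=> mx sx /torP[st ut lt]; have [e _ eE] := mono_conj mx.
have sp : Sp (x *m t *m invmx x) by apply: Sp_mul (Sp_inv sx); apply: Sp_mul.
have d a b : a != b -> (x *m t *m invmx x) a b = 0.
  move=> ab; rewrite eE; have : s a != s b by rewrite (inj_eq perm_inj).
  rewrite -val_eqE neq_ltn => /orP[h|h]; first by rewrite lt // mulr0.
  by rewrite ut // mulr0.
apply/torP; split=> // a b ab; apply: d; apply/eqP => h;
  by rewrite h ltnn in ab.
Qed.

Lemma weyl_weyl_word (s : seq 'I_n) : weyl (@weyl_word F n s).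
Proof.
exists (word_mx F s) => //; split=> [|t]; first exact: Sp_word.
have mw := mono_word s; have sw' := Sp_word s.
split=> [|h]; first exact: Tor_conj_mono mw sw'.
have := Tor_conj_mono (mono_inv mw) (Sp_inv sw') h.
rewrite invmxK -!mulmxA mulVmx ?Sp_unit // mulmx1 mulmxA.
by rewrite mulVmx ?Sp_unit // mul1mx.
Qed.

(** The permutation determines the coset, since symplectic signed permutation matrices over one
    permutation differ by an element of T ([mono_diff]). *)
Lemma weyl_word_eq (s t : seq 'I_n) : wperm s = wperm t -> @weyl_word F n s = @weyl_word F n t.
Proof.
move=> e; apply/seteqP.
suff h (s' t' : seq 'I_n) : wperm s' = wperm t' -> @weyl_word F n s' `<=` @weyl_word F n t'.
  by split; apply: h.
move=> {}e x [d hd <-].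
have hT : Tor (invmx (word_mx F t') *m word_mx F s').
  apply: (mono_diff (mono_word t')); rewrite -?e; [exact: mono_word|exact: Sp_word..].
exists (invmx (word_mx F t') *m word_mx F s' *m d); first exact: Tor_mul.
by rewrite !mulmxA mulmxV ?mul1mx // Sp_unit //; apply: Sp_word.
Qed.

Lemma weyl_word_mem (s : seq 'I_n) : @weyl_word F n s (word_mx F s).
Proof. by exists 1%:M; [apply: Tor1|rewrite mulmx1]. Qed.

End Monomial.

(** * Root elements *)

Section RootElements.
Variables (F : padicFieldType) (n : nat).
Local Notation M := 'M[F]_(n + n).
Local Notation I := 'I_(n + n).
Implicit Types (g h x y A B : M) (a b c p q : I) (i : 'I_n).

(** The entry at (p, q) forces a mirror entry by the form. In the long root case q = [rev_ord p]
    both places coincide and the two branches agree. *)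
Definition xr_nil p q (r : F) : M := \matrix_(a, b)
  (if (a == p) && (b == q) then r
   else if (a == rev_ord q) && (b == rev_ord p) then - (r * (eps F p * eps F q))
   else 0).

Definition xr p q r : M := 1%:M + xr_nil p q r.

Lemma xr_nil_supp p q r a b : xr_nil p q r a b != 0 ->
  (a = p /\ b = q) \/ (a = rev_ord q /\ b = rev_ord p).
Proof.
rewrite mxE; case: ifP => [/andP[/eqP-> /eqP->]|_]; first by left.
by case: ifP => [/andP[/eqP-> /eqP->]|_]; [right|rewrite eqxx].
Qed.

(** The nonzero columns q and [rev_ord p] are disjoint from the nonzero rows p and [rev_ord q]. The
    same disjointness is what is later asked of X and Y in [fK]. *)
Lemma xr_nil_mul p q r r' : p != q -> xr_nil p q r *m xr_nil p q r' = 0.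
Proof.
move=> pq; apply/matrixP => a b; rewrite mxE [RHS]mxE big1 // => c _.
apply/eqP/negPn/negP; rewrite mulf_eq0 negb_or.
move=> /andP[/xr_nil_supp h1 /xr_nil_supp h2].
case: h1 => -[_ h1]; case: h2 => -[h2 _]; move: h2; rewrite h1 => /eqP.
- by rewrite eq_sym (negPf pq).
- by rewrite eq_sym rev_ord_neq.
- by rewrite rev_ord_neq.
- by rewrite (inj_eq rev_ord_inj) (negPf pq).
Qed.

Lemma xr_nil_adj p q r : sp_adj (xr_nil p q r) = - xr_nil p q r.
Proof.
have rv a b : (rev_ord a == b) = (a == rev_ord b).
  by rewrite -(inj_eq rev_ord_inj) rev_ordK.
have epq : eps F p * eps F q * (eps F p * eps F q) = 1.
  by rewrite mulrACA !eps_mul mulr1.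
apply/matrixP => a b; rewrite !mxE !rv !rev_ordK.
rewrite ![(b == _) && _]andbC.
have [/andP[/eqP-> /eqP->]|_] := boolP ((a == p) && (b == q)).
  case: ifP => [/andP[/eqP ep _]|_].
    have -> : eps F p = - eps F q by rewrite ep eps_rev.
    by rewrite mulNr eps_mul mulN1r.
  by rewrite mulrN [r * _]mulrC mulrA epq mul1r.
case: ifP => [/andP[/eqP-> /eqP->]|_]; last by rewrite mulr0 oppr0.
by rewrite !eps_rev mulrNN opprK [RHS]mulrC [eps F q * _]mulrC.
Qed.

Lemma xrM p q r r' : p != q -> xr p q r *m xr p q r' = xr p q (r + r').
Proof.
move=> pq; rewrite /xr mulmxDl mul1mx mulmxDr mulmx1 xr_nil_mul // addr0.
rewrite -addrA; congr (_ + _); apply/matrixP => a b; rewrite !mxE.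
by case: ifP => _; [rewrite addrC|case: ifP => _; ring].
Qed.

Lemma xr0 p q : xr p q 0 = 1%:M.
Proof.
rewrite /xr [xr_nil _ _ _](_ : _ = 0) ?addr0 //; apply/matrixP => a b.
by rewrite !mxE mul0r oppr0 !if_same.
Qed.

Lemma Sp_xr p q r : p != q -> Sp (xr p q r).
Proof.
move=> pq; apply/SpP; rewrite /xr.
have -> : sp_adj (1%:M + xr_nil p q r) = 1%:M + sp_adj (xr_nil p q r).
  rewrite -{2}(@sp_adj1 F n); apply/matrixP => a b; rewrite !mxE.
  by rewrite mulrDr.
rewrite xr_nil_adj mulmxDl mul1mx mulNmx mulmxDr mulmx1 xr_nil_mul //.
by rewrite addr0 addrK.
Qed.

Lemma xr_diag p q r a : p != q -> xr p q r a a = 1.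
Proof.
move=> pq; suff x0 : xr_nil p q r a a = 0.
  by rewrite mxE x0 addr0 mxE eqxx.
apply/eqP/negPn/negP => /xr_nil_supp[[e1 e2]|[e1 e2]].
  by rewrite -e1 -e2 eqxx in pq.
by move: pq; rewrite -(inj_eq rev_ord_inj) -e1 -e2 eqxx.
Qed.

Lemma xr_offdiag p q r a b : a != b -> xr p q r a b = xr_nil p q r a b.
Proof. by move=> ab; rewrite mxE mxE (negPf ab) add0r. Qed.

Lemma Uni_xr p q r : (p < q)%N -> Uni (xr p q r).
Proof.
move=> pq; have pq' : p != q by rewrite -val_eqE neq_ltn pq.
apply/UniP; split; [exact: Sp_xr|by move=> a; apply: xr_diag|move=> a b ba].
rewrite xr_offdiag; last by rewrite -val_eqE neq_ltn ba orbT.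
apply/eqP/negPn/negP => /xr_nil_supp[[e1 e2]|[e1 e2]].
  by move: ba; rewrite e1 e2; lia.
by move: ba; rewrite e1 e2 /=; have := ltn_ord q; lia.
Qed.

(** Conjugation by y moves the entry (p, q) to the position obtained by applying s^-1, so the
    hypothesis says that the transported root is positive. *)
Lemma xr_conj_Uni (s : {perm I}) y p q r : mono s y -> Sp y -> comm_rev s ->
  ((s^-1)%g p < (s^-1)%g q)%N -> Uni (y *m xr p q r *m invmx y).
Proof.
move=> my sy cs lt; have [e he eE] := mono_conj my.
have pq : p != q by apply: contraTneq lt => ->; rewrite ltnn.
apply/UniP; split.
- by apply: Sp_mul (Sp_inv sy); apply: Sp_mul => //; apply: Sp_xr.
- by move=> a; rewrite eE is_signK // mul1r xr_diag.
- move=> a b ba; rewrite eE xr_offdiag; last first.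
    by rewrite (inj_eq perm_inj) -val_eqE neq_ltn ba orbT.
  apply/eqP; rewrite mulf_eq0; apply/orP; right.
  have cs' := comm_revV cs.
  apply/negPn/negP => /xr_nil_supp[[e1 e2]|[e1 e2]].
    by move: lt; rewrite -e1 -e2 !permK; lia.
  move: (congr1 (s^-1)%g e1) (congr1 (s^-1)%g e2); rewrite !permK !cs'.
  by move=> ea eb; move: ba; rewrite ea eb /=; have := ltn_ord ((s^-1)%g q); lia.
Qed.

Lemma xr_mulE p q r A a b : p != q -> (xr p q r *m A) a b = A a b +
  (if a == p then r * A q b
   else if a == rev_ord q then - (r * (eps F p * eps F q)) * A (rev_ord p) b
   else 0).
Proof.
move=> pq; rewrite mulmxDl mul1mx mxE; congr (_ + _); rewrite mxE.
have [->|ap] := eqVneq a p.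
  rewrite (bigD1 q) //= mxE !eqxx /= big1 ?addr0 // => c cq.
  rewrite mxE (negPf cq) andbF; case: ifP => [/andP[/eqP e /eqP ec]|_].
    by move: cq; rewrite ec e rev_ordK eqxx.
  by rewrite mul0r.
have [ea|aq] := eqVneq a (rev_ord q).
  rewrite {a}ea in ap *; rewrite (bigD1 (rev_ord p)) //= mxE !eqxx /= big1 => [|c cq].
    by rewrite addr0 (negPf ap).
  by rewrite mxE (negPf cq) andbF (negPf ap) mul0r.
rewrite big1 // => c _; rewrite mxE.
by move: ap aq => /negPf-> /negPf->; rewrite mul0r.
Qed.

End RootElements.

(** * Simple root coordinates and the rank-one identity *)

Section SimpleRoots.
Variables (F : padicFieldType) (n : nat).
Local Notation M := 'M[F]_(n + n).
Local Notation I := 'I_(n + n).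
Implicit Types (g h x y A B u v : M) (a b c p q : I) (i : 'I_n).

Lemma pos_lt_nxt i : (pos i < nxt i)%N.
Proof. by rewrite nxt_val. Qed.

Lemma pos_neq_nxt i : pos i != nxt i.
Proof. by rewrite -val_eqE neq_ltn pos_lt_nxt. Qed.

Lemma nxt_neq_pos i : nxt i != pos i.
Proof. by rewrite eq_sym pos_neq_nxt. Qed.

Lemma uni_mul_adj u v p q : q = p.+1 :> nat -> Uni u -> Uni v ->
  (u *m v) p q = u p q + v p q.
Proof.
move=> qp /UniP[_ du uu] /UniP[_ dv uv]; have pq : q != p by rewrite -val_eqE /=; lia.
rewrite mxE (bigD1 p) //= (bigD1 q) //= big1 => [|c /andP[cp cq]].
  by rewrite du dv mul1r mulr1 addr0 addrC.
have [cp'|cp'] := ltnP c p; first by rewrite uu // mul0r.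
rewrite uv ?mulr0 //; move: cp cq; rewrite -!val_eqE /=; lia.
Qed.

Lemma uni_inv_adj u p q : q = p.+1 :> nat -> Uni u -> invmx u p q = - u p q.
Proof.
move=> qp hu; apply/eqP; rewrite -addr_eq0 -uni_mul_adj //; last exact: Uni_inv.
rewrite mulVmx; last by apply: Sp_unit; case: hu.
have /negPf e : p != q by rewrite -val_eqE /=; lia.
by rewrite mxE e.
Qed.

Lemma uni_rev_adj u p q : q = p.+1 :> nat -> Uni u -> u p q = 0 ->
  u (rev_ord q) (rev_ord p) = 0.
Proof.
move=> qp hu e; have := uni_inv_adj qp hu.
rewrite e oppr0 Sp_invE; last by case: hu.
by rewrite mxE => /eqP; rewrite !mulf_eq0 !(negPf (eps_neq0 _ _)) => /eqP.
Qed.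

Lemma xr_pq p q r : p != q -> xr p q r p q = r :> F.
Proof. by move=> pq; rewrite xr_offdiag // mxE !eqxx. Qed.

Lemma uni_decomp_r u i : Uni u -> exists2 u1,
  Uni u1 /\ u1 (pos i) (nxt i) = 0 &
  u = u1 *m xr (pos i) (nxt i) (u (pos i) (nxt i)).
Proof.
move=> hu; set r := u _ _; have pq := pos_neq_nxt i.
exists (u *m xr (pos i) (nxt i) (- r)); last first.
  by rewrite -mulmxA xrM // addNr xr0 mulmx1.
have hx := Uni_xr (- r) (pos_lt_nxt i).
by split; [apply: Uni_mul|rewrite uni_mul_adj ?nxt_val // xr_pq // subrr].
Qed.

Lemma uni_decomp_l u i : Uni u -> exists r u1,
  [/\ Uni u1, u1 (pos i) (nxt i) = 0 & u = xr (pos i) (nxt i) r *m u1].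
Proof.
move=> hu; have [u1 [hu1 e0]] := uni_decomp_r i (Uni_inv hu).
set r := invmx u _ _ => e; exists (- r), (invmx u1); split.
- exact: Uni_inv.
- by rewrite uni_inv_adj ?nxt_val // e0 oppr0.
- have eZ : invmx u *m (xr (pos i) (nxt i) (- r) *m invmx u1) = 1%:M.
    rewrite e -mulmxA [xr _ _ _ *m (_ *m _)]mulmxA xrM ?pos_neq_nxt // subrr.
    by rewrite xr0 mul1mx mulmxV //; apply/Sp_unit/Uni_Sp.
  by rewrite -[LHS]mulmx1 -eZ mulKVmx //; apply/Sp_unit/Uni_Sp.
Qed.

(** With zero simple coordinate, u lies in the unipotent radical of the minimal parabolic, which the
    reflection normalizes: by [sw_lt] only the entry of the simple root and its mirror could leave
    the upper triangle. *)
Lemma Uni_conj_sw x u i : mono (sw i) x -> Sp x -> Uni u ->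
  u (pos i) (nxt i) = 0 -> Uni (x *m u *m invmx x).
Proof.
move=> mx sx hu e0; have /UniP[su du uu] := hu.
have e0' := @uni_rev_adj _ (pos i) _ (nxt_val i) hu e0.
have [e he eE] := mono_conj mx; apply/UniP; split.
- by apply: Sp_mul (Sp_inv sx); apply: Sp_mul.
- by move=> a; rewrite eE du mulr1 is_signK.
- move=> a b ba; rewrite eE.
  have [lt|le] := ltnP (sw i b) (sw i a); first by rewrite uu // mulr0.
  have lt : (sw i a < sw i b)%N.
    rewrite ltn_neqAle le andbT; apply/eqP => /val_inj/perm_inj h.
    by rewrite h ltnn in ba.
  have swK c : sw i (sw i c) = c by rewrite !swE swfK.
  have [] := sw_lt lt (i := i); rewrite ?swK // => -[ea eb].
    by rewrite ea eb e0 mulr0.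
  by rewrite ea eb e0' mulr0.
Qed.

(** The SL_2 computation: the entry 1 + r(-1/r) that would remain below the diagonal cancels. For a
    short simple root there are two mirror blocks, for the long one a single block. *)
Lemma sl2_bor i (r : F) : r != 0 ->
  Bor (simple_refl F i *m xr (pos i) (nxt i) r *m xr (nxt i) (pos i) (- r^-1)).
Proof.
move=> r0; have pq := pos_neq_nxt i; have qp := nxt_neq_pos i.
set p := pos i in pq qp *; set q := nxt i in pq qp *.
apply/borP; split.
  by apply: Sp_mul; [apply: Sp_mul|]; [apply: Sp_simple|apply: Sp_xr..].
move=> a b ba; rewrite -mulmxA simple_reflE mono_mulmxE; apply/eqP.
rewrite mulf_eq0; apply/orP; right; apply/eqP; rewrite xr_mulE //.
set Y := xr q p _.
have vp : p = i :> nat by [].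
have vq : q = i.+1 :> nat by exact: nxt_val.
have hi := ltn_ord i; have hb := ltn_ord b; have ha := ltn_ord a.
clearbody p q.
have Y0 (c d : I) : (d < c)%N -> ~ (c = q /\ d = p) ->
    ~ (c = rev_ord p /\ d = rev_ord q) -> Y c d = 0.
  move=> dc h1 h2; rewrite xr_offdiag; last by rewrite -val_eqE neq_ltn dc orbT.
  by apply/eqP/negPn/negP => /xr_nil_supp[].
have Yd c : Y c c = 1 by apply: xr_diag.
have Yqp : Y q p = - r^-1 by rewrite /Y xr_pq.
have Yrv : (p : nat) <> (rev_ord q : nat) ->
    Y (rev_ord p) (rev_ord q) = r^-1 * (eps F q * eps F p).
  move=> h; rewrite xr_offdiag; last by rewrite (inj_eq rev_ord_inj).
  rewrite mxE !eqxx ifF ?mulNr ?opprK //.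
  by apply/negbTE/negP => /andP[_ /eqP e]; apply: h; rewrite -e.
have sE := swE i a; have vs := congr1 (@nat_of_ord _) sE; rewrite swfE in vs.
have [sp|sp] := eqVneq (sw i a) p.
  have aq : a = q by apply: val_inj; move: vs; rewrite sp vp;
    do 4?[case: eqP => ?]; rewrite /= ?vq; lia.
  rewrite sp; have [bp|bp] := eqVneq b p.
    by rewrite bp Yd Yqp mulrN mulfV // subrr.
  have bp' : (b < p)%N by move: bp; rewrite -val_eqE /=; move: ba; rewrite aq vq; lia.
  rewrite !Y0 ?mulr0 ?addr0 //; rewrite ?vq; try lia.
  - by move=> [_ e]; rewrite e eqxx in bp.
  - by move=> [e1 e2]; move: bp'; rewrite e2 /= vq => h;
       move/(congr1 val): e1; rewrite /= vq; lia.
  - by move=> [_ e]; rewrite e eqxx in bp.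
  - by move=> [e1 e2]; move/(congr1 val): e1; rewrite /=; lia.
(* The mirror row. It is a new case only when p differs from [rev_ord q], that is for a short simple
   root, and the same cancellation occurs there. *)
have [sq|sq] := eqVneq (sw i a) (rev_ord q).
  have sq' := congr1 val sq; rewrite /= vq in sq'.
  have vps : (sw i a : nat) <> p by move=> /val_inj e; rewrite e eqxx in sp.
  have aq : a = rev_ord p by apply: val_inj; move: vs; rewrite sq /= vq vp;
    rewrite vp in vps; do 4?[case: eqP => ?]; lia.
  have h : (p : nat) <> rev_ord q by rewrite -sq; move=> e; apply: vps.
  rewrite sq; have [bp|bp] := eqVneq b (rev_ord q).
    rewrite bp Yd Yrv // mulNr.
    have -> : r * (eps F p * eps F q) * (r^-1 * (eps F q * eps F p)) =
        (r * r^-1) * ((eps F p * eps F p) * (eps F q * eps F q)) by ring.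
    by rewrite mulfV // !eps_mul !mulr1 subrr.
  have bp' : (b < rev_ord q)%N.
    by move: bp; rewrite -val_eqE /=; move: ba; rewrite aq /= vq; lia.
  move: (bp') => /=; rewrite vq => bp''.
  rewrite !Y0 ?mulr0 ?addr0 //= ?vq; try lia.
  - by move=> [e _]; move/(congr1 val): e; rewrite /= vq; lia.
  - by move=> [e1 e2]; move: bp''; rewrite e2 /= vq; lia.
  - by move=> [e1 e2]; move/(congr1 val): e1; rewrite /= vq; lia.
  - by move=> [_ e]; move: bp''; rewrite e /= vq; lia.
rewrite addr0.
have vps : (sw i a : nat) <> i by move=> e; case/eqP: sp; apply: val_inj; rewrite /= vp.
have vqs : (sw i a : nat) <> (n + n - i.+2)%N.
  by move=> e; case/eqP: sq; apply: val_inj; rewrite /= vq.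
have [sa|sa] := eqVneq (sw i a) a.
  rewrite sa; apply: Y0 => //.
    by move=> [e _]; move: vs vps vqs; rewrite sa e vq; do 4?[case: eqP => ?]; lia.
  by move=> [e _]; move: vs vps vqs; rewrite sa e /=; do 4?[case: eqP => ?]; lia.
have lt : (b < sw i a)%N.
  have {}sa : (sw i a : nat) <> a by move=> /val_inj e; rewrite e eqxx in sa.
  by move: vs vps vqs sa; do 4?[case: eqP => ?]; lia.
apply: Y0 => // -[e1 e2]; move/(congr1 val): e1; move/(congr1 val): e2 => /=.
  by move: vs vps vqs; rewrite vq; do 4?[case: eqP => ?]; lia.
by move: vs vps vqs; rewrite vq; do 4?[case: eqP => ?]; lia.
Qed.

Lemma sl2_bruhat i (r : F) : r != 0 -> exists2 b, Bor b &
  simple_refl F i *m xr (pos i) (nxt i) r = b *m xr (nxt i) (pos i) r^-1.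
Proof.
move=> r0; exists (simple_refl F i *m xr (pos i) (nxt i) r *m
  xr (nxt i) (pos i) (- r^-1)); first exact: sl2_bor.
by rewrite -[RHS]mulmxA xrM ?nxt_neq_pos // addNr xr0 mulmx1.
Qed.

End SimpleRoots.

(** * Peeling off the letters of a word, and the deletion property *)

Section KeyDecomposition.
Variables (F : padicFieldType) (n : nat).
Local Notation M := 'M[F]_(n + n).
Local Notation I := 'I_(n + n).
Implicit Types (g h x y A B u v : M) (a b c p q : I) (i : 'I_n).
Implicit Types (s : seq 'I_n) (theta : I -> int).

Definition low_cells s : set M :=
  [set g | exists2 s', subseq s' s & bruhat_cell (word_mx F s') g].

(** The rule that BwBsB lies in the union of BwB and BwsB. If w(alpha) is positive, x_alpha(r)
    passes through w into B. If it is negative and r is not 0, the rank-one identity trades it for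
    x_{-alpha}(1/r), which does pass, and the letter disappears. *)
Lemma low_cells_rcons s i g (b : M) : low_cells s g -> Bor b ->
  low_cells (rcons s i) (g *m simple_refl F i *m b).
Proof.
move=> [s' ss [b1 [_ [h1 [t [u [ht hu ->]]] ->]]]] hb.
have [r [u1 [hu1 e0 ->]]] := uni_decomp_l i hu.
set y := word_mx F s'; set x := simple_refl F i.
have my : mono (wperm s') y by apply: mono_word.
have sy : Sp y by apply: Sp_word.
have uy := Sp_unit sy.
have mx : mono (sw i) x by apply: mono_simple.
have sx : Sp x by apply: Sp_simple.
have ux := Sp_unit sx.
have hb1 : Bor (b1 *m (y *m t *m invmx y)).
  by apply: Bor_mul h1 (Tor_Bor _); apply: Tor_conj_mono my sy ht.
have hb2 : Bor (invmx x *m u1 *m x *m b).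
  apply: Bor_mul hb; rewrite -[x in _ *m x]invmxK; apply: Uni_Bor.
  by apply: (@Uni_conj_sw _ _ _ _ i) => //; [rewrite -swV; apply: mono_inv|apply: Sp_inv].
set X := xr _ _ r.
have eE : b1 *m y *m (t *m (X *m u1)) *m x *m b =
    b1 *m (y *m t *m invmx y) *m (y *m X *m x) *m (invmx x *m u1 *m x *m b).
  by rewrite !mulmxA -[_ *m invmx y *m y]mulmxA mulVmx // mulmx1
     -[_ *m x *m invmx x]mulmxA mulmxV // mulmx1.
rewrite eE => {eE}.
have up : low_cells (rcons s i) (b1 *m (y *m t *m invmx y) *m (y *m x) *m
    (invmx x *m u1 *m x *m b)).
  exists (rcons s' i); first by rewrite -!cats1; apply: cat_subseq.
  exists (b1 *m (y *m t *m invmx y)), (invmx x *m u1 *m x *m b); split=> //.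
  by rewrite word_mx_rcons.
have mv (b' z : M) : y *m z *m invmx y = b' -> y *m z = b' *m y.
  by move=> <-; rewrite -mulmxA mulVmx // mulmx1.
have [lt|le] := ltnP ((wperm s')^-1%g (pos i)) ((wperm s')^-1%g (nxt i)).
  have hX := xr_conj_Uni r my sy (@wperm_rev n s') lt.
  rewrite (mv _ X erefl); exists (rcons s' i).
    by rewrite -!cats1; apply: cat_subseq.
  exists (b1 *m (y *m t *m invmx y) *m (y *m X *m invmx y)).
  exists (invmx x *m u1 *m x *m b); split=> //.
    by apply: Bor_mul hb1 (Uni_Bor hX).
  by rewrite word_mx_rcons !mulmxA.
have [r0|r0] := eqVneq r 0; first by rewrite /X r0 xr0 mulmx1.
have lt : ((wperm s')^-1%g (nxt i) < (wperm s')^-1%g (pos i))%N.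
  rewrite ltn_neqAle le andbT; apply/eqP => /val_inj/perm_inj/eqP.
  by rewrite (negPf (nxt_neq_pos i)).
have hxx : Tor (x *m x).
  by rewrite -{1}[x]invmxK; apply: (@mono_diff _ _ (sw i)) => //;
    [rewrite -swV; apply: mono_inv|apply: Sp_inv].
have nr0 : - r != 0 by rewrite oppr_eq0.
have [b' hb' eb'] := sl2_bruhat i nr0.
have sb' := Sp_unit (Bor_Sp hb').
(* Inverting [sl2_bruhat] at -r produces x^-1; x is recovered through x^2, which lies in T. *)
have eX : X *m x = xr (nxt i) (pos i) r^-1 *m (invmx b' *m (x *m x)).
  rewrite !mulmxA; congr (_ *m x).
  have e1 : (x *m xr (pos i) (nxt i) (- r)) *m (X *m invmx x) = 1%:M.
    by rewrite mulmxA -[_ *m X]mulmxA xrM ?pos_neq_nxt // addNr xr0 mulmx1 mulmxV.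
  have e2 : b' *m xr (nxt i) (pos i) (- r)^-1 *m
      (xr (nxt i) (pos i) r^-1 *m invmx b') = 1%:M.
    rewrite mulmxA -[_ *m xr _ _ r^-1]mulmxA xrM ?nxt_neq_pos // invrN addNr.
    by rewrite xr0 mulmx1 mulmxV.
  rewrite eb' in e1; have [ub _] := mulmx1_unit e1.
  have e3 : X *m invmx x = xr (nxt i) (pos i) r^-1 *m invmx b'.
    by rewrite -[LHS](mulKmx ub) e1 -e2 mulKmx.
  by rewrite -e3 -mulmxA mulVmx // mulmx1.
rewrite -[y *m X *m x]mulmxA eX [y *m (_ *m _)]mulmxA.
have hX := xr_conj_Uni r^-1 my sy (@wperm_rev n s') lt.
rewrite (mv _ (xr (nxt i) (pos i) r^-1) erefl); exists s'.
  by apply: subseq_trans ss _; apply: subseq_rcons.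
exists (b1 *m (y *m t *m invmx y) *m (y *m xr (nxt i) (pos i) r^-1 *m invmx y)).
exists (invmx b' *m (x *m x) *m (invmx x *m u1 *m x *m b)); split.
- by apply: Bor_mul hb1 (Uni_Bor hX).
- by apply: Bor_mul hb2; apply: Bor_mul (Bor_inv hb') (Tor_Bor hxx).
- by rewrite !mulmxA.
Qed.

(** The symmetry that gives the two mirror entries of a symplectic root element the same exponent
    bound. *)
Definition rev_sym theta := exists k, forall a, theta a + theta (rev_ord a) = k.

(* [good theta r]: the word read from right to left along r creates a new
   inversion at every step. *)
Fixpoint good theta (r : seq 'I_n) : Prop :=
  if r is i :: r' then
    theta (pos i) < theta (nxt i) /\ good (theta \o sw i) r'
  else True.

(** For theta a = 2ma these are the exponents of H_m, as conjugation by d_m shifts the entry (a, b)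
    by 2m(a - b). Composing theta with a permutation conjugates by a Weyl element. *)
Definition fH theta (m : int) a b : int := theta a - theta b + m.

(* The conjugates of a large negative root element x_{-gamma}(s) by H_m stay in
   the lattice [fK], where X and Y are the rows and columns of the root
   vector; an entry gains m for each index outside X, Y. *)
Definition fK theta (m : int) (X Y : pred I) a b : int :=
  theta a - theta b + 1 - m + (if X a then 0 else m) + (if Y b then 0 else m).

(** The middle index c misses X or Y, so one extra m appears on the right and absorbs the second
    -m. *)
Lemma fK_mul theta m (X Y : pred I) a c b : 0 <= m -> ~~ (X c && Y c) ->
  fK theta m X Y a b <= fK theta m X Y a c + fK theta m X Y c b.
Proof. by rewrite /fK; move: (X a) (X c) (Y c) (Y b) => [] [] [] []; lia. Qed.

Lemma fK_diag theta m (X Y : pred I) a : 0 <= m -> ~~ (X a && Y a) ->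
  1 <= fK theta m X Y a a.
Proof. by rewrite /fK; move: (X a) (Y a) => [] []; lia. Qed.

Lemma fHM theta m a c b : 0 <= m ->
  fH theta m a b <= fH theta m a c + fH theta m c b.
Proof. by rewrite /fH; lia. Qed.

(** Changing the row loses at most the m attached to lying outside X, and a factor from H_m brings m
    back; likewise for columns and Y. So the lattice is stable under H_m on both sides. *)
Lemma latt_fK_conj theta m (X Y : pred I) g h h' : 0 <= m ->
  latt (fK theta m X Y) g -> latt (fH theta m) (h' - 1%:M) ->
  latt (fH theta m) (h - 1%:M) -> latt (fK theta m X Y) (h' *m g *m h).
Proof.
move=> m0 hg hh' hh.
have h1 : latt (fK theta m X Y) (h' *m g).
  have -> : h' *m g = g + (h' - 1%:M) *m g by rewrite mulmxBl mul1mx subrKC.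
  apply: (lattD hg); apply: latt_mul hh' hg => a c b.
  by rewrite /fK /fH; move: (X a) (X c) (Y b) => [] [] []; lia.
have -> : h' *m g *m h = h' *m g + h' *m g *m (h - 1%:M).
  by rewrite mulmxBr mulmx1 subrKC.
apply: (lattD h1); apply: latt_mul h1 hh => a c b.
by rewrite /fK /fH; move: (X a) (Y c) (Y b) => [] [] []; lia.
Qed.

Lemma mono_latt (s : {perm I}) x (f f' : I -> I -> int) A : mono s x ->
  (forall a b, f' a b = f (s a) (s b)) -> latt f A ->
  latt f' (x *m A *m invmx x).
Proof.
move=> mx ff hA; have [e he eE] := mono_conj mx => a b.
by rewrite eE ff; apply: is_sign_pideal; [apply: is_sign_mul|apply: hA].
Qed.

Lemma conj_sub1 x g : x \in unitmx ->
  x *m g *m invmx x - 1%:M = x *m (g - 1%:M) *m invmx x.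
Proof. by move=> ux; rewrite mulmxBr mulmx1 mulmxBl mulmxV. Qed.

Lemma xr_latt theta m p q (r : F) : rev_sym theta ->
  pideal (fH theta m p q) r -> latt (fH theta m) (xr p q r - 1%:M).
Proof.
move=> [k sy] hr a b; rewrite /xr addrAC subrr add0r mxE.
case: ifP => [/andP[/eqP-> /eqP->]//|_].
case: ifP => [/andP[/eqP-> /eqP->]|_]; last exact: pideal0.
have -> : fH theta m (rev_ord q) (rev_ord p) = fH theta m p q.
  by rewrite /fH; have := sy p; have := sy q; lia.
apply: pidealN; rewrite mulrC; apply: is_sign_pideal => //.
by apply: is_sign_mul; apply: is_sign_eps.
Qed.

(** Induction on the reversed word, theta describing the conjugate of H_m seen by the letters still
    to be read. The support condition in the second alternative serves the induction: it keeps h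
    upper triangular after conjugation by the peeled letter. The first alternative has a shorter
    word because a large coordinate cancels its letter. *)
Lemma key_decomposition (m : int) r theta u : 0 <= m ->
  rev_sym theta -> good theta r -> Uni u ->
  (exists s (c g : M) (X Y : pred I), [/\ subseq s (rev r) /\ (size s < size r)%N,
     low_cells s c, word_mx F (rev r) *m u = c *m g, Sp g &
     (forall a, ~~ (X a && Y a)) /\ latt (fK theta m X Y) (g - 1%:M)]) \/
  (exists u' h, [/\ u = u' *m h, Uni u',
     Uni (word_mx F (rev r) *m u' *m invmx (word_mx F (rev r))),
     Uni h /\ latt (fH theta m) (h - 1%:M) &
     forall a b, a != b -> h a b != 0 -> theta a < theta b]).
Proof.
move=> m0; elim: r theta u => [|i r IH] theta u sy /=.
  move=> _ hu; right; exists u, 1%:M; split; rewrite ?mulmx1 //.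
  - have e1 : word_mx F (rev [::]) = 1%:M :> M by rewrite /word_mx big_nil.
    by rewrite e1 mul1mx invmx1 mulmx1.
  - split; [exact: Uni1|rewrite subrr => a b; rewrite mxE; exact: pideal0].
  - by move=> a b ab; rewrite mxE (negPf ab) eqxx.
move=> [lt gr] hu; rewrite rev_cons word_mx_rcons.
set y := word_mx F (rev r); set x := simple_refl F i.
set p := pos i; set q := nxt i.
have pq : p != q by apply: pos_neq_nxt.
have mx : mono (sw i) x by apply: mono_simple.
have sx : Sp x by apply: Sp_simple.
have ux := Sp_unit sx.
have mx' : mono (sw i) (invmx x) by rewrite -swV; apply: mono_inv.
have [u1 [hu1 u10]] := uni_decomp_r i hu; rewrite -/p -/q.
set rr := u p q => eu.
have hu2 : Uni (x *m u1 *m invmx x) by apply: Uni_conj_sw mx sx hu1 u10.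
have [k hk] := sy.
have [hr|hr] := pselect (pideal (fH theta m p q) rr); last first.
  left; have r0 : rr != 0 by apply/eqP => e; apply: hr; rewrite e; apply: pideal0.
  have [b hb eb] := sl2_bruhat i r0.
  pose X : pred I := fun a => (a == q) || (a == rev_ord p).
  pose Y : pred I := fun a => (a == p) || (a == rev_ord q).
  exists (rev r), (y *m (x *m u1 *m invmx x) *m b), (xr q p rr^-1), X, Y; split.
  - by rewrite size_rev; split=> //; apply: subseq_rcons.
  - exists (rev r) => //; exists 1%:M, (x *m u1 *m invmx x *m b); split.
    + exact: Uni_Bor (@Uni1 _ _).
    + by apply: Bor_mul hb; apply: Uni_Bor.
    + by rewrite mul1mx !mulmxA.
  - rewrite -[RHS]mulmxA -eb [in LHS]eu !mulmxA -[_ *m invmx x *m x]mulmxA.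
    by rewrite mulVmx // mulmx1.
  - by apply: Sp_xr; rewrite eq_sym.
  - split.
      move=> a; apply/negP => /andP[/orP[]/eqP-> /orP[]/eqP].
      - by move/eqP; rewrite eq_sym (negPf pq).
      - by move/eqP; rewrite eq_sym rev_ord_neq.
      - by move/eqP; rewrite rev_ord_neq.
      - by move/rev_ord_inj/eqP; rewrite (negPf pq).
    (* The inverse of a coordinate outside its ideal has exponent theta q - theta p + 1 - m, exactly
       the value of [fK] on X times Y. *)
    have hV := pidealV hr; have hp := hk p; have hq := hk q.
    have eF a b' : X a -> Y b' -> (theta a - theta b' = theta q - theta p) ->
        pideal (fK theta m X Y a b') rr^-1.
      move=> Xa Yb e; apply: pideal_le hV.
      by rewrite /fK Xa Yb /fH; lia.
    move=> a b'; rewrite /xr addrAC subrr add0r mxE.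
    case: ifP => [/andP[/eqP-> /eqP->]|_].
      by apply: eF; rewrite /X /Y ?eqxx.
    case: ifP => [/andP[/eqP-> /eqP->]|_]; last exact: pideal0.
    apply: pidealN; rewrite mulrC; apply: is_sign_pideal.
      by apply: is_sign_mul; apply: is_sign_eps.
    by apply: eF; rewrite /X /Y ?eqxx ?orbT //; lia.
have sy' : rev_sym (theta \o sw i).
  by exists k => a /=; rewrite sw_rev hk.
have hxr := xr_latt sy hr.
have hxr' := xr_latt sy (pidealN hr).
have uxr := Uni_xr rr (pos_lt_nxt i).
have eu' : y *m x *m u = y *m (x *m u1 *m invmx x) *m x *m xr p q rr.
  rewrite [in LHS]eu !mulmxA -[_ *m invmx x *m x]mulmxA.
  by rewrite mulVmx // mulmx1.
have swK c : sw i (sw i c) = c by rewrite !swE swfK.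
have [[s' [c [g [X [Y [[ss sz] hc e sg [dXY hg]]]]]]]|] := IH _ _ sy' gr hu2.
  (* The letter and its small root element move left past g: c absorbs them by [low_cells_rcons],
     and g becomes a conjugate covered by [latt_fK_conj]. *)
  left; exists (rcons s' i), (c *m x *m xr p q rr).
  exists (xr p q (- rr) *m (invmx x *m g *m x) *m xr p q rr).
  exists (X \o sw i), (Y \o sw i); split.
  - rewrite size_rcons; split=> //.
    by rewrite -!cats1; apply: cat_subseq.
  - exact: low_cells_rcons (Uni_Bor uxr).
  - rewrite eu' e !mulmxA -[_ *m xr p q rr *m xr p q _]mulmxA xrM // subrr xr0.
    by rewrite mulmx1 -[_ *m x *m invmx x]mulmxA mulmxV // mulmx1.
  - apply: Sp_mul (Sp_xr _ pq); apply: Sp_mul; first exact: Sp_xr.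
    exact: Sp_mul (Sp_mul (Sp_inv sx) sg) sx.
  - split; first by move=> a /=; apply: dXY.
    have -> : xr p q (- rr) *m (invmx x *m g *m x) *m xr p q rr - 1%:M =
       xr p q (- rr) *m (invmx x *m (g - 1%:M) *m invmx (invmx x)) *m xr p q rr.
      rewrite -conj_sub1 ?unitmx_inv // invmxK [X in _ = X *m _]mulmxBr mulmx1.
      by rewrite mulmxBl xrM // addNr xr0.
    apply: latt_fK_conj => //; apply: mono_latt mx' _ hg.
    by move=> a b; rewrite /fK /= !swK.
move=> [u' [h' [e hu' hyu [hh' lh'] sh']]]; right.
pose h1 := invmx x *m h' *m invmx (invmx x).
have [ee he eE] := mono_conj mx'.
have h1E a b : a != b -> h1 a b != 0 -> theta a < theta b /\ (sw i a < sw i b)%N.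
  move=> ab; rewrite /h1 eE mulf_eq0 negb_or => /andP[_ hn0]; split.
    have := @sh' (sw i a) (sw i b); rewrite /= !swK; apply=> //.
    by rewrite (inj_eq perm_inj).
  have /UniP[_ _ uh] := hh'; rewrite ltnNge; apply/negP => le.
  case/eqP: hn0; apply: uh; rewrite ltn_neqAle le andbT eq_sym.
  by rewrite val_eqE (inj_eq perm_inj).
have hh1 : Uni h1.
  apply/UniP; split.
  - apply: Sp_mul; last by rewrite invmxK.
    by apply: Sp_mul (Uni_Sp hh'); apply: Sp_inv.
  - move=> a; rewrite /h1 eE is_signK // mul1r.
    by have /UniP[_ ->] := hh'.
  (* By [sw_lt] an entry thrown below the diagonal sits at the simple root or its mirror, where the
     support condition on h' contradicts [theta (pos i) < theta (nxt i)]. *)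
  - move=> a b ba; apply/eqP/negPn/negP => n0.
    have ab : a != b by rewrite -val_eqE neq_ltn ba orbT.
    have [tl sl] := h1E a b ab n0.
    have [] := @sw_lt _ i b a ba sl => -[eb ea].
      by move: tl; rewrite ea eb; move: lt; lia.
    move: tl; rewrite ea eb; have := hk p; have := hk q; move: lt.
    by rewrite -/p -/q; lia.
have eh1 : u1 = (invmx x *m u' *m x) *m h1.
  rewrite /h1 invmxK !mulmxA -[_ *m x *m invmx x]mulmxA mulmxV // mulmx1.
  rewrite -[_ *m u' *m h']mulmxA -e !mulmxA mulVmx // mul1mx.
  by rewrite -mulmxA mulVmx // mulmx1.
exists (invmx x *m u' *m x), (h1 *m xr p q rr); split.
- by rewrite mulmxA -eh1.
(* Conjugating u' directly gives no control of its simple coordinate; unipotence is read off u1 and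
   h1 instead. *)
- have -> : invmx x *m u' *m x = u1 *m invmx h1.
    by rewrite eh1 mulmxK //; apply/Sp_unit/Uni_Sp.
  by apply: Uni_mul hu1 (Uni_inv hh1).
- have sy0 : Sp y by apply: Sp_word.
  have -> : y *m x *m (invmx x *m u' *m x) *m invmx (y *m x) = y *m u' *m invmx y.
    rewrite !mulmxA -[_ *m x *m invmx x]mulmxA mulmxV // mulmx1.
    rewrite invmx_mul //; last exact: Sp_unit.
    by rewrite mulmxA -[_ *m x *m invmx x]mulmxA mulmxV // mulmx1.
  exact: hyu.
- split; first exact: Uni_mul.
  apply: latt_sub1_mul => [a c b||]; first exact: fHM.
    rewrite /h1 conj_sub1 ?unitmx_inv //; apply: mono_latt mx' _ lh'.
    by move=> a b; rewrite /fH /= !swK.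
  exact: hxr.
- move=> a b ab n0; apply/negPn/negP; rewrite -leNgt => le.
  case/eqP: n0; rewrite mxE big1 // => c _; apply/eqP/negPn/negP.
  rewrite mulf_eq0 negb_or => /andP[n1 n2].
  have hx a' b' : a' != b' -> xr p q rr a' b' != 0 -> theta a' < theta b'.
    move=> ab'; rewrite xr_offdiag // => /xr_nil_supp[[-> ->]|[-> ->]] //.
    by have := hk p; have := hk q; move: lt; rewrite -/p -/q; lia.
  have [ac|ac] := eqVneq a c.
    by rewrite -ac in n2; have := hx _ _ ab n2; lia.
  have [t1 _] := h1E _ _ ac n1.
  have [cb|cb] := eqVneq c b; first by rewrite cb in t1; lia.
  by have := hx _ _ cb n2; lia.
Qed.

(** The deletion property. A step without a new inversion makes some simple root negative under the
    letters to its right, and then two letters of the word cancel. *)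
Lemma not_good_exchange theta r : (forall a b, (a < b)%N -> theta a < theta b) ->
  ~ good theta r ->
  exists2 s, subseq s (rev r) /\ (size s < size r)%N &
    @weyl_word F n s = weyl_word (rev r).
Proof.
move=> inc.
(* t collects the letters already read, which have turned theta into its composite with
   [wperm t]. *)
have main (t : seq 'I_n) (r' : seq 'I_n) : ~ good (theta \o wperm t) r' ->
    exists r1 i r2, r' = r1 ++ i :: r2 /\
      (wperm (rev r1 ++ t) (nxt i) < wperm (rev r1 ++ t) (pos i))%N.
  elim: r' t => [|i r' IH] t /=; first by case.
  move=> /not_andP[h|h].
    exists [::], i, r'; split=> //=; rewrite ltnNge; apply/negP => le.
    apply: h; apply: inc; rewrite ltn_neqAle le andbT; apply/eqP.
    by move=> /val_inj/perm_inj/eqP; rewrite (negPf (pos_neq_nxt i)).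
  have [|r1 [j [r2 [-> lt]]]] := IH (i :: t).
    move=> g; apply: h; suff -> : (theta \o wperm t) \o sw i = theta \o wperm (i :: t).
      by [].
    by apply/funext => a /=; rewrite /wperm big_cons permM.
  by exists (i :: r1), j, r2; split=> //; rewrite rev_cons cat_rcons.
move=> ng; have [|r1 [i [r2 [er lt]]]] := main [::] r.
  by move=> g; apply: ng; move: g; congr good; apply/funext => a /=;
     rewrite /wperm big_nil perm1.
rewrite cats0 in lt.
(* Follow the root of i through t up to the letter j that makes it negative: just before, it is the
   simple root of j, so the prefix t1 intertwines the two reflections. *)
have flip (t : seq 'I_n) : (wperm t (nxt i) < wperm t (pos i))%N ->
    exists t1 j t2, t = t1 ++ j :: t2 /\ (sw i * wperm t1 = wperm t1 * sw j)%g.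
  elim/last_ind: t => [|t j IH].
    by rewrite /wperm big_nil !perm1; have := pos_lt_nxt i; lia.
  have w1 : wperm [:: j] = sw j by rewrite /wperm big_seq1.
  rewrite -cats1 wperm_cat w1 !permM => lt'.
  have [/IH[t1 [j' [t2 [-> e]]]]|le] := ltnP (wperm t (nxt i)) (wperm t (pos i)).
    by exists t1, j', (t2 ++ [:: j]); split=> //; rewrite -catA.
  exists t, j, [::]; split=> //.
  have lt2 : (wperm t (pos i) < wperm t (nxt i))%N.
    rewrite ltn_neqAle le andbT; apply/eqP.
    by move=> /val_inj/perm_inj/eqP; rewrite (negPf (pos_neq_nxt i)).
  have cr := @wperm_rev n t; set w := wperm t in lt' lt2 cr *.
  have wE : [/\ w (pos i) = pos j, w (nxt i) = nxt j,
       w (rev_ord (pos i)) = rev_ord (pos j) &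
       w (rev_ord (nxt i)) = rev_ord (nxt j)] \/
     [/\ w (pos i) = rev_ord (nxt j), w (nxt i) = rev_ord (pos j),
       w (rev_ord (pos i)) = nxt j & w (rev_ord (nxt i)) = pos j].
    by have [[e1 e2]|[e1 e2]] := sw_lt lt2 lt'; [left|right];
       rewrite !cr e1 e2 ?rev_ordK.
  apply/permP => a; rewrite !permM !swE /swf.
  have inj := inj_eq (@perm_inj _ w).
  rewrite -(inj a (pos i)) -(inj a (nxt i)) -(inj a (rev_ord (pos i))).
  rewrite -(inj a (rev_ord (nxt i))) !(fun_if w).
  case: wE => -[-> -> -> ->] //; move: (w a) => b.
  apply: val_inj; rewrite !(fun_if val) -!val_eqE /= !nxtE.
  by have := ltn_ord j; have := ltn_ord b; do 8?[case: eqP => ?]; rewrite ?nxtE; lia.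
have [t1 [j [t2 [et eP]]]] := flip _ lt.
exists (rev r2 ++ t1 ++ t2).
  have er' : rev r = rev r2 ++ i :: t1 ++ j :: t2.
    by rewrite er rev_cat rev_cons cat_rcons et.
  split.
    rewrite er'; apply: cat_subseq => //.
    apply: subseq_trans (subseq_cons _ _); apply: cat_subseq => //.
    exact: subseq_cons.
  by rewrite -(size_rev r) er' !size_cat /= !size_cat /=; lia.
apply: weyl_word_eq.
rewrite er rev_cat rev_cons cat_rcons et !wperm_cat; congr (_ * _)%g.
have wc (k : 'I_n) s' : wperm (k :: s') = (sw k * wperm s')%g by rewrite /wperm big_cons.
rewrite !wc wperm_cat wc !mulgA eP -!mulgA; congr (_ * _)%g.
by rewrite mulgA -{1}(swV j) mulVg mul1g.
Qed.

End KeyDecomposition.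

(** * The groups H_m as lattices *)

Section HoweGroups.
Variables (F : padicFieldType) (n : nat) (varpi : F).
Hypothesis hvarpi : uniformizer varpi.
Local Notation M := 'M[F]_(n + n).
Local Notation I := 'I_(n + n).
Implicit Types (g h A u : M) (a b c : I) (m k : nat).

(** The exponents of d_m up to a constant, which conjugation does not see. *)
Definition th m a : int := (2 * m * a)%N%:Z.

Definition fHowe m : I -> I -> int := fH (th m) m%:Z.

Lemma th_sym m : rev_sym (th m).
Proof.
exists (2 * m * (n + n).-1)%N%:Z => a; rewrite /th -PoszD -mulnDr /=.
by congr ((_ * _)%N%:Z); have := ltn_ord a; lia.
Qed.

Lemma fHowe_mul m a c b : fHowe m a b <= fHowe m a c + fHowe m c b.
Proof. exact: fHM. Qed.

Lemma fHowe_rev m a b : fHowe m (rev_ord b) (rev_ord a) = fHowe m a b.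
Proof.
by rewrite /fHowe /fH; have [k hk] := th_sym m; have := hk a; have := hk b; lia.
Qed.

(** At distance d above the diagonal the exponent is -(2d - 1)m, so U_m grows with m, while below
    the diagonal (2d + 1)m makes H_m shrink. *)
Lemma fHowe_mono k m a b : (k <= m)%N -> (a <= b)%N -> a != b ->
  fHowe m a b <= fHowe k a b.
Proof. by rewrite -val_eqE /fHowe /fH /th /= => *; nia. Qed.

Let dexp m a : int := ((2 * a + 1)%N%:Z - (2 * n)%N%:Z) * m%:Z.

Lemma Tor_dmx m : Tor (dmx n varpi m).
Proof.
have [v0 _] := hvarpi.
have ud : upper_mx (dmx n varpi m).
  by move=> a b ba; rewrite mxE; case: eqP => // e; rewrite e ltnn in ba.
have ld : lower_mx (dmx n varpi m).
  by move=> a b ba; rewrite mxE; case: eqP => // e; rewrite e ltnn in ba.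
apply/torP; split=> //; apply/SpP/upper_lower1.
- by apply: upper_mul => //; apply: upper_adj.
- by apply: lower_mul => //; apply: lower_adj.
- move=> a; rewrite upper_mul_diag //; last exact: upper_adj.
  rewrite !mxE !eqxx eps_mul mul1r !mulr1n -expfzDr // -mulrDl.
  rewrite [X in X * _](_ : _ = 0) ?mul0r ?expr0z //=.
  by have := ltn_ord a; lia.
Qed.

Lemma invmx_dmxE m a b :
  invmx (dmx n varpi m) a b = varpi ^ (- dexp m a) *+ (a == b).
Proof.
rewrite Sp_invE; last exact: Tor_Sp (Tor_dmx m).
rewrite !mxE (inj_eq rev_ord_inj) eq_sym.
have [->|_] := eqVneq a b; last by rewrite !mulr0n mulr0.
rewrite eps_mul mul1r !mulr1n; congr (_ ^ _); rewrite /dexp -mulNr.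
by congr (_ * _); rewrite /=; have := ltn_ord b; lia.
Qed.

Lemma dmx_conjE m A a b : (dmx n varpi m *m A *m invmx (dmx n varpi m)) a b =
  varpi ^ (dexp m a - dexp m b) * A a b.
Proof.
have [v0 _] := hvarpi.
have -> : invmx (dmx n varpi m) = diag_mx (\row_c varpi ^ (- dexp m c)).
  apply/matrixP => c d; rewrite invmx_dmxE !mxE.
  by have [->|] := eqVneq c d.
rewrite mul_mx_diag mxE mul_diag_mx !mxE expfzDr // mulrAC; congr (_ * _ * _).
Qed.

Lemma dmx_conjVE m A a b : (invmx (dmx n varpi m) *m A *m dmx n varpi m) a b =
  varpi ^ (dexp m b - dexp m a) * A a b.
Proof.
have [v0 _] := hvarpi.
have ud := Sp_unit (Tor_Sp (Tor_dmx m)).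
have := dmx_conjE m (invmx (dmx n varpi m) *m A *m dmx n varpi m) a b.
rewrite !mulmxA mulmxV // mul1mx -mulmxA mulmxV // mulmx1 => ->.
by rewrite mulrA -expfzDr // addrA subrK subrr expr0z mul1r.
Qed.

Lemma HgrpP m h : Hgrp varpi m h <-> Sp h /\ latt (fHowe m) (h - 1%:M).
Proof.
have st := Tor_Sp (Tor_dmx m); have ut := Sp_unit st.
have dE a b : fHowe m a b = (dexp m a - dexp m b) + m%:Z.
  by rewrite /fHowe /fH /th /dexp; lia.
split=> [[k [sk hk] <-]|[sh hh]].
  split; first exact: Sp_mul (Sp_mul st sk) (Sp_inv st).
  move=> a b; rewrite conj_sub1 // dmx_conjE dE.
  by apply: pidealM => //; apply: pideal_expz.
exists (invmx (dmx n varpi m) *m h *m dmx n varpi m); last first.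
  by rewrite !mulmxA mulmxV // mul1mx -mulmxA mulmxV // mulmx1.
split; first exact: Sp_mul (Sp_mul (Sp_inv st) sh) st.
move=> a b; rewrite -{2}[dmx n varpi m]invmxK conj_sub1 ?unitmx_inv // invmxK.
rewrite dmx_conjVE.
have -> : m%:Z = (dexp m b - dexp m a) + fHowe m a b by rewrite dE; lia.
by apply: pidealM (hh a b); apply: pideal_expz.
Qed.

Lemma UmE m : Um varpi m = [set u : M | latt (fHowe m) (u - 1%:M)] `&` @Uni F n.
Proof.
apply/seteqP; split=> u [h1 h2]; split=> //.
  by have /HgrpP[] := h2.
by apply/HgrpP; split=> //; apply: Uni_Sp.
Qed.

Lemma superdiagE g : superdiag g = \sum_(i < n) g (pos i) (nxt i).
Proof. by []. Qed.

(** Adjacent exponents of d_m differ by 2m, which cancels the factor varpi^(-2m) in [tau]. *)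
Lemma psiH_psiU (R : realType) (psi : F -> R[i]) m h :
  psiH varpi psi m h = psiU psi h.
Proof.
have [v0 _] := hvarpi.
rewrite /psiH /tau /psiU !superdiagE mulr_sumr; congr psi.
apply: eq_bigr => i _; rewrite dmx_conjVE mulrA -expfzDr //.
rewrite [X in varpi ^ X](_ : _ = 0) ?expr0z ?mul1r // /dexp nxt_val /=; lia.
Qed.

End HoweGroups.

(** * Open sets of matrices and closedness of U *)

Section Topology.
Variables (F : padicFieldType) (n : nat).
Local Notation M := 'M[F]_(n + n).
Local Notation I := 'I_(n + n).
Implicit Types (g h A u : M) (a b c : I) (f : I -> I -> int).

Lemma nbhs_pideal (x : F) (k : int) : nbhs x [set y : F | pideal k (y - x)].
Proof.
rewrite -nbhs_entourageE; exists [set xy | pideal k (xy.1 - xy.2)].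
  by apply/padic_entourageE; exists k.
move=> y /xsectionP /= h; rewrite -opprB; exact: pidealN.
Qed.

Lemma mx_open (S : set M) :
  (forall g, S g -> exists k : int, forall h,
     latt (fun _ _ => k) (h - g) -> S h) -> open S.
Proof.
move=> hS; rewrite openE => g /hS[k hk].
exists (fun a b => [set y : F | pideal k (y - g a b)]) => [a b|h hh].
  exact: nbhs_pideal.
by apply: hk => a b; rewrite !mxE; apply: hh.
Qed.

Lemma latt_bounded A : exists2 c : int, c <= 0 & latt (fun _ _ => c) A.
Proof.
have s0 a : 0 <= \sum_b `|pval (A a b)| :> int by apply: sumr_ge0.
exists (- \sum_a \sum_b `|pval (A a b)|) => [|a b].
  by rewrite oppr_le0 sumr_ge0.
right; apply: le_trans (_ : - `|pval (A a b)| <= _); last by lia.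
rewrite lerN2 (bigD1 a) //= (bigD1 b) //= -addrA lerDl.
by apply: addr_ge0; apply: sumr_ge0.
Qed.

Lemma neq0_stable (x : F) : x != 0 ->
  exists k : int, forall y, pideal k (y - x) -> y != 0.
Proof.
move=> x0; exists (pval x + 1) => y h; apply/eqP => y0; move: h.
rewrite y0 sub0r => /pidealN; rewrite opprK => -[e|]; last by lia.
by rewrite e eqxx in x0.
Qed.

Lemma latt_mulc (k l : int) A B : latt (fun _ _ => k) A ->
  latt (fun _ _ => l) B -> latt (fun _ _ => k + l) (A *m B).
Proof. by apply: latt_mul => *; apply: lexx. Qed.

Lemma Uni_closed : open (~` @Uni F n : set M).
Proof.
have entry (P : M -> F) : (forall g (k : int), exists l : int, forall h,
      latt (fun _ _ => l) (h - g) -> pideal k (P h - P g)) ->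
    open [set g | P g != 0].
  move=> hP; apply: mx_open => g /neq0_stable[k hk].
  by have [l hl] := hP g k; exists l => h /hl /hk.
pose E a b : set M := [set g |
  (g^T *m symp_form F n *m g - symp_form F n) a b != 0].
pose D a b : set M := [set g | (g - 1%:M) a b != 0].
have oE a b : open (E a b).
  apply: entry => g k.
  have [c c0 hg] := latt_bounded g.
  have hJ : latt (fun _ _ => 0) (symp_form F n).
    move=> a' b'; rewrite symp_formE; apply: is_sign_pideal.
      exact: is_sign_eps.
    by case: eqP => _; [apply: pideal1|apply: pideal0].
  have ht (A : M) l : latt (fun _ _ => l) A -> latt (fun _ _ => l) A^T.
    by move=> hA a' b'; rewrite mxE; apply: hA.
  (* The bound is nonnegative, so h is bounded by c like g; subtracting c pays for the factor g or h
     left beside h - g. *)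
  exists (`|k| - c) => h hh.
  have -> : (h^T *m symp_form F n *m h - symp_form F n) a b -
     (g^T *m symp_form F n *m g - symp_form F n) a b =
     ((h - g)^T *m symp_form F n *m h + g^T *m symp_form F n *m (h - g)) a b.
    rewrite linearB /= mulmxBr 2!mulmxBl !mxE; ring.
  have hh' : latt (fun _ _ => c) h.
    rewrite -[h](subrK g); apply: lattD hg.
    by move=> a' b'; apply: pideal_le (hh a' b'); lia.
  rewrite mxE; apply: pidealD.
    apply: pideal_le (latt_mulc (latt_mulc (ht _ _ hh) hJ) hh' a b); lia.
  apply: pideal_le (latt_mulc (latt_mulc (ht _ _ hg) hJ) hh a b); lia.
have oD a b : open (D a b).
  apply: entry => g k; exists k => h hh.
  by have := hh a b; rewrite !mxE opprB addrA subrK.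
have -> : ~` @Uni F n = (\bigcup_(ab in [set: I * I]) E ab.1 ab.2) `|`
    (\bigcup_(ab in [set ab : I * I | (ab.2 <= ab.1)%N]) D ab.1 ab.2).
  apply/seteqP; split=> g /=.
    apply: contra_notP => /not_orP[h1 h2]; apply/UniP; split.
    - rewrite /Sp /=; apply/eqP; rewrite -subr_eq0; apply/eqP/matrixP => a b.
      rewrite [RHS]mxE; apply/eqP/negPn/negP => n0; apply: h1.
      by exists (a, b).
    - move=> a; apply/eqP/negPn/negP => n0; apply: h2; exists (a, a) => //=.
      by rewrite /D /= !mxE eqxx subr_eq0.
    - move=> a b ba; apply/eqP/negPn/negP => n0; apply: h2.
      exists (a, b) => /=; first exact: ltnW.
      rewrite /D /= !mxE; have -> : (a == b) = false.
        by apply/eqP => e; rewrite e ltnn in ba.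
      by rewrite subr0.
  move=> h /UniP[sg dg ug]; case: h => -[[a b] /= hab].
    by rewrite /E /= sg subrr mxE eqxx.
  rewrite /D /= !mxE; have [->|ab] := eqVneq a b; first by rewrite dg subrr eqxx.
  by rewrite ug ?subrr ?eqxx // ltn_neqAle hab andbT eq_sym val_eqE.
apply: openU; apply: bigcup_open => ab _; [exact: oE|exact: oD].
Qed.

Lemma open_coset_latt f g : Uni g ->
  open [set h : M | latt f (invmx g *m h - 1%:M)].
Proof.
move=> hg; apply: mx_open => h hh.
have [c c0 hc] := latt_bounded (invmx g).
(* The sum dominates every exponent of f, and c compensates the denominators of g^-1. *)
exists ((\sum_a \sum_b `|f a b|) - c) => h' hh' /=.
have -> : invmx g *m h' - 1%:M = (invmx g *m h - 1%:M) + invmx g *m (h' - h).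
  by rewrite mulmxBr [RHS]addrC addrA subrK.
apply: lattD hh _; apply: latt_mul hc hh' => a _ b.
rewrite addrC subrK (bigD1 a) //= (bigD1 b) //= -addrA.
apply: le_trans (ler_norm _) _; rewrite lerDl.
by apply: addr_ge0; apply: sumr_ge0 => // ? _; apply: sumr_ge0.
Qed.

End Topology.

(** * Lattice subgroups of U and coset representatives *)

Section LatticeSubgroups.
Variables (F : padicFieldType) (n : nat).
Local Notation M := 'M[F]_(n + n).
Local Notation I := 'I_(n + n).
Implicit Types (g h x y u : M) (a b c : I) (f : I -> I -> int).

Definition LG f : set M := [set u | latt f (u - 1%:M)] `&` @Uni F n.

(** The first condition gives products. The symmetry gives inverses, because the inverse is
    [sp_adj], which permutes entries through [rev_ord] up to sign. *)
Definition group_bound f := (forall a c b, f a b <= f a c + f c b) /\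
  (forall a b, f (rev_ord b) (rev_ord a) = f a b).

Lemma latt_inv (f : I -> I -> int) g : group_bound f -> Sp g ->
  latt f (g - 1%:M) -> latt f (invmx g - 1%:M).
Proof.
move=> [_ fr] sg hg a b; rewrite Sp_invE //.
have -> : sp_adj g - 1%:M = sp_adj (g - 1%:M).
  by rewrite -{1}sp_adj1; apply/matrixP => c d; rewrite !mxE mulrBr.
rewrite mxE -fr; apply: is_sign_pideal; last exact: hg.
by apply: is_sign_mul; apply: is_sign_eps.
Qed.

Lemma LG1 f : LG f 1%:M.
Proof.
split; last exact: Uni1.
by move=> a b; rewrite subrr mxE; apply: pideal0.
Qed.

Lemma LG_mul f g h : group_bound f -> LG f g -> LG f h -> LG f (g *m h).
Proof.
move=> [fm _] [g1 g2] [h1 h2]; split; last exact: Uni_mul.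
exact: latt_sub1_mul.
Qed.

Lemma LG_inv f g : group_bound f -> LG f g -> LG f (invmx g).
Proof.
move=> gf [g1 g2]; split; last exact: Uni_inv.
exact: latt_inv gf (Uni_Sp g2) g1.
Qed.

Lemma LG_unit f g : LG f g -> g \in unitmx.
Proof. by move=> [_ /Uni_Sp/Sp_unit]. Qed.

Definition transversal (G H : set M) (r : seq M) := [/\ uniq r,
  forall x, x \in r -> G x,
  forall x y, x \in r -> y \in r -> H (invmx x *m y) -> x = y &
  forall g, G g -> exists2 x, x \in r & H (invmx x *m g)].

Lemma transversal_mull f0 f r u : group_bound f -> LG f u ->
  transversal (LG f) (LG f0) r -> transversal (LG f) (LG f0) [seq u *m x | x <- r].
Proof.
move=> hf hu [r1 r2 r3 r4]; have uu := LG_unit hu.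
have uK x y : x \in r -> invmx (u *m x) *m (u *m y) = invmx x *m y.
  move=> /r2 hx; have ux := LG_unit hx.
  by rewrite invmx_mul // !mulmxA -[_ *m invmx u *m u]mulmxA mulVmx // mulmx1.
split.
- rewrite map_inj_in_uniq // => x y xr yr /(congr1 (mulmx (invmx u))).
  by rewrite !mulKmx.
- by move=> _ /mapP[x xr ->]; apply: LG_mul => //; apply: r2.
- move=> _ _ /mapP[x xr ->] /mapP[y yr ->]; rewrite uK // => h.
  by rewrite (r3 _ _ xr yr h).
- move=> g hg; have [|x xr hx] := r4 (invmx u *m g).
    by apply: LG_mul => //; apply: LG_inv.
  exists (u *m x); first exact: map_f.
  by rewrite -[g](mulKVmx uu) uK.
Qed.

Lemma transversal_comp f0 f1 f2 r s :
  group_bound f0 -> group_bound f1 -> group_bound f2 ->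
  LG f0 `<=` LG f1 -> LG f1 `<=` LG f2 ->
  transversal (LG f2) (LG f1) r -> transversal (LG f1) (LG f0) s ->
  transversal (LG f2) (LG f0) [seq x *m y | x <- r, y <- s].
Proof.
move=> g0 g1 g2 s01 s12 [r1 r2 r3 r4] [s1 s2 s3 s4].
have key x y x' y' : x \in r -> x' \in r -> y \in s -> y' \in s ->
    LG f0 (invmx (x *m y) *m (x' *m y')) -> x = x' /\ y = y'.
  move=> xr xr' ys ys' h.
  have [ux uy] := (LG_unit (r2 _ xr), LG_unit (s2 _ ys)).
  rewrite invmx_mul // in h.
  have ex : x = x'.
    apply: r3 => //.
    have -> : invmx x *m x' = y *m (invmx y *m invmx x *m (x' *m y')) *m invmx y'.
      have uy' := LG_unit (s2 _ ys').
      by rewrite !mulmxA mulmxV // mul1mx -mulmxA mulmxV // mulmx1.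
    apply: LG_mul (LG_inv g1 (s2 _ ys')) => //.
    by apply: LG_mul (s01 _ h) => //; apply: s2.
  split=> //; apply: s3 => //; move: h; rewrite -ex !mulmxA.
  by rewrite -[_ *m invmx x *m x]mulmxA mulVmx // mulmx1.
split.
- rewrite allpairs_uniq // => -[x y] [x' y'] /=.
  move=> /allpairsP[[? ?] /= [xr ys [-> ->]]] /allpairsP[[? ?] /= [xr' ys' [-> ->]]].
  move=> e; have [] := key _ _ _ _ xr xr' ys ys'; last by move=> -> ->.
  rewrite e mulVmx; first exact: LG1.
  by rewrite unitmx_mul (LG_unit (r2 _ xr')) (LG_unit (s2 _ ys')).
- move=> _ /allpairsP[[x y] /= [xr ys ->]]; apply: LG_mul => //; first exact: r2.
  by apply/s12/s2.
- move=> _ _ /allpairsP[[x y] /= [xr ys ->]] /allpairsP[[x' y'] /= [xr' ys' ->]].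
  by move=> h; have [-> ->] := key _ _ _ _ xr xr' ys ys' h.
- move=> g /r4[x xr /s4[y ys hy]]; exists (x *m y).
    by apply/allpairsP; exists (x, y).
  have [ux uy] := (LG_unit (r2 _ xr), LG_unit (s2 _ ys)).
  by rewrite invmx_mul // -mulmxA.
Qed.

End LatticeSubgroups.

(** * Haar measure and finite coset sums *)

Section Measure.
Variables (R : realType) (F : padicFieldType) (n : nat).
Local Notation M := 'M[F]_(n + n).
Local Notation I := 'I_(n + n).
Variable mu : {measure set (borel_mx F n) -> \bar R}.
Hypothesis hmu : haar_measure (@Uni F n) mu.
Implicit Types (g h x y u : M) (a b c : I) (f : I -> I -> int).

Lemma measurable_open (O : set M) : open O -> measurable (O : set (borel_mx F n)).
Proof. by move=> oO; apply: sub_sigma_algebra. Qed.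

Lemma measurable_Uni : measurable (@Uni F n : set (borel_mx F n)).
Proof.
rewrite -[X in measurable X]setCK; apply: measurableC.
by apply: measurable_open; apply: Uni_closed.
Qed.

Lemma coset_LG f g : Uni g -> [set h | LG f (invmx g *m h)] =
  [set h : M | latt f (invmx g *m h - 1%:M)] `&` @Uni F n.
Proof.
move=> hg; apply/seteqP; split=> h [h1 h2]; split=> //.
  rewrite -[h](mulKVmx (Sp_unit (Uni_Sp hg))); exact: Uni_mul.
by apply: Uni_mul h2; apply: Uni_inv.
Qed.

Lemma measurable_coset f g : Uni g ->
  measurable ([set h | LG f (invmx g *m h)] : set (borel_mx F n)).
Proof.
move=> hg; rewrite coset_LG //; apply: measurableI; last exact: measurable_Uni.
by apply: measurable_open; apply: open_coset_latt.
Qed.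

Lemma measurable_LG f : measurable (LG f : set (borel_mx F n)).
Proof.
have := @measurable_coset f _ (@Uni1 F n); rewrite invmx1.
by under eq_set do rewrite mul1mx.
Qed.

Lemma mu_coset f g : Uni g -> mu [set h | LG f (invmx g *m h)] = mu (LG f).
Proof.
move=> hg; rewrite -(haar_invariant hmu hg (measurable_LG f)); congr (mu _).
have ug := Sp_unit (Uni_Sp hg).
apply/seteqP; split=> h /=; last by move=> [x hx <-]; rewrite mulKmx.
by move=> hh; exists (invmx g *m h) => //; rewrite mulKVmx.
Qed.

Lemma mu_LG_gt0 f : (0 < mu (LG f))%E.
Proof.
apply: (haar_open hmu); last by exists 1%:M; apply: LG1.
have := @open_coset_latt F n f _ (@Uni1 F n); rewrite invmx1.
by under eq_set do rewrite mul1mx.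
Qed.

(** P will select the cosets on which an integrand takes a given value, so the measure of a fibre
    becomes a count. *)
Lemma mu_cosets f (P : pred M) r : group_bound f -> uniq r ->
  (forall x, x \in r -> Uni x) ->
  (forall x y, x \in r -> y \in r -> LG f (invmx x *m y) -> x = y) ->
  measurable ([set h | exists2 x, x \in r & P x /\ LG f (invmx x *m h)]
    : set (borel_mx F n)) /\
  mu [set h | exists2 x, x \in r & P x /\ LG f (invmx x *m h)] =
    ((count P r)%:R%:E * mu (LG f))%E.
Proof.
move=> hf; elim: r => [|x r IH] /=.
  move=> _ _ _; rewrite [X in mu X](_ : _ = set0); last first.
    by apply/seteqP; split=> // h [].
  rewrite [X in measurable X](_ : _ = set0); last first.
    by apply/seteqP; split=> // h [].
  by rewrite measure0 mul0e; split.
move=> /andP[xr ur] hr hinj.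
have hx : Uni x by apply: hr; rewrite mem_head.
have [||mS eS] := IH ur.
  by move=> y yr; apply: hr; rewrite in_cons yr orbT.
  by move=> y z yr zr; apply: hinj; rewrite in_cons ?yr ?zr orbT.
set S := [set h | exists2 y, y \in r & _] in mS eS.
have [Px|nPx] := boolP (P x); last first.
  suff -> : [set h | exists2 y, y \in x :: r & P y /\ LG f (invmx y *m h)] = S.
    by rewrite add0n.
  apply/seteqP; split=> h [y + [Py hy]]; last first.
    by move=> yr; exists y; rewrite ?in_cons ?yr ?orbT.
  rewrite in_cons => /orP[/eqP e|yr]; first by rewrite -e Py in nPx.
  by exists y.
have -> : [set h | exists2 y, y \in x :: r & P y /\ LG f (invmx y *m h)] =
    [set h | LG f (invmx x *m h)] `|` S.
  apply/seteqP; split=> h.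
    move=> [y + [Py hy]]; rewrite in_cons => /orP[/eqP e|yr].
      by left; rewrite /= -e.
    by right; exists y.
  move=> [hh|[y yr hh]]; first by exists x; rewrite ?mem_head.
  by exists y; rewrite ?in_cons ?yr ?orbT.
have mx := measurable_coset f hx.
split; first exact: measurableU.
have disj : [set h | LG f (invmx x *m h)] `&` S = set0.
  apply/seteqP; split=> // h [/= h1 [y yr [_ h2]]].
  suff e : x = y by rewrite e yr in xr.
  apply: hinj; rewrite ?in_cons ?eqxx ?yr ?orbT //.
  have uh : h \in unitmx.
    have := LG_unit h1; rewrite unitmx_mul => /andP[//].
  have uy : y \in unitmx.
    by apply/Sp_unit/Uni_Sp/hr; rewrite in_cons yr orbT.
  have -> : invmx x *m y = (invmx x *m h) *m invmx (invmx y *m h).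
    rewrite invmx_mul ?unitmx_inv // invmxK.
    by rewrite mulmxA -[_ *m h *m _]mulmxA mulmxV // mulmx1.
  by apply: LG_mul h1 (LG_inv hf h2).
have -> : mu ([set h | LG f (invmx x *m h)] `|` S) =
    (mu [set h | LG f (invmx x *m h)] + mu S)%E by apply: measureU.
by rewrite eS mu_coset // natrD EFinD ge0_muleDl ?lee_fin ?ler0n // mul1e.
Qed.

(** Distinct cosets are disjoint with the same positive measure, so a family of inequivalent
    elements has at most mu(LG f) / mu(LG f0) members; a family of maximal size meets every
    coset. *)
Lemma transversal_exists f0 f : group_bound f0 -> group_bound f ->
  (LG f0 : set M) `<=` LG f -> (mu (LG f) < +oo)%E ->
  exists r : seq M, transversal (LG f) (LG f0) r.
Proof.
move=> g0 g1 sub fin.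
have le0 : (mu (LG f0) <= mu (LG f))%E.
  by apply: le_measure => //; rewrite inE; apply: measurable_LG.
have f0fin : mu (LG f0) \is a fin_num.
  by rewrite ge0_fin_numE //; apply: le_lt_trans fin.
have ffin : mu (LG f) \is a fin_num by rewrite ge0_fin_numE.
have m0 : 0 < fine (mu (LG f0)).
  by rewrite -lte_fin fineK //; apply: mu_LG_gt0.
pose Q q := exists r : seq M, [/\ size r = q, uniq r,
  forall x, x \in r -> LG f x &
  forall x y, x \in r -> y \in r -> LG f0 (invmx x *m y) -> x = y].
have bound q : `[<Q q>] -> (q <= Num.trunc (fine (mu (LG f)) / fine (mu (LG f0))))%N.
  move=> /asboolP[r [sr ur rG rinj]].
  have [|mS eS] := @mu_cosets f0 predT r g0 ur _ rinj.
    by move=> x /rG[].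
  have : (mu [set h | exists2 x, x \in r & predT x /\ LG f0 (invmx x *m h)] <=
      mu (LG f))%E.
    apply: le_measure; rewrite ?inE //; first exact: measurable_LG.
    move=> h [x xr [_ hx]]; have hG := rG x xr.
    by rewrite -[h](mulKVmx (LG_unit hG)); apply: LG_mul => //; apply: sub.
  rewrite eS count_predT sr -(fineK f0fin) -(fineK ffin) -EFinM lee_fin => le.
  have d0 : 0 <= fine (mu (LG f)) / fine (mu (LG f0)).
    by rewrite divr_ge0 ?fine_ge0.
  by rewrite truncn_ge_nat // ler_pdivlMr.
have ex : exists q, `[<Q q>].
  by exists 0%N; apply/asboolP; exists [::]; split.
case: (ex_maxnP ex bound) => q /asboolP[r [sr ur rG rinj]] qmax.
exists r; split=> // g hg; apply: contrapT => nc.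
have gr x : x \in r -> ~ LG f0 (invmx x *m g).
  by move=> xr h; apply: nc; exists x.
suff : (q.+1 <= q)%N by rewrite ltnn.
apply: qmax; apply/asboolP; exists (g :: r); split.
- by rewrite /= sr.
- rewrite /= ur andbT; apply/negP => /gr; apply.
  by rewrite mulVmx; [apply: LG1|apply: LG_unit hg].
- by move=> x; rewrite in_cons => /orP[/eqP->//|]; apply: rG.
- move=> x y; rewrite !in_cons => /orP[/eqP->|xr] /orP[/eqP->|yr] //.
  + move=> h; exfalso; apply: (gr y yr); have := LG_inv g0 h.
    have ug := LG_unit hg; have uy := LG_unit (rG _ yr).
    by rewrite invmx_mul ?unitmx_inv // invmxK.
  + by move=> h; case: (gr x xr).
  + exact: rinj.
Qed.

(** Constancy on left cosets of [LG f0] makes each fibre of G a union of cosets of one common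
    measure, which cancels against the normalization. *)
Lemma vintegral_transversal (V : lmodType R[i]) f0 f (r : seq M) (G : M -> V) :
  group_bound f0 -> group_bound f -> (LG f0 : set M) `<=` LG f ->
  transversal (LG f) (LG f0) r -> (mu (LG f) < +oo)%E ->
  (forall x y, LG f x -> LG f0 y -> G (x *m y) = G x) ->
  ((fine (mu (LG f)))^-1)%:C%C *: vintegral mu (LG f) G =
  ((size r)%:R^-1 : R[i]) *: \sum_(x <- r) G x.
Proof.
move=> g0 g1 sub [ur rG rinj rcov] fin hG.
have rU x : x \in r -> Uni x by move=> /rG[].
have le0 : (mu (LG f0) <= mu (LG f))%E.
  by apply: le_measure => //; rewrite inE; apply: measurable_LG.
have f0fin : mu (LG f0) \is a fin_num.
  by rewrite ge0_fin_numE //; apply: le_lt_trans fin.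
have m0 : 0 < fine (mu (LG f0)).
  by rewrite -lte_fin fineK //; apply: mu_LG_gt0.
set m := fine (mu (LG f0)) in m0.
have Gx x g : x \in r -> LG f0 (invmx x *m g) -> G g = G x.
  move=> xr h; rewrite -[g](mulKVmx (LG_unit (rG _ xr))).
  by apply: hG => //; apply: rG.
have fib (P : pred M) (S : set M) :
    S = [set h | exists2 x, x \in r & P x /\ LG f0 (invmx x *m h)] ->
    fine (mu S) = (count P r)%:R * m.
  move=> ->; have [_ ->] := mu_cosets P g0 ur rU rinj.
  by rewrite -{1}(fineK f0fin) -EFinM.
have muG : fine (mu (LG f)) = (size r)%:R * m.
  rewrite -(count_predT r); apply: fib; apply/seteqP; split=> g.
    by move=> /rcov[x xr hx]; exists x.
  move=> [x xr [_ hx]]; rewrite -[g](mulKVmx (LG_unit (rG _ xr))).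
  by apply: LG_mul (sub _ hx) => //; apply: rG.
have sumE : vintegral mu (LG f) G = m%:C%C *: \sum_(x <- r) G x.
  rewrite /vintegral.
  (* Each distinct value is weighted by the number of representatives attaining it; counting
     multiplicities turns the sum over values into one over representatives. *)
  have -> : G @` LG f = [set` undup (map G r)].
    apply/seteqP; split=> v /=.
      move=> [g /rcov[x xr hx] <-]; rewrite mem_undup.
      by apply/mapP; exists x => //; apply: Gx.
    by rewrite mem_undup => /mapP[x xr ->]; exists x => //; apply: rG.
  rewrite -fsbig_seq ?undup_uniq // scaler_sumr.
  rewrite -(big_map G xpredT (fun v => m%:C%C *: v)).
  rewrite -[RHS]big_undup_iterop_count; apply: eq_bigr => v _.
  rewrite (fib (fun x => G x == v)); last first.
    apply/seteqP; split=> g /=.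
      move=> [/rcov[x xr hx] e]; exists x => //; split=> //.
      by rewrite -e; apply/eqP/esym/Gx.
    move=> [x xr [/eqP e hx]]; split; last by rewrite /= (Gx x).
    rewrite -[g](mulKVmx (LG_unit (rG _ xr))).
    by apply: LG_mul (sub _ hx) => //; apply: rG.
  rewrite count_map Monoid.iteropE /=.
  have -> : iter (count (preim G (pred1 v)) r) (+%R (m%:C%C *: v)) 0 =
     (m%:C%C *: v) *+ count (preim G (pred1 v)) r.
    by elim: (count _ _) => [|k IH]; rewrite ?mulr0n // iterS IH mulrS.
  by rewrite -scaler_nat scalerA rmorphM rmorph_nat.
rewrite sumE scalerA muG; congr (_ *: _).
by rewrite -rmorphM invfM mulfVK ?gt_eqF // fmorphV rmorph_nat.
Qed.

End Measure.

(** * Howe vectors and their transformation laws *)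

Section HoweVectors.
Variables (R : realType) (F : padicFieldType) (n : nat) (varpi : F).
Hypothesis hvarpi : uniformizer varpi.
Variable psi : F -> R[i].
Hypothesis hpsi : additive_character_of_conductor_O psi.
Variable mu : {measure set (borel_mx F n) -> \bar R}.
Hypothesis hmu : haar_measure (@Uni F n) mu.
Local Notation M := 'M[F]_(n + n).
Local Notation I := 'I_(n + n).
Implicit Types (g h x y z u l : M) (a b c : I) (m k C : nat).

Local Notation Umg m := (LG (fHowe (n := n) m) : set M).
(** The exponents of K_C. The group [U0 C] is U cap K_C: it fixes v and psi_U is trivial on it, so
    the integrand of a Howe vector is constant on its left cosets. *)
Definition fC C : I -> I -> int := fun _ _ => C%:Z.
Local Notation U0 C := (LG (fC C) : set M).

Lemma fHowe_group m : group_bound (fHowe (n := n) m).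
Proof. by split; [apply: fHowe_mul|apply: fHowe_rev]. Qed.

Lemma fC_group C : group_bound (fC C).
Proof. by split=> // *; rewrite /fC; lia. Qed.

Lemma LG_sub (f f' : I -> I -> int) :
  (forall a b, (a < b)%N -> f' a b <= f a b) -> (LG f : set M) `<=` LG f'.
Proof.
move=> hf u [h1 h2]; split=> // a b; have /UniP[_ du uu] := h2.
have [lt|le] := ltnP a b; first by apply: pideal_le (h1 a b); apply: hf.
rewrite !mxE; have [->|ab] := eqVneq a b; first by rewrite du subrr; apply: pideal0.
rewrite uu ?subrr; first exact: pideal0.
by rewrite ltn_neqAle le andbT eq_sym val_eqE.
Qed.

Lemma U0_sub C m : U0 C `<=` Umg m.
Proof. by apply: LG_sub => a b ab; rewrite /fHowe /fH /th /fC; nia. Qed.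

Lemma Umg_sub k m : (k <= m)%N -> Umg k `<=` Umg m.
Proof.
move=> km; apply: LG_sub => a b ab; apply: fHowe_mono => //; first exact: ltnW.
by rewrite -val_eqE neq_ltn ab.
Qed.

Lemma psi_congr (x y : F) : pideal 0 (x - y) -> psi x = psi y.
Proof.
by move=> /(psi_trivial_O hpsi) h; rewrite -(subrK y x) (psiD hpsi) h mul1r.
Qed.

Lemma superdiag_uniM u v : Uni u -> Uni v ->
  superdiag (u *m v) = superdiag u + superdiag v.
Proof.
move=> hu hv; rewrite !superdiagE -big_split; apply: eq_bigr => i _.
by rewrite uni_mul_adj // nxt_val.
Qed.

Lemma psiU_mul u v : Uni u -> Uni v -> psiU psi (u *m v) = psiU psi u * psiU psi v.
Proof. by move=> hu hv; rewrite /psiU superdiag_uniM // (psiD hpsi). Qed.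

Lemma psiU_neq0 u : psiU psi u != 0.
Proof. exact: (psi_neq0 hpsi). Qed.

Lemma superdiag_latt (k : int) g : (forall i, pideal k (g (pos i) (nxt i))) ->
  pideal k (superdiag g).
Proof. by move=> h; rewrite superdiagE; apply: pideal_sum => i _. Qed.

Lemma sub1_superdiag g i : (g - 1%:M) (pos i) (nxt i) = g (pos i) (nxt i).
Proof. by rewrite !mxE (negPf (pos_neq_nxt i)) subr0. Qed.

Lemma psiU_U0 C u : U0 C u -> psiU psi u = 1.
Proof.
move=> [h _]; apply: (psi_trivial_O hpsi); apply: superdiag_latt => i.
by rewrite -sub1_superdiag; apply: pideal_le (h _ _).
Qed.

(** Whatever the middle index, the cross terms at (i, i + 1) have exponent 2k - 2k = 0 and so lie in
    O. Hence psi_U restricts to a character of H_k. *)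
Lemma superdiag_HM k g h : latt (fHowe k) (g - 1%:M) ->
  latt (fHowe k) (h - 1%:M) ->
  pideal 0 (superdiag (g *m h) - (superdiag g + superdiag h)).
Proof.
move=> hg hh.
have -> : superdiag (g *m h) - (superdiag g + superdiag h) =
    superdiag ((g - 1%:M) *m (h - 1%:M)).
  rewrite !superdiagE -big_split -sumrB; apply: eq_bigr => i _ /=.
  rewrite mulmxBl mul1mx mulmxBr mulmx1 !mxE.
  by rewrite (negPf (pos_neq_nxt i)) subr0; ring.
apply: superdiag_latt => i; rewrite mxE; apply: pideal_sum => c _.
apply: pidealM_le (hg _ _) (hh _ _).
by rewrite /fHowe /fH /th nxt_val /=; lia.
Qed.

Lemma superdiag_lower g : lower_mx g -> superdiag g = 0.
Proof.
move=> lg; rewrite superdiagE big1 // => i _; apply: lg; exact: pos_lt_nxt.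
Qed.

Lemma KgrpP C g : Kgrp C g <-> Sp g /\ latt (fC C) (g - 1%:M).
Proof. by []. Qed.

Lemma Kgrp_mul C g h : Kgrp C g -> Kgrp C h -> Kgrp C (g *m h).
Proof.
move=> [sg hg] [sh hh]; apply/KgrpP; split; first exact: Sp_mul.
by apply: latt_sub1_mul hg hh; apply: (fC_group C).1.
Qed.

Lemma Kgrp_inv C g : Kgrp C g -> Kgrp C (invmx g).
Proof.
move=> [sg hg]; apply/KgrpP; split; first exact: Sp_inv.
exact: latt_inv (fC_group C) sg hg.
Qed.

Lemma U0P C u : U0 C u <-> Uni u /\ Kgrp C u.
Proof.
split=> [[h1 h2]|[h1 [_ h2]]]; split=> //.
by split=> //; apply: Uni_Sp.
Qed.

(** The torus part is included. Nonzero entries of l - 1 have exponent at least k, which places l in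
    K_C when C <= k. *)
Definition lowH k l := [/\ Sp l, lower_mx l & latt (fHowe k) (l - 1%:M)].

Lemma lowH_inv k l : lowH k l -> lowH k (invmx l).
Proof.
move=> [sl ll hl]; split; first exact: Sp_inv.
  by rewrite Sp_invE //; apply: lower_adj.
exact: latt_inv (fHowe_group k) sl hl.
Qed.

Lemma lowH_Kgrp C k l : (C <= k)%N -> lowH k l -> Kgrp C l.
Proof.
move=> Ck [sl ll hl]; apply/KgrpP; split=> // a b.
have [lt|le] := ltnP a b.
  rewrite !mxE ll //; have -> : (a == b) = false.
    by apply/eqP => e; rewrite e ltnn in lt.
  by rewrite subrr; apply: pideal0.
by apply: pideal_le (hl a b); rewrite /fHowe /fH /th /fC; nia.
Qed.

(* Iwahori factorization of H_k: psi_k only sees the upper unipotent factor. *)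
Lemma lowH_swap C k l x : (0 < C <= k)%N -> lowH k l -> Umg k x ->
  exists y z, [/\ Umg k y, Kgrp C z, l *m x = y *m z & psiU psi y = psiU psi x].
Proof.
move=> /andP[C0 Ck] [sl ll hl] [x1 x2].
have fm := @fHowe_mul n k.
have k1 a : 1 <= fHowe k a a by rewrite /fHowe /fH /th; lia.
have hlx : latt (fHowe k) (l *m x - 1%:M) by apply: latt_sub1_mul.
have slx : Sp (l *m x) by apply: Sp_mul sl (Uni_Sp x2).
have [u [t [l' [e [u1 u2] [t1 t2] [sl' ll' _ hl']]]]] := sp_udl fm k1 slx hlx.
have hz : lowH k (t *m l').
  split; first exact: Sp_mul (Tor_Sp t1) sl'.
    by apply: lower_mul => //; have /torP[] := t1.
  exact: latt_sub1_mul.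
exists u, (t *m l'); split.
- by [].
- exact: lowH_Kgrp Ck hz.
- by rewrite mulmxA.
- have [_ lz lz'] := hz.
  have h1 := superdiag_HM hl x1; rewrite (superdiag_lower ll) add0r in h1.
  have h2 := superdiag_HM u2 lz'.
  rewrite (superdiag_lower lz) addr0 mulmxA -e in h2.
  apply: psi_congr; have := pidealB h1 h2; congr (pideal _ _); ring.
Qed.

Section Rep.
Variables (V : lmodType R[i]) (rho : M -> {linear V -> V}).
Hypothesis hrho : representation rho.
Variables (v : V) (C : nat).
Hypotheses (hC : (0 < C)%N) (hfix : forall g, Kgrp C g -> rho g v = v).

Local Notation howe m := (howe_vector varpi psi rho mu m v).

Lemma howe_infinite m : mu (Umg m) = +oo%E -> howe m = 0.
Proof.
by rewrite /howe_vector UmE // => ->; rewrite /= invr0 scale0r.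
Qed.

Lemma howe_transversal m r : transversal (Umg m) (U0 C) r ->
  (mu (Umg m) < +oo)%E ->
  howe m = ((size r)%:R^-1 : R[i]) *: \sum_(x <- r) (psiU psi x)^-1 *: rho x v.
Proof.
move=> hr fin; rewrite /howe_vector UmE //.
rewrite (vintegral_transversal hmu (fC_group C) (fHowe_group m) (@U0_sub C m) hr fin).
  by congr (_ *: _); apply: eq_bigr => x _; rewrite psiH_psiU.
move=> x y [_ hx] hy; have [hy1 hy2] := (U0P C y).1 hy.
rewrite !psiH_psiU // psiU_mul // (psiU_U0 hy) mulr1.
by rewrite (repM hrho (Uni_Sp hx) (Uni_Sp hy1)) hfix.
Qed.

Lemma mu_dichotomy m :
  mu (Umg m) = +oo%E \/ (mu (Umg m) < +oo)%E.
Proof.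
by case: (eqVneq (mu (Umg m)) +oo%E) => [->|h]; [left|right; rewrite ltey].
Qed.

(** Left translation by u turns one transversal into another, and the normalized coset sum is the
    same for every transversal. *)
Lemma howe_equivariant m u : Umg m u -> rho u (howe m) = psiU psi u *: howe m.
Proof.
move=> hu; have [/howe_infinite ->|fin] := mu_dichotomy m.
  by rewrite linear0 scaler0.
have [r hr] := transversal_exists hmu (fC_group C) (fHowe_group m) (@U0_sub C m) fin.
have hr' := transversal_mull (fHowe_group m) hu hr.
rewrite {2}(howe_transversal hr' fin) (howe_transversal hr fin) size_map big_map.
rewrite linearZ /= scalerA mulrC -scalerA; congr (_ *: _).
rewrite linear_sum scaler_sumr big_seq [RHS]big_seq; apply: eq_bigr => x xr.
have hx : Umg m x by case: hr => _ + _ _; apply.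
rewrite linearZ /= psiU_mul; [|by case: hu|by case: hx].
rewrite scalerA invfM mulrA mulfV ?psiU_neq0 // mul1r.
by rewrite (repM hrho) //; apply: Uni_Sp; [case: hu|case: hx].
Qed.

(** For x in U_k, [lowH_swap] gives l x = y z with z fixing v and psi_U(y) = psi_U(x). The elements
    y form another transversal, so l only permutes the terms of the coset sum. *)
Lemma howe_lower k l : (C <= k)%N -> lowH k l -> rho l (howe k) = howe k.
Proof.
move=> Ck hl; have [/howe_infinite ->|fin] := mu_dichotomy k.
  by rewrite linear0.
have Ck' : (0 < C <= k)%N by rewrite hC.
have [r hr] := transversal_exists hmu (fC_group C) (fHowe_group k) (@U0_sub C k) fin.
have [r1 r2 r3 r4] := hr.
have sl : Sp l by case: hl.
have ul := Sp_unit sl.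
have /choice[phi hphi] : forall x, exists y, Umg k x ->
    exists z, [/\ Umg k y, Kgrp C z, l *m x = y *m z & psiU psi y = psiU psi x].
  move=> x; have [hx|nx] := pselect (Umg k x); last by exists x.
  by have [y [z h]] := lowH_swap Ck' hl hx; exists y => _; exists z.
have Kunit z : Kgrp C z -> z \in unitmx by move=> [/Sp_unit].
have Uunit x : Umg k x -> x \in unitmx by move=> [_ /Uni_Sp/Sp_unit].
have Uquo x y : Umg k x -> Umg k y -> Uni (invmx x *m y).
  by move=> [_ hx] [_ hy]; apply: Uni_mul hy; apply: Uni_inv.
have hr' : transversal (Umg k) (U0 C) (map phi r).
  have inj x y : x \in r -> y \in r -> U0 C (invmx (phi x) *m phi y) -> x = y.
    move=> xr yr /U0P[_ h].
    have [hx hy] := (r2 _ xr, r2 _ yr).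
    have [zx [px kx ex _]] := hphi _ hx; have [zy [py ky ey _]] := hphi _ hy.
    apply: r3 => //; apply/U0P; split; first exact: Uquo.
    have -> : invmx x *m y = invmx zx *m (invmx (phi x) *m phi y) *m zy.
      have ex' : x = invmx l *m phi x *m zx by rewrite -mulmxA -ex mulKmx.
      have ey' : y = invmx l *m phi y *m zy by rewrite -mulmxA -ey mulKmx.
      rewrite {1}ex' {1}ey'.
      have uph := Uunit _ px; have uz := Kunit _ kx.
      rewrite invmx_mul ?unitmx_mul ?unitmx_inv ?ul // invmx_mul ?unitmx_inv //.
      rewrite invmxK.
      by rewrite !mulmxA -[_ *m l *m invmx l]mulmxA mulmxV // mulmx1.
    by apply: Kgrp_mul ky; apply: Kgrp_mul h; apply: Kgrp_inv.
  have phiU x : x \in r -> Umg k (phi x).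
    by move=> /r2/hphi[z []].
  split.
  - rewrite map_inj_in_uniq // => x y xr yr e; apply: inj => //.
    by rewrite e mulVmx ?Uunit //; [apply: LG1|apply: phiU].
  - by move=> _ /mapP[x xr ->]; apply: phiU.
  - by move=> _ _ /mapP[x xr ->] /mapP[y yr ->] h; rewrite (inj x y).
  (* Covering uses the swap for l^-1, which carries g to a coset represented in r. *)
  - move=> g hg; have [y [z [hy kz e _]]] := lowH_swap Ck' (lowH_inv hl) hg.
    have [x xr /U0P[_ hx]] := r4 _ hy; exists (phi x); first exact: map_f.
    have [zx [px kx ex _]] := hphi _ (r2 _ xr).
    apply/U0P; split; first exact: Uquo.
    have -> : invmx (phi x) *m g = zx *m (invmx x *m y) *m z.
      have -> : g = l *m y *m z by rewrite -mulmxA -e mulKVmx.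
      have -> : l = phi x *m zx *m invmx x.
        by rewrite -ex -mulmxA mulmxV ?mulmx1 // Uunit //; apply: r2.
      by rewrite !mulmxA mulVmx ?mul1mx ?Uunit.
    by apply: Kgrp_mul kz; apply: Kgrp_mul hx.
rewrite {2}(howe_transversal hr' fin) (howe_transversal hr fin) size_map big_map.
rewrite linearZ; congr (_ *: _).
rewrite linear_sum big_seq [RHS]big_seq; apply: eq_bigr => x xr.
have hx := r2 _ xr; have [z [hy kz e ep]] := hphi _ hx.
rewrite linearZ /= ep; congr (_ *: _).
have sx : Sp x by case: hx => _ /Uni_Sp.
have sp : Sp (phi x) by case: hy => _ /Uni_Sp.
have sz : Sp z by case: kz.
by rewrite -(repM hrho) // e (repM hrho) // hfix.
Qed.

(** Averaging in stages, through the tower of U cap K_C inside U_k inside U_m. *)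
Lemma howe_average k m r : (k <= m)%N -> (mu (Umg m) < +oo)%E ->
  transversal (Umg m) (Umg k) r ->
  howe m = ((size r)%:R^-1 : R[i]) *: \sum_(x <- r) (psiU psi x)^-1 *: rho x (howe k).
Proof.
move=> km fin hr.
have fink : (mu (Umg k) < +oo)%E.
  apply: le_lt_trans fin; apply: le_measure; rewrite ?inE; try exact: measurable_LG.
  exact: Umg_sub.
have [s hs] := transversal_exists hmu (fC_group C) (fHowe_group k) (@U0_sub C k) fink.
have hrs := transversal_comp (fC_group C) (fHowe_group k) (fHowe_group m)
  (@U0_sub C k) (Umg_sub km) hr hs.
rewrite (howe_transversal hrs fin) (howe_transversal hs fink) size_allpairs.
rewrite natrM invfM -scalerA; congr (_ *: _).
rewrite big_allpairs_dep scaler_sumr big_seq [RHS]big_seq; apply: eq_bigr => x xr.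
have hx : Umg m x by case: hr => _ + _ _; apply.
rewrite linearZ /= scalerA [in RHS]mulrC -scalerA; congr (_ *: _).
rewrite linear_sum scaler_sumr big_seq [RHS]big_seq; apply: eq_bigr => y ys.
have hy : Umg k y by case: hs => _ + _ _; apply.
case: hx hy => _ hx [_ hy]; rewrite psiU_mul // invfM -scalerA; congr (_ *: _).
rewrite linearZ /=; congr (_ *: _).
by rewrite (repM hrho) //; apply: Uni_Sp.
Qed.

End Rep.

End HoweVectors.

(** * Root spaces and the group U_w^- *)

Section RootSpaces.
Variables (F : padicFieldType) (n : nat) (varpi : F).
Hypothesis hvarpi : uniformizer varpi.
Local Notation M := 'M[F]_(n + n).
Local Notation I := 'I_(n + n).
Local Notation chi := {ffun 'I_n -> int}.
Implicit Types (X x t u : M) (a b c : I) (g d : chi).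

Lemma varpi_expz_inj (y z : int) : varpi ^ y = varpi ^ z -> y = z.
Proof.
have [v0 _] := hvarpi.
suff le (i j : int) : varpi ^ i = varpi ^ j -> i <= j.
  by move=> e; apply/eqP; rewrite eq_le !le.
move=> e; have : pideal (i - j) (1 : F).
  have -> : 1 = varpi ^ (i - j) by rewrite expfzDr // e -expfzDr // subrr expr0z.
  exact: pideal_expz.
move=> [/eqP|]; first by rewrite oner_eq0.
by rewrite pval1; lia.
Qed.

Let dexp a : int := (2 * a + 1)%N%:Z - (2 * n)%N%:Z.
Let D : M := dmx n varpi 1.

Lemma dmx1E a b : D a b = varpi ^ dexp a *+ (a == b).
Proof. by rewrite !mxE mulr1. Qed.

(** The pairing of g with the cocharacter that gives d_1. Simple roots pair to -2, so positive roots
    are negative here and their root vectors are strictly upper triangular. *)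
Definition chi_height g : int := \sum_(i < n) dexp (lshift n i) * g i.

Lemma char_eval_dmx g : char_eval g D = varpi ^ chi_height g.
Proof.
have [v0 _] := hvarpi.
rewrite /char_eval /chi_height; elim/big_rec2: _ => [|i x y _ ->].
  by rewrite expr0z.
by rewrite expfzDr // dmx1E eqxx mulr1n exprz_exp.
Qed.

Lemma chi_heightD g d : chi_height (g + d) = chi_height g + chi_height d.
Proof.
by rewrite /chi_height -big_split; apply: eq_bigr => i _; rewrite ffunE mulrDr.
Qed.

Lemma chi_height0 : chi_height 0 = 0.
Proof. by rewrite /chi_height big1 // => i _; rewrite ffunE mulr0. Qed.

Lemma chi_heightN g : chi_height (- g) = - chi_height g.
Proof. by apply/eqP; rewrite -addr_eq0 -chi_heightD addNr chi_height0. Qed.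

Lemma chi_heightMn g k : chi_height (g *+ k) = chi_height g *+ k.
Proof.
elim: k => [|k IH]; first by rewrite !mulr0n chi_height0.
by rewrite !mulrS chi_heightD IH.
Qed.

Lemma chi_height_simple i : chi_height (simple_root i) = - 2.
Proof.
rewrite /chi_height; case: (boolP (i.+1 < n)%N) => hi.
  pose j := Ordinal hi; have ij : j != i by rewrite -val_eqE /=; lia.
  rewrite (bigD1 i) //= (bigD1 j) //= big1 => [|k /andP[ki kj]].
    rewrite !ffunE hi -!val_eqE /= !eqxx; have -> : (i.+1 == i)%N = false by lia.
    have -> : (i == i.+1 :> nat)%N = false by lia.
    by rewrite /dexp /=; lia.
  rewrite ffunE hi (negPf ki); have -> : (k == i.+1 :> nat) = false.
    by move: kj; rewrite -val_eqE /= => /negPf.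
  by rewrite subrr mulr0.
rewrite (bigD1 i) //= big1 => [|k ki].
  by rewrite ffunE (negPf hi) eqxx /dexp /=; have := ltn_ord i; lia.
by rewrite ffunE (negPf hi) (negPf ki) mulr0.
Qed.

Lemma pos_root_height g : pos_root F g -> chi_height g < 0.
Proof.
move=> [[g0 _] [c ec]].
have e : chi_height g = \sum_(i < n) (- 2) *+ c i.
  rewrite ec; elim/big_rec2: _ => [|i x y _ <-]; first exact: chi_height0.
  by rewrite chi_heightD chi_heightMn chi_height_simple.
have [i ci] : exists i, (0 < c i)%N.
  apply: contrapT => nex; case/eqP: g0; rewrite ec big1 // => i _.
  have -> : c i = 0%N by case: (posnP (c i)) => // ci; case: nex; exists i.
  by rewrite mulr0n.
rewrite e (bigD1 i) //=.
apply: le_lt_trans (_ : (- 2) *+ c i + 0 < 0).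
  rewrite lerD2l; apply: sumr_le0 => j _; rewrite mulNrn; lia.
by rewrite addr0 mulNrn; lia.
Qed.

Lemma weight_entry X t (z : F) a b : Tor t ->
  t *m X *m invmx t = z *: X -> X a b != 0 -> t a a = z * t b b.
Proof.
move=> ht e n0; have ut := Sp_unit (Tor_Sp ht); have /torP[_ u l] := ht.
have dt (c d : I) : c != d -> t c d = 0.
  by rewrite -val_eqE neq_ltn => /orP[]; [apply: l|apply: u].
have e1 : t *m X = z *: (X *m t) by rewrite scalemxAl -e -mulmxA mulVmx // mulmx1.
have := congr1 (fun Y : M => Y a b) e1; rewrite !mxE (bigD1 a) //= big1.
  rewrite (bigD1 b) //= big1 => [|c cb]; last by rewrite (dt c b cb) mulr0.
  rewrite !addr0 [X a b * _]mulrC mulrA => h; exact: (mulIf n0).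
by move=> c ca; rewrite dt ?mul0r // eq_sym.
Qed.

Lemma height_entry X z a b : D *m X *m invmx D = varpi ^ z *: X ->
  X a b != 0 -> dexp a - dexp b = z.
Proof.
have [v0 _] := hvarpi.
move=> e n0; have := weight_entry (Tor_dmx n hvarpi 1) e n0.
rewrite !dmx1E !eqxx !mulr1n -expfzDr // => /varpi_expz_inj ->.
by rewrite addrK.
Qed.

(** The value at varpi of a coordinate cocharacter; its diagonal entry at c differs from all the
    others. *)
Definition bump_tor c : M :=
  \matrix_(a, b) ((varpi ^ (if a == c then 1 else
     if a == rev_ord c then -1 else 0)) *+ (a == b)).

Lemma Tor_bump c : Tor (bump_tor c).
Proof.
have [v0 _] := hvarpi.
have ud : upper_mx (bump_tor c).
  move=> a b ba; rewrite mxE (_ : (a == b) = false) //.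
  by apply/negbTE; rewrite -val_eqE neq_ltn ba ?orbT.
have ld : lower_mx (bump_tor c).
  move=> a b ba; rewrite mxE (_ : (a == b) = false) //.
  by apply/negbTE; rewrite -val_eqE neq_ltn ba ?orbT.
apply/torP; split=> //; apply/SpP/upper_lower1.
- by apply: upper_mul => //; apply: upper_adj.
- by apply: lower_mul => //; apply: lower_adj.
- move=> a; rewrite upper_mul_diag //; last exact: upper_adj.
  rewrite !mxE !eqxx eps_mul mul1r !mulr1n -expfzDr //.
  rewrite [X in varpi ^ X](_ : _ = 0) ?expr0z // (inj_eq rev_ord_inj).
  have -> : (rev_ord a == c) = (a == rev_ord c).
    by rewrite -(inj_eq rev_ord_inj) rev_ordK.
  have [->|ac] := eqVneq a c; first by rewrite eq_sym rev_ord_neq.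
  by case: ifP.
Qed.

(** Nonzero entries of X at (a, c) and (c, b) would give t_a t_b = t_c^2 for t = [bump_tor c]:
    exponent 2 on the right, at most 0 on the left because a < c < b. *)
Lemma root_space_sq g X : root_space g X -> (forall a b, X a b != 0 -> (a < b)%N) ->
  X *m X = 0.
Proof.
have [v0 _] := hvarpi.
move=> [_ hX] sX; apply/matrixP => a b; rewrite mxE [RHS]mxE big1 // => c _.
apply/eqP/negPn/negP; rewrite mulf_eq0 negb_or => /andP[n1 n2].
have e1 := weight_entry (Tor_bump c) (hX _ (Tor_bump c)) n1.
have e2 := weight_entry (Tor_bump c) (hX _ (Tor_bump c)) n2.
have [ac cb] := (sX _ _ n1, sX _ _ n2).
have : bump_tor c a a * bump_tor c b b = bump_tor c c c * bump_tor c c c.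
  by rewrite e1 {3}e2; ring.
rewrite !mxE !eqxx !mulr1n -!expfzDr // => /varpi_expz_inj.
have -> : (a == c) = false by apply/negbTE; rewrite -val_eqE /=; lia.
have -> : (b == c) = false by apply/negbTE; rewrite -val_eqE /=; lia.
by case: ifP; case: ifP.
Qed.

Lemma sp_lie_adj X : sp_lie X -> sp_adj X = - X.
Proof.
move=> hX; apply/matrixP => a b; rewrite [LHS]mxE [RHS]mxE.
have := congr1 (fun Y : M => Y (rev_ord a) b) hX; rewrite /= !mxE.
rewrite (bigD1 (rev_ord b)) //= big1 => [|c cb]; last first.
  rewrite symp_formE; have -> : (b == rev_ord c) = false.
    by apply: contraNF cb => /eqP->; rewrite rev_ordK.
  by rewrite mulr0n !mulr0.
rewrite (bigD1 a) //= big1 => [|c cb]; last first.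
  by rewrite symp_formE rev_ordK (negPf cb) mulr0n mulr0 mul0r.
rewrite !symp_formE mxE !rev_ordK !eqxx !mulr1n !eps_rev !mulr1 !addr0 mulrN mulNr.
move/eqP; rewrite addrC subr_eq0 eqr_oppLR => /eqP e.
rewrite -mulrA [eps F b * _]mulrC -[X _ _ * _]opprK -e.
by rewrite mulrN mulrA eps_mul mul1r.
Qed.

(** Replaces the product over root subgroups by two triangularity conditions. They hold for each
    root element by the sign of its height and pass to products. *)
Lemma Uminus_spec (s : seq 'I_n) u : Uminus (weyl_word s) u ->
  Uni u /\ (lower_mx (word_mx F s *m u *m invmx (word_mx F s)) /\
            diag1_mx (word_mx F s *m u *m invmx (word_mx F s))).
Proof.
set x := word_mx F s.
have sx : Sp x by apply: Sp_word.
have ux := Sp_unit sx; have mx : mono (wperm s) x by apply: mono_word.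
have hD := Tor_dmx n hvarpi 1.
move=> [r [y [_ er hy ->]]].
pose P (u : M) := Uni u /\ (lower_mx (x *m u *m invmx x) /\
  diag1_mx (x *m u *m invmx x)).
rewrite -/(P _) big_seq; elim/big_ind: _.
- split; first exact: Uni1.
  by rewrite mulmx1 mulmxV //; split; [have /torP[] := @Tor1 F n|
    have /UniP[] := @Uni1 F n].
- move=> u1 u2 [h1 [l1 d1]] [h2 [l2 d2]].
  have e : x *m (u1 *m u2) *m invmx x =
      (x *m u1 *m invmx x) *m (x *m u2 *m invmx x).
    by rewrite !mulmxA -[_ *m invmx x *m x]mulmxA mulVmx // mulmx1.
  split; first exact: Uni_mul.
  rewrite e; split; first exact: lower_mul.
  by move=> a; rewrite lower_mul_diag // d1 d2 mulr1.
move=> g gr; have hg : [set` r] g by []; rewrite er in hg.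
have [X hX <-] := hy g hg; have [pg [d pd act]] := hg.
have [lX rX] := hX.
have sX a b : X a b != 0 -> (a < b)%N.
  move=> n0; have := rX _ hD; rewrite char_eval_dmx => /height_entry h.
  have := h _ _ n0; have := pos_root_height pg; rewrite /dexp; lia.
have X2 := root_space_sq hX sX.
have s1 : Sp (1%:M + X).
  apply/SpP.
  have -> : sp_adj (1%:M + X) = 1%:M - X.
    rewrite -(sp_lie_adj lX) -{2}(@sp_adj1 F n); apply/matrixP => a b.
    by rewrite !mxE mulrDr.
  by rewrite mulmxDr mulmx1 mulmxBl mul1mx X2 subr0 subrK.
pose X' := x *m X *m invmx x.
have eX' : x *m (1%:M + X) *m invmx x = 1%:M + X'.
  by rewrite mulmxDr mulmx1 mulmxDl mulmxV.
have sX' a b : X' a b != 0 -> (b < a)%N.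
  move=> n0.
  have hD' : Tor (invmx x *m D *m x).
    by rewrite -{2}[x]invmxK; apply: Tor_conj_mono (mono_inv mx) (Sp_inv sx) hD.
  (* By [weyl_act] the conjugated root vector has weight -d at D, of positive height, which forces
     its entries strictly below the diagonal. *)
  have e : D *m X' *m invmx D = varpi ^ chi_height (- d) *: X'.
    rewrite -char_eval_dmx (act _ _ (weyl_word_mem F s) hD).
    have := rX _ hD'; set z := char_eval _ _ => e.
    have ud' := Sp_unit (Tor_Sp hD'); have ud := Sp_unit (Tor_Sp hD).
    have e1 : (invmx x *m D *m x) *m X = z *: (X *m (invmx x *m D *m x)).
      by rewrite scalemxAl -e -[RHS]mulmxA [invmx _ *m (_ *m x)]mulVmx // mulmx1.
    have e2 : D *m X' = z *: (X' *m D).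
      have -> : D *m X' = x *m ((invmx x *m D *m x) *m X) *m invmx x.
        by rewrite /X' !mulmxA mulmxV // mul1mx.
      rewrite e1 -scalemxAr -scalemxAl; congr (_ *: _).
      by rewrite /X' !mulmxA -[_ *m x *m invmx x]mulmxA mulmxV // mulmx1.
    by rewrite e2 -scalemxAl -mulmxA mulmxV // mulmx1.
  have := height_entry e n0; have := pos_root_height pd.
  by rewrite chi_heightN /dexp; lia.
have X0 (Z : M) a b : Z a b = 0 -> (1%:M + Z) a b = (a == b)%:R.
  by move=> e; rewrite mxE e addr0 mxE.
split.
  apply/UniP; split=> // [a|a b ba].
    rewrite X0 ?eqxx //; apply/eqP/negPn/negP => /sX; by rewrite ltnn.
  rewrite X0; first by case: eqP => // e; rewrite e ltnn in ba.
  by apply/eqP/negPn/negP => /sX; lia.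
rewrite eX'; split=> [a b ba|a].
  rewrite X0; first by case: eqP => // e; rewrite e ltnn in ba.
  by apply/eqP/negPn/negP => /sX'; lia.
by rewrite X0 ?eqxx //; apply/eqP/negPn/negP => /sX'; rewrite ltnn.
Qed.

End RootSpaces.

(** * Words, lengths, and the splitting of unipotent elements *)

Section Words.
Variables (F : padicFieldType) (n : nat).
Local Notation M := 'M[F]_(n + n).
Implicit Types (s : seq 'I_n).

(** [weyl_length] is defined by [xget] with default 0; a word for w guarantees that a minimal size
    exists and that the default is not taken for want of one. *)
Lemma weyl_length_spec (w : set M) s : weyl_word s = w -> exists s0,
  [/\ weyl_word s0 = w, size s0 = weyl_length w &
      forall s', weyl_word s' = w -> (weyl_length w <= size s')%N].
Proof.
move=> es.
pose Q k := `[<exists2 s', size s' = k & @weyl_word F n s' = w>].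
have exQ : exists k, Q k by exists (size s); apply/asboolP; exists s.
case: (ex_minnP exQ) => k /asboolP[s0 sz0 es0] kmin.
have : [set k | (exists2 s, size s = k & weyl_word s = w) /\
    forall s, weyl_word s = w -> (k <= size s)%N] k.
  split; first by exists s0.
  by move=> s' es'; apply: kmin; apply/asboolP; exists s'.
move=> /(xgetI 0%N) /= [[s1 sz1 es1] h]; exists s1; split=> //.
Qed.

Lemma bruhat_cell_coset s s' (g : M) : @weyl_word F n s = weyl_word s' ->
  bruhat_cell (word_mx F s) g -> bruhat_cell (word_mx F s') g.
Proof.
move=> e [b1 [b2 [h1 h2 ->]]].
have : @weyl_word F n s' (word_mx F s) by rewrite -e; apply: weyl_word_mem.
move=> [t ht <-]; exists b1, (t *m b2); split=> //; last by rewrite !mulmxA.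
by apply: Bor_mul h2; apply: Tor_Bor.
Qed.

Lemma bruhat_cell_normal s (g : M) : bruhat_cell (word_mx F s) g ->
  exists u t u', [/\ Uni u, Tor t, Uni u' & g = u *m (t *m word_mx F s *m u')].
Proof.
set x := word_mx F s; have sx : Sp x by apply: Sp_word.
have ux := Sp_unit sx.
move=> [_ [_ [[t1 [u1 [ht1 hu1 ->]]] [t2 [u2 [ht2 hu2 ->]]] ->]]].
have ut1 := Sp_unit (Tor_Sp ht1).
exists (t1 *m u1 *m invmx t1), (t1 *m (x *m t2 *m invmx x)), u2; split=> //.
- exact: Uni_conj_Tor.
- by apply: Tor_mul => //; apply: Tor_conj_mono (mono_word F s) sx ht2.
- rewrite !mulmxA -[_ *m invmx t1 *m t1]mulmxA mulVmx // mulmx1.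
  by rewrite -[_ *m invmx x *m x]mulmxA mulVmx // mulmx1.
Qed.

Lemma bruhat_cell_Sp s (g : M) : bruhat_cell (word_mx F s) g -> Sp g.
Proof.
move=> [b1 [b2 [h1 h2 ->]]]; apply: Sp_mul (Bor_Sp h2).
by apply: Sp_mul (Bor_Sp h1) _; apply: Sp_word.
Qed.

(* [u] lies in (U cap w^-1 U w) U_m. *)
Definition splits m s (u : M) := exists u' h : M, [/\ u = u' *m h, Uni u',
  Uni (word_mx F s *m u' *m invmx (word_mx F s)) & LG (fHowe (n := n) m) h].

Lemma splits_nil m u : Uni u -> splits m [::] u.
Proof.
move=> hu; exists u, 1%:M; split; rewrite ?mulmx1 //; last exact: LG1.
have -> : word_mx F [::] = 1%:M :> M by rewrite /word_mx big_nil.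
by rewrite mul1mx invmx1 mulmx1.
Qed.

Lemma splits_mulr m s u x : LG (fHowe (n := n) m) x ->
  splits m s (u *m x) -> splits m s u.
Proof.
move=> hx [u' [h [e h1 h2 h3]]]; exists u', (h *m invmx x); split=> //.
  by rewrite mulmxA -e mulmxK //; apply: LG_unit hx.
by apply: LG_mul => //; [apply: fHowe_group|apply: LG_inv => //; apply: fHowe_group].
Qed.

(** Write u = u' h. Conjugated by w, u is lower unipotent and u' upper, so w u w^-1 must be the
    lower unipotent factor of w h w^-1. That factor lies in the lattice of w H_m w^-1, and
    conjugating back puts u in H_m. *)
Lemma Uminus_not_splits varpi m s u : uniformizer varpi ->
  (0 < m)%N -> Uminus (weyl_word s) u -> splits m s u -> Hgrp varpi m u.
Proof.
move=> hv m0 /(Uminus_spec hv)[hu [lu du]].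
set x := word_mx F s in lu du *.
have sx : Sp x by apply: Sp_word.
have ux := Sp_unit sx; have mx : mono (wperm s) x by apply: mono_word.
move=> [u' [h [e hu' hxu' [hh1 hh2]]]]; rewrite -/x in hxu'.
apply/HgrpP => //; split; first exact: Uni_Sp.
pose f a b := fHowe (n := n) m (wperm s a) (wperm s b).
have ff a c b : f a b <= f a c + f c b by apply: fHowe_mul.
have f1 a : 1 <= f a a by rewrite /f /fHowe /fH; lia.
have shx : Sp (x *m h *m invmx x).
  exact: Sp_mul (Sp_mul sx (Uni_Sp hh2)) (Sp_inv sx).
have lhx : latt f (x *m h *m invmx x - 1%:M).
  by rewrite conj_sub1 //; apply: mono_latt mx _ hh1.
have [u2 [t2 [l2 [e2 [h1 _] [h2 _] [h3 h4 h5 h6]]]]] := sp_udl ff f1 shx lhx.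
have sxu : Sp (x *m u *m invmx x).
  exact: Sp_mul (Sp_mul sx (Uni_Sp hu)) (Sp_inv sx).
have el : x *m u *m invmx x = l2.
  apply: (@lower_unip_unique _ _ 1%:M ((x *m u' *m invmx x) *m (u2 *m t2))) => //.
  - exact: Uni_Bor (@Uni1 _ _).
  - by apply: Bor_mul (Uni_Bor hxu') (Bor_mul (Uni_Bor h1) (Tor_Bor h2)).
  - rewrite mul1mx -[RHS]mulmxA -e2 e !mulmxA -[_ *m invmx x *m x]mulmxA.
    by rewrite mulVmx // mulmx1.
have eu : u - 1%:M = invmx x *m (l2 - 1%:M) *m invmx (invmx x).
  rewrite -el conj_sub1 // invmxK !mulmxA mulVmx // mul1mx.
  by rewrite -mulmxA mulVmx // mulmx1.
rewrite eu; apply: mono_latt (mono_inv mx) _ h6 => a b.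
by rewrite /f !permKV.
Qed.

End Words.

(** * The thresholds 4^a C *)

Section Levels.
Variables (l : nat) (a : nat -> nat).
Hypothesis ha : forall j, (0 < j <= l)%N -> (j + a j.-1 <= a j)%N.

Lemma level_mono i j : (i <= j <= l)%N -> (a i <= a j)%N.
Proof.
elim: j => [|j IH] /andP[ij js]; first by have -> : i = 0%N by lia.
have [->//|ne] := eqVneq i j.+1.
have h1 : (a i <= a j)%N by apply: IH; lia.
by have := @ha j.+1 js; rewrite /=; lia.
Qed.

(** a_j exceeds a_{j-1} by at least 1, so the threshold drops by a factor of at least 4, which
    covers the 3 of [lowH_fK]. *)
Lemma level_step C j m : (0 < j <= l)%N -> (4 ^ a j * C <= m)%N ->
  (C <= 4 ^ a j.-1 * C)%N /\ (3 * (4 ^ a j.-1 * C) <= m)%N.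
Proof.
move=> hj hm; have := ha hj => h; split; first by rewrite leq_pmull // expn_gt0.
apply: leq_trans hm; have : (4 ^ (a j.-1).+1 <= 4 ^ a j)%N.
  by rewrite leq_exp2l //; lia.
rewrite expnS => h'; rewrite mulnA; apply: leq_mul => //.
by apply: leq_trans h'; rewrite leq_mul2r orbT.
Qed.

End Levels.

(** * Comparing the two Whittaker functions cell by cell *)

Section Comparison.
Variables (R : realType) (F : padicFieldType) (n : nat) (varpi : F).
Hypothesis hvarpi : uniformizer varpi.
Variable psi : F -> R[i].
Hypothesis hpsi : additive_character_of_conductor_O psi.
Variable mu : {measure set (borel_mx F n) -> \bar R}.
Hypothesis hmu : haar_measure (@Uni F n) mu.
Variables (V V' : lmodType R[i]).
Variables (rho : 'M[F]_(n + n) -> {linear V -> V}).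
Variables (rho' : 'M[F]_(n + n) -> {linear V' -> V'}).
Hypotheses (hrho : representation rho) (hrho' : representation rho').
Variables (lambda : {scalar V}) (lambda' : {scalar V'}).
Hypothesis hlambda : whittaker_functional psi rho lambda.
Hypothesis hlambda' : whittaker_functional psi rho' lambda'.
Variables (v : V) (v' : V') (C : nat).
Hypothesis hC : (0 < C)%N.
Hypothesis hfix : forall k, Kgrp C k -> rho k v = v.
Hypothesis hfix' : forall k, Kgrp C k -> rho' k v' = v'.

Local Notation M := 'M[F]_(n + n).
Local Notation I := 'I_(n + n).
Implicit Types (g x u t : M) (s : seq 'I_n) (k m : nat).

Local Notation W k := (whittaker rho lambda (howe_vector varpi psi rho mu k v)).
Local Notation W' k :=
  (whittaker rho' lambda' (howe_vector varpi psi rho' mu k v')).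
Local Notation Umg m := (LG (fHowe (n := n) m) : set M).

Definition agree k g := W k g = W' k g.

Lemma agree_Uni k u g : Uni u -> Sp g -> agree k g -> agree k (u *m g).
Proof.
rewrite /agree /whittaker => hu sg e; have su := Uni_Sp hu.
rewrite (repM hrho) // (repM hrho') //.
by rewrite (proj2 hlambda) // (proj2 hlambda') // e.
Qed.

Lemma agree_Um m u g : Umg m u -> Sp g -> agree m g -> agree m (g *m u).
Proof.
rewrite /agree /whittaker => hu sg e; have su : Sp u by case: hu => _ /Uni_Sp.
rewrite (repM hrho) // (repM hrho') //.
rewrite (howe_equivariant hvarpi hpsi hmu hrho hfix hu).
rewrite (howe_equivariant hvarpi hpsi hmu hrho' hfix' hu).
move: (howe_vector _ _ rho _ _ _) (howe_vector _ _ rho' _ _ _) e => z z' e.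
by rewrite !linearZ /= e.
Qed.

Lemma agree_lower k l g : (C <= k)%N -> lowH k l -> Sp g ->
  agree k g -> agree k (g *m l).
Proof.
rewrite /agree /whittaker => Ck hl sg e; have sl : Sp l by case: hl.
rewrite (repM hrho) // (repM hrho') //.
rewrite (howe_lower hvarpi hpsi hmu hrho hC hfix Ck hl).
by rewrite (howe_lower hvarpi hpsi hmu hrho' hC hfix' Ck hl).
Qed.

Lemma agree_average k m g : (k <= m)%N -> Sp g ->
  (forall x, Umg m x -> agree k (g *m x)) -> agree m g.
Proof.
move=> km sg h; rewrite /agree /whittaker.
have [inf|fin] := mu_dichotomy mu m.
  rewrite (howe_infinite hvarpi psi rho v inf).
  by rewrite (howe_infinite hvarpi psi rho' v' inf) !linear0.
have [r hr] := transversal_exists hmu (fHowe_group n k) (fHowe_group n m)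
  (Umg_sub km) fin.
rewrite (howe_average hvarpi hpsi hmu hrho hfix km fin hr).
rewrite (howe_average hvarpi hpsi hmu hrho' hfix' km fin hr).
move: h; rewrite /agree /whittaker.
move: (howe_vector _ _ rho _ _ _) (howe_vector _ _ rho' _ _ _) => z z' h.
rewrite !linearZ /=; congr (_ * _); rewrite !linear_sum /=.
rewrite big_seq [RHS]big_seq; apply: eq_bigr => x xr.
have hx : Umg m x by case: hr => _ + _ _; apply.
have sx : Sp x by case: hx => _ /Uni_Sp.
rewrite !linearZ /=; congr (_ * _).
by have := h x hx; rewrite (repM hrho) // (repM hrho').
Qed.

(** Origin of the factor 3: at distance d below the diagonal [fK] guarantees exponent (2d - 1)m + 1
    and H_k asks for (2d + 1)k; the tightest case d = 1 reads m + 1 >= 3k. *)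
Lemma lowH_fK k m (X Y : pred I) (l : M) : (3 * k <= m)%N -> Sp l -> lower_mx l ->
  diag1_mx l -> latt (fK (th (n := n) m) m%:Z X Y) (l - 1%:M) -> lowH k l.
Proof.
move=> km sl ll dl hl; split=> // a b.
have [lt|le] := ltnP b a.
  apply: pideal_le (hl a b); rewrite /fHowe /fH /fK /th.
  have [d ed] : exists d, (a : nat) = (b + d.+1)%N by exists (a - b.+1)%N; lia.
  by rewrite ed; move: (X a) (Y b) => [] []; nia.
rewrite !mxE; have [->|ab] := eqVneq a b; first by rewrite dl subrr; apply: pideal0.
rewrite ll ?subrr; first exact: pideal0.
by rewrite ltn_neqAle le andbT val_eqE.
Qed.

(** Failing to split is invariant under right translation by U_m, so every term of the average falls
    under the first alternative of [key_decomposition]. The upper part of g is absorbed into a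
    smaller cell, the lower part into H_k. *)
Lemma agree_not_splits k m s t u : (C <= k)%N -> (3 * k <= m)%N ->
  good (th (n := n) m) (rev s) ->
  (forall s' g, subseq s' s -> (size s' < size s)%N ->
     bruhat_cell (word_mx F s') g -> agree k g) ->
  Tor t -> Uni u -> ~ splits m s u -> agree m (t *m word_mx F s *m u).
Proof.
move=> Ck km gs IH ht hu ns.
have st := Tor_Sp ht; have sw := Sp_word F s.
apply: (@agree_average k); first by lia.
  exact: Sp_mul (Sp_mul st sw) (Uni_Sp hu).
move=> x hx; have hux : Uni (u *m x) by apply: Uni_mul hu _; case: hx.
have m0 : 0 <= m%:Z by lia.
have [] := key_decomposition m0 (th_sym n m) gs hux; rewrite revK; last first.
  move=> [u' [h [e h1 h2 [h3 h4] _]]]; case: ns; apply: (splits_mulr hx).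
  by exists u', h; split.
move=> [s' [c [g [X [Y [[ss sz] [s2 ss2 hc] e sg [dXY lg]]]]]]].
rewrite size_rev in sz.
have [u2 [t2 [l [eg [h1 _] [h2 _] [h3 h4 h5 h6]]]]] :=
  sp_udl (fun a c b => fK_mul _ a b m0 (dXY c)) (fun a => fK_diag _ m0 (dXY a)) sg lg.
have cell : bruhat_cell (word_mx F s2) (t *m c *m (u2 *m t2)).
  case: hc => b1 [b2 [hb1 hb2 ->]]; exists (t *m b1), (b2 *m (u2 *m t2)); split.
  - exact: Bor_mul (Tor_Bor ht) hb1.
  - exact: Bor_mul hb2 (Bor_mul (Uni_Bor h1) (Tor_Bor h2)).
  - by rewrite !mulmxA.
have -> : t *m word_mx F s *m u *m x = t *m c *m (u2 *m t2) *m l.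
  by rewrite -!mulmxA [word_mx F s *m _]e eg !mulmxA.
apply: (agree_lower Ck); first exact: lowH_fK km h3 h4 h5 h6.
  exact: bruhat_cell_Sp cell.
apply: IH cell; first exact: subseq_trans ss2 ss.
by apply: leq_ltn_trans sz; apply: size_subseq.
Qed.

(** After moving u' across w, it acts on the left and h on the right, both through psi_U and with
    the same factor for the two representations. *)
Lemma agree_splits m s t u : (forall t, Tor t -> agree m (t *m word_mx F s)) ->
  Tor t -> splits m s u -> agree m (t *m word_mx F s *m u).
Proof.
move=> H ht [u' [h [-> h1 h2 h3]]].
have st := Tor_Sp ht; have sx := Sp_word F s; have ux := Sp_unit sx.
rewrite mulmxA; apply: agree_Um => //.
  exact: Sp_mul (Sp_mul st sx) (Uni_Sp h1).
have -> : t *m word_mx F s *m u' = (t *m (word_mx F s *m u' *m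
    invmx (word_mx F s)) *m invmx t) *m (t *m word_mx F s).
  rewrite !mulmxA -[_ *m invmx t *m t]mulmxA mulVmx ?Sp_unit // mulmx1.
  by rewrite -[_ *m invmx _ *m word_mx F s]mulmxA mulVmx // mulmx1.
apply: agree_Uni; [exact: Uni_conj_Tor|exact: Sp_mul|exact: H].
Qed.

Variables (s0 : seq 'I_n) (a : nat -> nat).
Hypothesis ha : forall j, (0 < j <= size s0)%N -> (j + a j.-1 <= a j)%N.

(** The bound L serves both parts of the theorem: it admits only the proper subwords of the reduced
    word, or that word as well. *)
Lemma agree_cells L :
  (forall s k t, subseq s s0 -> (size s < L)%N -> (4 ^ a (size s) * C <= k)%N ->
     Tor t -> agree k (t *m word_mx F s)) ->
  forall s k g, subseq s s0 -> (size s < L)%N -> (4 ^ a (size s) * C <= k)%N ->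
     bruhat_cell (word_mx F s) g -> agree k g.
Proof.
move=> H s; have [N sN] := ubnP (size s); elim: N s sN => // N IH s sN k g ss sL hk hg.
have szs : (size s <= size s0)%N by apply: size_subseq.
(* A word that is not good defines the same cell as a shorter subword, whose threshold is no larger
   because a is monotone. *)
have [gd|ng] := pselect (good (th (n := n) k) (rev s)); last first.
  have k0 : (0 < k)%N by apply: leq_trans hk; rewrite muln_gt0 hC expn_gt0.
  have inc (b c : I) : (b < c)%N -> th k b < th k c.
    by rewrite /th ltz_nat ltn_pmul2l // muln_gt0.
  have [s' [ss' sz'] e] := not_good_exchange F inc ng.
  rewrite revK in ss' e; rewrite size_rev in sz'.
  have lt1 : (size s' < N)%N by exact: leq_trans sz' sN.
  have lt2 : (size s' < L)%N by exact: ltn_trans sz' sL.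
  apply: (IH s' lt1 k g) => //; first exact: subseq_trans ss' ss.
    apply: leq_trans hk; rewrite leq_mul2r leq_exp2l // (level_mono ha) ?orbT //.
    by rewrite (ltnW sz').
  exact: bruhat_cell_coset (esym e) hg.
have [u [t [u' [hu ht hu' ->]]]] := bruhat_cell_normal hg.
have sw := Sp_word F s; have st := Tor_Sp ht.
apply: agree_Uni => //; first exact: Sp_mul (Sp_mul st sw) (Uni_Sp hu').
have [sp|ns] := pselect (splits k s u').
  by apply: agree_splits => // t' ht'; apply: H.
have s_gt0 : (0 < size s)%N.
  by case: (s) ns => // ns; case: ns; apply: splits_nil.
(* The lower level is 4^(a (size s - 1)) C: it reaches the threshold of every shorter subword, and
   three times it is at most k. *)
have [|Ck km] := level_step ha _ hk; first by rewrite s_gt0.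
apply: agree_not_splits Ck km gd _ ht hu' ns => s' g' ss' sz' hg'.
have lt1 : (size s' < N)%N by exact: leq_trans sz' sN.
have lt2 : (size s' < L)%N by exact: ltn_trans sz' sL.
apply: (IH s' lt1 _ g') => //; first exact: subseq_trans ss' ss.
rewrite leq_mul2r leq_exp2l // (level_mono ha) ?orbT //; apply/andP; split.
  by move: sz'; case: (size s).
exact: leq_trans (leq_pred _) szs.
Qed.

End Comparison.

(** * From subwords of a reduced word to Weyl elements below w *)

Theorem theorem3p11 (R : realType) (F : padicFieldType) (n : nat)
  (hn : (1 < n)%N)
  (varpi : F) (hvarpi : uniformizer varpi)
  (psi : F -> R[i]) (hpsi : additive_character_of_conductor_O psi)
  (mu : {measure set (borel_mx F n) -> \bar R})
  (hmu : haar_measure (@Uni F n) mu)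
  (V V' : lmodType R[i])
  (rho : 'M[F]_(n + n) -> {linear V -> V})
  (rho' : 'M[F]_(n + n) -> {linear V' -> V'})
  (hrho : representation rho) (hrho' : representation rho')
  (hsm : smooth_rep rho) (hsm' : smooth_rep rho')
  (hirr : irreducible_rep rho) (hirr' : irreducible_rep rho')
  (lambda : {scalar V}) (lambda' : {scalar V'})
  (hlambda : whittaker_functional psi rho lambda)
  (hlambda' : whittaker_functional psi rho' lambda')
  (omega : 'M[F]_(n + n) -> R[i])
  (homega : central_character rho omega)
  (homega' : central_character rho' omega)
  (v : V) (v' : V')
  (hv : whittaker rho lambda v 1%:M = 1)
  (hv' : whittaker rho' lambda' v' 1%:M = 1)
  (C : nat) (hC : (0 < C)%N)
  (hfix : forall k, Kgrp C k -> rho k v = v)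
  (hfix' : forall k, Kgrp C k -> rho' k v' = v')
  (rep : set 'M[F]_(n + n) -> 'M[F]_(n + n))
  (hrep : forall x, weyl x -> x (rep x))
  (w : set 'M[F]_(n + n)) (hw : weyl w) (hw0 : bruhat_le w (@w0 F n))
  (a : nat -> nat) (ha0 : a 0%N = 0%N)
  (ha : forall t, (0 < t <= weyl_length w)%N -> (t + a t.-1 <= a t)%N)
  (m : nat) (hm : (4 ^ a (weyl_length w) * C <= m)%N) :
  let W k := whittaker rho lambda (howe_vector varpi psi rho mu k v) in
  let W' k := whittaker rho' lambda' (howe_vector varpi psi rho' mu k v') in
  ((forall w' k t, weyl w' -> bruhat_lt w' w ->
      (4 ^ a (weyl_length w') * C <= k)%N -> Tor t ->
      W k (t *m rep w') = W' k (t *m rep w')) ->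
   forall t u, Tor t -> (Uminus w `\` Uminus_m varpi w m) u ->
     W m (t *m rep w *m u) = W' m (t *m rep w *m u))
  /\
  ((forall w' k t, weyl w' -> bruhat_le w' w ->
      (4 ^ a (weyl_length w') * C <= k)%N -> Tor t ->
      W k (t *m rep w') = W' k (t *m rep w')) ->
   forall g, bruhat_cell (rep w) g -> W m g = W' m g).
Proof.
move=> W W'.
have [s1 es1] : exists s1, weyl_word s1 = w.
  by case: hw0 => s [s' [_ _ ->]]; exists s'.
have [s [es sl smin]] := weyl_length_spec es1.
have m0 : (0 < m)%N by apply: leq_trans hm; rewrite muln_gt0 hC expn_gt0.
have has j : (0 < j <= size s)%N -> (j + a j.-1 <= a j)%N.
  by rewrite sl; apply: ha.
have inc (b c : 'I_(n + n)) : (b < c)%N -> th m b < th m c.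
  by rewrite /th ltz_nat ltn_pmul2l // muln_gt0.
have gs : good (th (n := n) m) (rev s).
  apply: contrapT => /(not_good_exchange F inc)[s' [_ lt] e].
  rewrite revK in e; rewrite size_rev sl in lt.
  by have := smin s' (etrans e es); rewrite leqNgt lt.
pose ag := agree varpi psi mu rho rho' lambda lambda' v v'.
(* The fixed representative and the word matrix differ by T, which the word normalizes, so the
   difference is absorbed in t. *)
have repE s' : exists2 d, Tor d & rep (weyl_word s') = word_mx F s' *m d.
  by have := hrep _ (weyl_weyl_word F s') => -[d hd <-]; exists d.
have tor_word k s' : (forall t, Tor t -> W k (t *m rep (weyl_word s')) =
      W' k (t *m rep (weyl_word s'))) ->
    forall t, Tor t -> ag k (t *m word_mx F s').
  move=> h t ht; have [d hd ed] := repE s'.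
  have sx := Sp_word F s'; have ud := Sp_unit (Tor_Sp hd).
  have -> : t *m word_mx F s' = t *m (word_mx F s' *m invmx d *m
      invmx (word_mx F s')) *m rep (weyl_word s').
    rewrite ed !mulmxA -[_ *m invmx (word_mx F s') *m _]mulmxA.
    by rewrite mulVmx ?Sp_unit // mulmx1 -mulmxA mulVmx // mulmx1.
  apply: h; apply: Tor_mul => //.
  exact: Tor_conj_mono (mono_word F s') sx (Tor_inv hd).
have short s' : (weyl_length (@weyl_word F n s') <= size s')%N.
  by have [s2 [_ _]] := weyl_length_spec (erefl (@weyl_word F n s')); apply.
(* A subword need not be reduced; the threshold attached to its size is then at least the one
   attached to the length of its element. *)
have levels s' k : subseq s' s -> (4 ^ a (size s') * C <= k)%N ->
    (4 ^ a (weyl_length (@weyl_word F n s')) * C <= k)%N.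
  move=> ss; apply: leq_trans; rewrite leq_mul2r leq_exp2l //.
  by rewrite (level_mono has) ?orbT // short size_subseq.
have ble s' : subseq s' s -> bruhat_le (@weyl_word F n s') w.
  by move=> ss; exists s, s'.
have cells := agree_cells hvarpi hpsi hmu hrho hrho' hlambda hlambda' hC hfix hfix' has.
have hms : (4 ^ a (size s) * C <= m)%N by rewrite sl.
split=> H.
- move=> t u ht [hu nu]; rewrite -es in hu.
  have [d hd ed] := repE s; rewrite -es ed.
  have sx := Sp_word F s; have [hu1 _] := Uminus_spec hvarpi hu.
  have -> : t *m (word_mx F s *m d) *m u = t *m (word_mx F s *m d *m
      invmx (word_mx F s)) *m word_mx F s *m u.
    rewrite !mulmxA -[_ *m invmx (word_mx F s) *m _]mulmxA.
    by rewrite mulVmx ?Sp_unit // mulmx1.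
  have ns : ~ splits m s u.
    move=> sp; apply: nu; split; first by rewrite -es.
    exact: Uminus_not_splits hvarpi m0 hu sp.
  have s_gt0 : (0 < size s)%N.
    by rewrite lt0n; apply/eqP => /size0nil e0; apply: ns; rewrite e0; apply: splits_nil.
  have [|Ck km] := level_step has _ hms; first by rewrite s_gt0 leqnn.
  apply: (agree_not_splits hvarpi hpsi hmu hrho hrho' hC hfix hfix' Ck km gs) => //.
    move=> s' g ss sz; apply: (cells (size s)) => //.
      move=> s2 k t2 ss2 sz2 hk ht2; apply: (tor_word) => // t' ht'.
      apply: H => //; [exact: weyl_weyl_word| |exact: levels].
      split; first exact: ble.
      (* A word shorter than the reduced word s cannot represent w, which makes the Bruhat
         inequality strict. *)
      by move=> e; have := smin s2 e; rewrite -sl leqNgt sz2.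
    rewrite leq_mul2r leq_exp2l // (level_mono has) ?orbT //.
    by rewrite leq_pred andbT -ltnS prednK.
  apply: Tor_mul => //; exact: Tor_conj_mono (mono_word F s) sx hd.
(* One more than the size admits s itself, since the hypothesis now includes w. *)
- move=> g hg; apply: (cells (size s).+1 _ s) => //.
    move=> s2 k t2 ss2 sz2 hk ht2; apply: tor_word => // t' ht'.
    by apply: H => //; [exact: weyl_weyl_word|exact: ble|exact: levels].
  have [d hd ed] := repE s; move: hg; rewrite -es ed => -[b1 [b2 [h1 h2 ->]]].
  exists b1, (d *m b2); split=> //; last by rewrite !mulmxA.
  exact: Bor_mul (Tor_Bor hd) h2.
Qed.
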